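(* Assume the following. Likelihood conditions. (i) For every $n$, $V_{n1},\dots,V_{nn}$ are i.i.d. with density $f_n(\cdot,\beta_{n0})$, the densities $f_n(\cdot,\beta_n)$ have a common support, the model is identifiable, and for $j,k=1,\dots,p_n$ $$E\Big\{\frac{\partial \log f_n(V_{n1},\beta_{n0})}{\partial\beta_{nj}}\Big\}=0,\qquad E\Big\{\frac{\partial \log f_n(V_{n1},\beta_{n0})}{\partial\beta_{nj}}\frac{\partial \log f_n(V_{n1},\beta_{n0})}{\partial\beta_{nk}}\Big\}=-E\Big\{\frac{\partial^2 \log f_n(V_{n1},\beta_{n0})}{\partial\beta_{nj}\,\partial\beta_{nk}}\Big\}.$$ (ii) There are constants $C_1,C_2,C_3,C_4$ such that for all $n$ and all $j,k=1,\dots,p_n$: $0<C_1<\lambda_{\min}\{I_n(\beta_{n0})\}\le\lambda_{\max}\{I_n(\beta_{n0})\}<C_2<\infty$, $E\{\frac{\partial \log f_n(V_{n1},\beta_{n0})}{\partial\beta_{nj}}\frac{\partial \log f_n(V_{n1},\beta_{n0})}{\partial\beta_{nk}}\}^2<C_3<\infty$ and $E\{\frac{\partial^2 \log f_n(V_{n1},\beta_{n0})}{\partial\beta_{nj}\partial\beta_{nk}}\}^2<C_4<\infty$. (iii) There are open sets $\omega_n\subset\Omega_n$ containing $\beta_{n0}$, large enough that for every $K>0$ one has $\{\beta:\|\beta-\beta_{n0}\|\le K\sqrt{p_n/n}\}\subset\omega_n$ for all sufficiently large $n$, such that for almost all $V_{ni}$ the density admits all third derivatives in $\beta_n$ for all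 $\beta_n\in\omega_n$; and there are functions $M_{njkl}$ and a constant $C_5<\infty$ with $\big|\frac{\partial^3\log f_n(V_{ni},\beta_n)}{\partial\beta_{nj}\partial\beta_{nk}\partial\beta_{nl}}\big|\le M_{njkl}(V_{ni})$ for all $\beta_n\in\omega_n$ and $E\{M_{njkl}^2(V_{ni})\}<C_5$ for all $n,j,k,l$. (iv) $\beta_{n0,1},\dots,\beta_{n0,s_n}$ are nonzero, $\beta_{n0,s_n+1},\dots,\beta_{n0,p_n}$ are zero, and $\min_{1\le j\le s_n}|\beta_{n0,j}|/\lambda_n\to\infty$ as $n\to\infty$. Penalty conditions. (v) $\liminf_{n\to\infty}\liminf_{\theta\to0+}p'_{\lambda_n}(\theta)/\lambda_n>0$. (vi) $a_n=O(n^{-1/2})$. (vii) $b_n\to0$ as $n\to\infty$. (viii) There are constants $C$ and $D$ such that $|p''_{\lambda_n}(\theta_1)-p''_{\lambda_n}(\theta_2)|\le D|\theta_1-\theta_2|$ whenever $\theta_1,\theta_2>C\lambda_n$. Suppose $\lambda_n\to0$, $\sqrt{n/p_n}\,\lambda_n\to\infty$ and $p_n^5/n\to0$ as $n\to\infty$. Let $\hat\beta_n=(\hat\beta_{n1}^T,\hat\beta_{n2}^T)^T$, with $\hat\beta_{n1}\in\mathbb{R}^{s_n}$, be a root-$(n/p_n)$-consistent local maximizer of $Q_n$, i.e. $\|\hat\beta_n-\beta_{n0}\|=O_p(\sqrt{p_n/n})$. Then, with probability tending to $1$, $\hat\beta_n$ must satisfy: (1) (Sparsity) $\hat\beta_{n2}=0$;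 (2) (Asymptotic normality) $$\sqrt{n}\,A_nI_n^{-1/2}(\beta_{n01})\{I_n(\beta_{n01})+\Sigma_{\lambda_n}\}\big[\hat\beta_{n1}-\beta_{n01}+\{I_n(\beta_{n01})+\Sigma_{\lambda_n}\}^{-1}\mathbf{b}_n\big]\xrightarrow{\mathcal D}\mathcal N(0,G),$$ where $q$ is a fixed integer, $A_n$ is a $q\times s_n$ matrix such that $A_nA_n^T\to G$, and $G$ is a $q\times q$ nonnegative symmetric matrix.
   Context: For each $n$, $s_n\le p_n$ are positive integers, $\Omega_n\subset\mathbb{R}^{p_n}$ is a parameter space, $\{f_n(\cdot,\beta_n):\beta_n\in\Omega_n\}$ is a parametric family of probability densities, $\beta_{n0}\in\Omega_n$ is the true parameter, and $V_{n1},\dots,V_{nn}$ are i.i.d. with density $f_n(\cdot,\beta_{n0})$; $E$ denotes expectation under $\beta_{n0}$. The components of $\beta_n$ are $\beta_{nj}$ and those of $\beta_{n0}$ are written $\beta_{n0,j}$, $1\le j\le p_n$; $\beta_{n01}=(\beta_{n0,1},\dots,\beta_{n0,s_n})^T$ is the subvector of nonzero components. The Fisher information matrix is $I_n(\beta_n)=E_{\beta_n}[\{\frac{\partial\log f_n(V_{n1},\beta_n)}{\partial\beta_n}\}\{\frac{\partial\log f_n(V_{n1},\beta_n)}{\partial\beta_n}\}^T]$, where $E_{\beta_n}$ is expectation under $f_n(\cdot,\beta_n)$; $I_n(\beta_{n01})$ is the $s_n\times s_n$ Fisher information matrix of the submodel in which the last $p_n-s_n$ components are known to be $0$, i.e.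 the upper-left $s_n\times s_n$ block of $I_n(\beta_{n0})$. $p_\lambda:[0,\infty)\to[0,\infty)$, $\lambda>0$, is a penalty function with $p_\lambda(0)=0$, $\lambda_n>0$ is a regularization parameter, and $p'_\lambda,p''_\lambda$ denote first and second derivatives on $(0,\infty)$ (assumed to exist where they are used). The log-likelihood and the penalized likelihood are $$L_n(\beta_n)=\sum_{i=1}^n\log f_n(V_{ni},\beta_n),\qquad Q_n(\beta_n)=L_n(\beta_n)-n\sum_{j=1}^{p_n}p_{\lambda_n}(|\beta_{nj}|).$$ Put $a_n=\max\{p'_{\lambda_n}(|\beta_{n0,j}|):\beta_{n0,j}\ne0\}$, $b_n=\max\{p''_{\lambda_n}(|\beta_{n0,j}|):\beta_{n0,j}\neq0\}$, $$\Sigma_{\lambda_n}=\mathrm{diag}\{p''_{\lambda_n}(|\beta_{n0,1}|),\dots,p''_{\lambda_n}(|\beta_{n0,s_n}|)\},\quad \mathbf{b}_n=\{p'_{\lambda_n}(|\beta_{n0,1}|)\,\mathrm{sgn}(\beta_{n0,1}),\dots,p'_{\lambda_n}(|\beta_{n0,s_n}|)\,\mathrm{sgn}(\beta_{n0,s_n})\}^T.$$ $\|\cdot\|$ is the Euclidean norm; $\lambda_{\min},\lambda_{\max}$ are smallest and largest eigenvalues; constants do not depend on $n$.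
   Formalization: Condition (v), under which sparsity can fail as written, is replaced by: for every K>0, p_{λ_n} is differentiable on (0, K√(p_n/n)] for large n and liminf_n inf{p'_{λ_n}(θ)/λ_n : 0<θ≤K√(p_n/n)} > 0. *)

(* Defs.v *)
(* MathComp-Analysis. *)
From HB Require Import structures.
From mathcomp Require Import all_boot all_order all_algebra.
From mathcomp Require Import all_classical all_reals all_analysis.

Set Implicit Arguments.
Unset Strict Implicit.
Unset Printing Implicit Defensive.

Import Order.TTheory GRing.Theory Num.Theory.
Import numFieldNormedType.Exports.

Local Open Scope classical_set_scope.
Local Open Scope ring_scope.

Section LinearAlgebra.
Context {R : realType}.

(* The norm [`|x|] of the library on matrices is the sup norm. *)
Definition enorm m (x : 'cV[R]_m) : R := Num.sqrt (\sum_i x i ord0 ^+ 2).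

Definition lambda_min m (A : 'M[R]_m) : R := inf [set a | eigenvalue A a].
Definition lambda_max m (A : 'M[R]_m) : R := sup [set a | eigenvalue A a].

Definition psd m (A : 'M[R]_m) : Prop :=
  forall u : 'cV[R]_m, 0 <= (u^T *m A *m u) ord0 ord0.

(* The symmetric nonnegative square root, which exists and is unique when [A]
   is symmetric and nonnegative; [0] if there is none. *)
Definition mxsqrt m (A : 'M[R]_m) : 'M[R]_m :=
  xget 0 [set B : 'M[R]_m | [/\ B^T = B, psd B & B *m B = A]].

Definition subvec s m (hs : (s <= m)%N) (x : 'cV[R]_m) : 'cV[R]_s :=
  \col_i x (widen_ord hs i) ord0.

Definition upper_left s m (hs : (s <= m)%N) (A : 'M[R]_m) : 'M[R]_s :=
  mxsub (widen_ord hs) (widen_ord hs) A.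

End LinearAlgebra.

Section PartialDerivatives.
Context {R : realType} {m : nat}.

Definition pderivable (g : 'cV[R]_m -> R) (j : 'I_m) (b : 'cV[R]_m) : Prop :=
  derivable g b (delta_mx j ord0 : 'cV[R]_m).

Definition pd (j : 'I_m) (g : 'cV[R]_m -> R) : 'cV[R]_m -> R :=
  fun b => 'D_(delta_mx j ord0 : 'cV[R]_m) g b.

Definition third_pderivable (g : 'cV[R]_m -> R) (b : 'cV[R]_m) : Prop :=
  forall j k l, [/\ pderivable g j b, pderivable (pd j g) k b
                  & pderivable (pd k (pd j g)) l b].

End PartialDerivatives.

Section Model.
Context {R : realType} {d : measure_display} {X : measurableType d} {m : nat}.
Variables (mu : {measure set X -> \bar R}) (f : X -> 'cV[R]_m -> R).

Definition density_family (Omega : set 'cV[R]_m) : Prop :=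
  forall b, Omega b ->
    [/\ measurable_fun [set: X] (f ^~ b), (forall x, 0 <= f x b)
      & (\int[mu]_x (f x b)%:E = 1)%E].

Definition common_support (Omega : set 'cV[R]_m) : Prop :=
  forall b b', Omega b -> Omega b' ->
    [set x | 0 < f x b] = [set x | 0 < f x b'].

Definition identifiable (Omega : set 'cV[R]_m) : Prop :=
  forall b b', Omega b -> Omega b' ->
    (forall A, measurable A ->
       (\int[mu]_(x in A) (f x b)%:E = \int[mu]_(x in A) (f x b')%:E)%E) ->
    b = b'.

(* [E_b {g(V)}] for [V] with density [f(., b)]. *)
Definition expect (b : 'cV[R]_m) (g : X -> R) : \bar R :=
  (\int[mu]_x (g x * f x b)%:E)%E.

Definition integrable_at (b : 'cV[R]_m) (g : X -> R) : Prop :=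
  mu.-integrable [set: X] (fun x => (g x * f x b)%:E).

Definition logf (x : X) (b : 'cV[R]_m) : R := ln (f x b).

Definition score (b : 'cV[R]_m) (j : 'I_m) (x : X) : R := pd j (logf x) b.
Definition hess (b : 'cV[R]_m) (j k : 'I_m) (x : X) : R :=
  pd j (pd k (logf x)) b.
Definition third (b : 'cV[R]_m) (j k l : 'I_m) (x : X) : R :=
  pd j (pd k (pd l (logf x))) b.

Definition fisher (b : 'cV[R]_m) : 'M[R]_m :=
  \matrix_(j, k) fine (expect b (fun x => score b j x * score b k x)).

Definition score_identities (b : 'cV[R]_m) : Prop :=
  (forall j, integrable_at b (score b j) /\ expect b (score b j) = 0%E) /\
  (forall j k,
     [/\ integrable_at b (fun x => score b j x * score b k x),
         integrable_at b (hess b j k)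
       & expect b (fun x => score b j x * score b k x)
         = (- expect b (hess b j k))%E]).

End Model.

Section Sample.
Context {R : realType} {dT dX : measure_display}.
Context {T : measurableType dT} {X : measurableType dX}.
Context {P : probability T R} {n : nat}.

Definition mutually_independent (V : 'I_n -> {RV P >-> X}) : Prop :=
  forall (J : {set 'I_n}) (A : 'I_n -> set X), (forall i, measurable (A i)) ->
    P (\bigcap_(i in [set i | i \in J]) (V i @^-1` A i))
    = (\prod_(i in J) P (V i @^-1` A i))%E.

Definition has_density (mu : {measure set X -> \bar R}) (V : {RV P >-> X})
    (h : X -> R) : Prop :=
  forall A, measurable A ->
    distribution P V A = (\int[mu]_(x in A) (h x)%:E)%E.

End Sample.

Section PenalizedLikelihood.
Context {R : realType} {d : measure_display} {X : measurableType d}.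
Context {n m : nat}.
Variables (f : X -> 'cV[R]_m -> R) (pen : R -> R) (v : 'I_n -> X).

Definition loglik (b : 'cV[R]_m) : R := \sum_i logf f (v i) b.

Definition penlik (b : 'cV[R]_m) : R :=
  loglik b - n%:R * \sum_j pen `|b j ord0|.

End PenalizedLikelihood.

Definition local_maximizer {R : realType} {m : nat} (Omega : set 'cV[R]_m)
    (Q : 'cV[R]_m -> R) (b : 'cV[R]_m) : Prop :=
  Omega b /\ \forall b' \near within Omega (nbhs b), Q b' <= Q b.

Section Penalty.
Context {R : realType} {m : nat}.
Implicit Types (pen : R -> R) (b : 'cV[R]_m).

Definition pen1 pen (t : R) : R := derive1 pen t.
Definition pen2 pen (t : R) : R := derive1 (derive1 pen) t.

(* [inf p'_l(t)/l] over [0 < t <= r]: the slope of the penalty at the origin,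
   measured on the scale [r] of the estimation error. The limit [t -> 0+] at
   fixed [l] would say nothing about the [t] of that scale, as it only concerns
   a neighborhood of [0] which may shrink with [l] at any speed. *)
Definition origin_slope pen (l r : R) : \bar R :=
  ereal_inf [set (pen1 pen t / l)%:E | t in [set t | 0 < t <= r]].

(* Maxima over a finite nonempty set, written with [sup]. *)
Definition pen1_max pen b : R :=
  sup [set pen1 pen `|b j ord0| | j in [set j | b j ord0 != 0]].
Definition pen2_max pen b : R :=
  sup [set pen2 pen `|b j ord0| | j in [set j | b j ord0 != 0]].

Definition pen_Sigma pen b : 'M[R]_m :=
  diag_mx (\row_j pen2 pen `|b j ord0|).
Definition pen_bias pen b : 'cV[R]_m :=
  \col_j (pen1 pen `|b j ord0| * Num.sg (b j ord0)).

End Penalty.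

Definition min_abs {R : realType} {m : nat} (b : 'cV[R]_m) : R :=
  inf [set `|b j ord0| | j in [set: 'I_m]].

Section Asymptotics.
Context {R : realType} {dT : nat -> measure_display}.
Context {T : forall n, measurableType (dT n)}.
Variable P : forall n, probability (T n) R.

(* [E n] holds with probability tending to one; [E n] itself need not be
   measurable. *)
Definition wp_to_1 (E : forall n, set (T n)) : Prop :=
  exists F : forall n, set (T n),
    [/\ forall n, measurable (F n), forall n, F n `<=` E n
      & (fun n => P n (F n)) @ \oo --> 1%E].

Definition bigO_p (Y : forall n, T n -> R) (r : nat -> R) : Prop :=
  forall e : R, 0 < e -> exists K : R,
    \forall n \near \oo, (P n [set w | (K * r n < `|Y n w|)%R] <= e%:E)%E.

End Asymptotics.

Section Gaussian.
Context {R : realType}.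

Definition tuple_cons q (z : measurableTypeR R * q.-tuple (measurableTypeR R)) :
  q.+1.-tuple (measurableTypeR R) := [tuple of z.1 :: z.2].

Lemma measurable_tuple_cons q : measurable_fun setT (@tuple_cons q).
Proof. exact: measurable_cons. Qed.

HB.instance Definition _ q :=
  isMeasurableFun.Build _ _ _ _ (@tuple_cons q) (@measurable_tuple_cons q).

(* The law of [q] independent standard normal variables. *)
Fixpoint std_gauss q : probability (q.-tuple (measurableTypeR R)) R :=
  match q with
  | 0 => dirac ([tuple] : 0.-tuple (measurableTypeR R))
  | q'.+1 => distribution
      (product_measure1 (normal_prob (0 : R) 1) (std_gauss q'))
      (@tuple_cons q')
  end.

(* The expectation of [g] under the law N(0, G), i.e. under the law of
   [G^(1/2) Z] with [Z] standard normal; [G] may be singular. *)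
Definition gauss_expect q (G : 'M[R]_q) (g : 'cV[R]_q -> R) : \bar R :=
  (\int[std_gauss q]_z (g (mxsqrt G *m (\col_i tnth z i)))%:E)%E.

(* Convergence in distribution: convergence of the expectations of all bounded
   continuous functions. *)
Definition cvg_to_gauss {dT : nat -> measure_display}
    {T : forall n, measurableType (dT n)} (P : forall n, probability (T n) R)
    q (W : forall n, T n -> 'cV[R]_q) (G : 'M[R]_q) : Prop :=
  forall g : 'cV[R]_q -> R, continuous g ->
    (exists M : R, forall x, `|g x| <= M) ->
    (fun n => (\int[P n]_w (g (W n w))%:E)%E) @ \oo --> gauss_expect G g.

End Gaussian.

(* Main.v *)
(* Write d = bhat - b0, I for the information matrix and U for the sum of the
   sample scores at b0. Second moment bounds and a coordinatewise Taylor
   expansion turn the first-order condition of the penalized maximum into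
     n (I d + p'(|bhat|) sgn(bhat)) = U + r   with   |r|^2 = O_p(p_n^5)
   at the nonzero coordinates of bhat. If some bhat_j with j >= s_n were
   nonzero, then p'(|bhat_j|) would be at least a multiple of lambda_n, while
   all the other terms, divided by n, are O_p(sqrt(p_n/n)) = o(lambda_n): hence
   the sparsity. On the first s_n coordinates, expanding p' at b0 gives
     n ((I_1 + Sigma) d_1 + b) = U_1 + r'   with   |r'|^2 = O_p(p_n^5) = o_p(n),
   so that the normality reduces to that of the linear forms of U_1 / sqrt n.
   Their characteristic functions are compared with the Gaussian ones by means
   of the fourth moments of the scores, and convergence of characteristic
   functions yields weak convergence because bounded continuous functions are
   uniformly approximated on cubes by trigonometric polynomials. *)
Require Import Defs.
From HB Require Import structures.
From mathcomp Require Import all_boot all_order all_algebra.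
From mathcomp Require Import all_classical all_reals all_analysis.
From mathcomp Require Import measurable_realfun lebesgue_integral_under.
From mathcomp Require complex spectral sesquilinear.
From mathcomp Require Import ring lra.

Set Implicit Arguments.
Unset Strict Implicit.
Unset Printing Implicit Defensive.

Import Order.TTheory GRing.Theory Num.Theory.
Import numFieldNormedType.Exports.

Local Open Scope classical_set_scope.
Local Open Scope ring_scope.

(** * Symmetric matrices *)

(** Means of [sin (x + b)] with a free phase [b] carry both the real and the imaginary part of a
    characteristic function, so that the probabilistic part stays real. The number of coordinates
    grows with n; the limit theorem for linear forms of the scores is therefore quantitative, with
    an error controlled by [p_n / sqrt n], and the vector statement follows because q is fixed. Only
    partial derivatives are assumed, so the expansion runs along coordinate paths inside a box
    around the true parameter. Condition (vii) bounds the entries of Sigma from above only, while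
    the statement of normality contains the inverse of I_1 + Sigma. The limit law is therefore
    established for (I_1 + Sigma) d_1 + b, which involves no inverse; a singular I_1 + Sigma would
    contradict this law, since that vector is deterministic along a left kernel. *)

Section Spectral.
Import complex spectral sesquilinear.
Variable R : realType.

(* The spectral theorem, read on the quadratic forms of the polynomials in [A]:
   [w i] is the squared norm of the component of [u] along the [i]-th
   eigenvector. *)
Lemma symmetric_spectral n (A : 'M[R]_n.+1) : A^T = A ->
  exists r : 'I_n.+1 -> R,
  [/\ forall i, eigenvalue A (r i),
      forall q q' : {poly R}, (forall i, q.[r i] = q'.[r i]) ->
        horner_mx A q = horner_mx A q'
    & forall u : 'cV[R]_n.+1, exists2 w : 'I_n.+1 -> R, forall i, 0 <= w i &
        forall q, (u^T *m horner_mx A q *m u) ord0 ord0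
          = \sum_i q.[r i] * w i].
Proof.
move=> Asym.
pose h : {rmorphism R -> (complex R)} := real_complex R.
pose AC := map_mx h A.
have realh m1 m2 (B : 'M[R]_(m1, m2)) :
    map_mx h B \is a mxOver (Num.real : qualifier 0 (complex R)).
  apply/mxOverP => i j; rewrite mxE complex_real.
  by [].
have ACherm : AC \is hermsymmx.
  apply: realsym_hermsym; last exact: realh.
  by apply/is_hermitianmxP; rewrite /= expr0 scale1r map_mx_id// /AC map_trmx Asym.
have [S [d [Suni dreal ACeq]]] : exists S (d : 'rV[complex R]_n.+1),
    [/\ S \is unitarymx, forall i, h (Re (d ord0 i)) = d ord0 i
      & AC = invmx S *m diag_mx d *m S].
  exists (spectralmx AC), (spectral_diag AC); split.
  - exact: spectral_unitarymx.
  - move=> i; have /mxOverP/(_ ord0 i) := hermitian_spectral_diag_real ACherm.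
    by move=> /complex_realP[x ->].
  - by have /orthomx_spectralP ACeq := hermitian_normalmx ACherm.
have Sunit := unitarymx_unit Suni.
pose r i := Re (d ord0 i).
have ACq q : map_mx h (horner_mx A q)
    = invmx S *m diag_mx (\row_i h q.[r i]) *m S.
  rewrite map_horner_mx -/AC ACeq.
  have -> := @horner_mx_uconjC _ n (map_poly h q) S (diag_mx d) Sunit.
  rewrite horner_mx_diag.
  apply: (f_equal (fun v => invmx S *m diag_mx v *m S)).
  by apply/rowP => i; rewrite !mxE -(dreal i) horner_map.
exists r; split.
- move=> i; rewrite -(eigenvalue_map h) -/AC dreal.
  apply/eigenvalueP; exists (row i S).
    rewrite {1}ACeq !mulmxA -row_mul mulmxV // row1 -rowE row_diag_mx -scalemxAl.
    by rewrite -rowE.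
  apply: contraTneq Sunit => rS0; rewrite unitmxE.
  rewrite (expand_det_row _ i) big1 ?unitr0 // => j _.
  by have /rowP/(_ j) := rS0; rewrite !mxE => ->; rewrite mul0r.
- move=> q q' qq'; apply: (@map_mx_inj _ _ h); rewrite !ACq.
  apply: (f_equal (fun v => invmx S *m diag_mx v *m S)).
  by apply/rowP => i; rewrite !mxE qq'.
move=> u; pose c := S *m map_mx h u.
pose w i := Re (conjc (c i ord0) * c i ord0).
have wE i : h (w i) = conjc (c i ord0) * c i ord0.
  rewrite /w; have := mulcJ_ge0 (c i ord0); rewrite mulrC => c0.
  by rewrite [RHS]complexE (ger0_Im c0) mulr0 addr0.
exists w => [i|q].
  by have := mulcJ_ge0 (c i ord0); rewrite mulrC -wE ler0c.
apply: (@complexI R); rewrite -/h.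
transitivity ((map_mx h (u^T *m horner_mx A q *m u)) ord0 ord0).
  by rewrite [RHS]mxE.
rewrite !map_mxM ACq (invmx_unitary Suni).
have uh : map_mx Num.conj (map_mx h u)^T = map_mx h u^T.
  apply/matrixP => i j; rewrite !mxE; apply/CrealP.
  by rewrite complex_real.
have cE : map_mx Num.conj c^T = map_mx h u^T *m map_mx Num.conj S^T.
  by rewrite /c trmx_mul map_mxM uh.
transitivity ((map_mx Num.conj c^T *m diag_mx (\row_i h q.[r i]) *m c) ord0 ord0).
  by rewrite cE /c !mulmxA.
rewrite rmorph_sum mxE; apply: eq_bigr => i _.
rewrite mul_mx_diag !mxE rmorphM wE mulrAC mulrC; congr (_ * _).
by rewrite /c mxE.
Qed.
End Spectral.

Section QuadraticForms.
Variable R : realType.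

(** Makes any function on the spectrum a polynomial in the matrix. Repetitions in [s] are allowed,
    as eigenvalues are listed with multiplicity. *)
Lemma poly_interpolation (s : seq R) (g : R -> R) :
  exists q : {poly R}, forall x, x \in s -> q.[x] = g x.
Proof.
elim: s => [|a s [q qg]]; first by exists 0.
have [as_|as_] := boolP (a \in s).
  by exists q => x; rewrite inE => /predU1P[->|]; exact: qg.
pose P := \prod_(b <- s) ('X - b%:P).
have Pa : P.[a] != 0.
  rewrite /P horner_prod prodf_seq_neq0; apply/allP => b bs.
  by rewrite !hornerE subr_eq0; apply: contraNneq as_ => ->.
exists (q + ((g a - q.[a]) / P.[a]) *: P) => x; rewrite inE !hornerE.
move=> /predU1P[->|xs]; first by rewrite divfK // addrC subrK.
suff -> : P.[x] = 0 by rewrite mulr0 addr0 qg.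
by apply/eqP; rewrite -[_ == _]/(root P x) /P root_prod_XsubC.
Qed.

Lemma sqnormE m (u : 'cV[R]_m) : (u^T *m u) ord0 ord0 = \sum_i u i ord0 ^+ 2.
Proof. by rewrite mxE; apply: eq_bigr => i _; rewrite mxE expr2. Qed.

Lemma sqnorm_ge0 m (u : 'cV[R]_m) : 0 <= (u^T *m u) ord0 ord0.
Proof. by rewrite sqnormE; apply: sumr_ge0 => i _; exact: sqr_ge0. Qed.

Lemma sqnorm_gt0 m (u : 'cV[R]_m) : u != 0 -> 0 < (u^T *m u) ord0 ord0.
Proof.
rewrite lt_neqAle sqnorm_ge0 andbT; apply: contra_neq; rewrite sqnormE => /esym.
move=> /psumr_eq0P u0; apply/colP => i; rewrite mxE; apply/eqP.
by rewrite -sqrf_eq0; apply/eqP/u0 => // j _; exact: sqr_ge0.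
Qed.

(** The root is [horner_mx A q] with [q] interpolating the square root on the spectrum: as a
    polynomial in [A] it inherits its symmetry, and its spectral values [Num.sqrt (r i)] are
    nonnegative. *)
Lemma mxsqrtP m (A : 'M[R]_m) : A^T = A -> psd A ->
  [/\ (mxsqrt A)^T = mxsqrt A, psd (mxsqrt A) & mxsqrt A *m mxsqrt A = A].
Proof.
(* It is enough to exhibit one root: [xgetP] leaves only the case where none exists, refuted in
   dimension 0 by the matrix [0]. *)
case: m A => [|n] A Asym Apsd; rewrite /mxsqrt; case: xgetP => // /=.
  move=> /(_ 0) []; split=> [||]; first exact: thinmx0.
    by move=> u; rewrite mulmx0 mul0mx mxE.
  by rewrite [RHS]thinmx0 [LHS]thinmx0.
have [r [eig hA hw]] := symmetric_spectral Asym.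
have [q qE] := poly_interpolation (codom r) Num.sqrt.
have {}qE i : q.[r i] = Num.sqrt (r i) by apply: qE; exact: codom_f.
move=> /(_ (horner_mx A q)) []; split.
- apply/esym; elim/poly_ind: q {qE} => [|q c IH].
    by rewrite !rmorph0 trmx0.
  rewrite rmorphD rmorphM /= horner_mx_X horner_mx_C linearD /= tr_scalar_mx.
  congr (_ + _); rewrite -mulmxE trmx_mul Asym -IH.
  by apply/comm_horner_mx/comm_mx_refl.
- move=> u; have [w w0 ->] := hw u; apply: sumr_ge0 => i _.
  by rewrite mulr_ge0 // qE sqrtr_ge0.
- have -> : horner_mx A q *m horner_mx A q = horner_mx A (q * q).
    by rewrite rmorphM.
  rewrite -[RHS](horner_mx_X A); apply: hA => i.
  rewrite !hornerE qE -expr2 sqr_sqrtr //.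
  (* The sign of [r i] is read off the quadratic form at an eigenvector. *)
  have /eigenvalueP[v vA v0] := eig i.
  have := Apsd v^T; rewrite trmxK vA -scalemxAl mxE.
  have vT0 : v^T != 0 by rewrite -(inj_eq trmx_inj) trmxK trmx0.
  by have := sqnorm_gt0 vT0; rewrite trmxK => v2; rewrite pmulr_lge0.
Qed.

(** [lambda_min] and [lambda_max] are an infimum and a supremum over the set of eigenvalues; they
    bracket the [r i] only once this set is known to be bounded. *)
Lemma symmetric_lambda n (A : 'M[R]_n.+1) : A^T = A ->
  exists r : 'I_n.+1 -> R,
  [/\ forall i, lambda_min A <= r i <= lambda_max A
    & forall u : 'cV[R]_n.+1, exists2 w : 'I_n.+1 -> R, forall i, 0 <= w i &
      [/\ (u^T *m u) ord0 ord0 = \sum_i w i,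
          (u^T *m A *m u) ord0 ord0 = \sum_i r i * w i
        & (u^T *m (A *m A) *m u) ord0 ord0 = \sum_i r i ^+ 2 * w i]].
Proof.
move=> Asym; have [r [eig hA hw]] := symmetric_spectral Asym.
have hq u w : (forall q, (u^T *m horner_mx A q *m u) ord0 ord0
          = \sum_i q.[r i] * w i) ->
    [/\ (u^T *m u) ord0 ord0 = \sum_i w i,
          (u^T *m A *m u) ord0 ord0 = \sum_i r i * w i
        & (u^T *m (A *m A) *m u) ord0 ord0 = \sum_i r i ^+ 2 * w i].
  move=> H; split.
  - have := H 1; rewrite rmorph1 mulmx1 => ->; apply: eq_bigr => i _.
    by rewrite hornerC mul1r.
  - have := H 'X; rewrite horner_mx_X => ->; apply: eq_bigr => i _.
    by rewrite hornerX.
  - have := H ('X * 'X); rewrite rmorphM /= horner_mx_X => ->.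
    by apply: eq_bigr => i _; rewrite hornerM hornerX expr2.
(* At an eigenvector, the quadratic form exhibits [a] as a weighted mean of the [r i]. *)
have eigB a : eigenvalue A a -> `|a| <= \sum_i `|r i|.
  move=> /eigenvalueP[v vA v0].
  have [w w0 /hq[h1 hX _]] := hw v^T.
  have vT0 : v^T != 0 by rewrite -(inj_eq trmx_inj) trmxK trmx0.
  have := sqnorm_gt0 vT0; rewrite h1 => w_gt0.
  have : a * \sum_i w i = \sum_i r i * w i.
    by rewrite -hX -h1 trmxK vA -scalemxAl [RHS]mxE.
  move=> aw; rewrite -(ler_pM2r w_gt0) -[X in _ * X <= _]gtr0_norm //.
  rewrite -normrM aw (le_trans (ler_norm_sum _ _ _)) //.
  rewrite mulr_suml; apply: ler_sum => i _.
  rewrite normrM ler_wpM2l // ger0_norm //.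
  by rewrite (bigD1 i) //= lerDl sumr_ge0.
exists r; split => [i|u]; last by have [w w0 /hq ?] := hw u; exists w.
apply/andP; split.
  apply: ge_inf; last exact: eig.
  by exists (- \sum_i `|r i|) => a /eigB; rewrite ler_norml => /andP[].
apply: ub_le_sup; last exact: eig.
by exists (\sum_i `|r i|) => a /eigB; rewrite ler_norml => /andP[].
Qed.

Lemma lambda_min_quad m (A : 'M[R]_m) c (u : 'cV[R]_m) : A^T = A ->
  c <= lambda_min A ->
  c * (u^T *m u) ord0 ord0 <= (u^T *m A *m u) ord0 ord0.
Proof.
case: m A u => [|n] A u Asym cA.
  by rewrite [u]flatmx0 !mulmx0 !mxE mulr0.
have [r [rA hw]] := symmetric_lambda Asym.
have [w w0 [-> -> _]] := hw u.
rewrite mulr_sumr; apply: ler_sum => i _; rewrite ler_wpM2r //.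
by rewrite (le_trans cA) //; have /andP[] := rA i.
Qed.

Lemma lambda_max_quad m (A : 'M[R]_m) c (u : 'cV[R]_m) : A^T = A ->
  lambda_max A <= c ->
  (u^T *m A *m u) ord0 ord0 <= c * (u^T *m u) ord0 ord0.
Proof.
case: m A u => [|n] A u Asym cA.
  by rewrite [u]flatmx0 !mulmx0 !mxE mulr0.
have [r [rA hw]] := symmetric_lambda Asym.
have [w w0 [-> -> _]] := hw u.
rewrite mulr_sumr; apply: ler_sum => i _; rewrite ler_wpM2r //.
by rewrite (le_trans _ cA) //; have /andP[] := rA i.
Qed.

(** The left side is the sum of the [r i ^+ 2 * w i]; nonnegativity of the eigenvalues turns
    [r i <= c] into [r i ^+ 2 <= c ^+ 2]. *)
Lemma lambda_max_sqnorm m (A : 'M[R]_m) c (u : 'cV[R]_m) : A^T = A ->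
  0 <= lambda_min A -> lambda_max A <= c ->
  ((A *m u)^T *m (A *m u)) ord0 ord0 <= c ^+ 2 * (u^T *m u) ord0 ord0.
Proof.
case: m A u => [|n] A u Asym A0 cA.
  by rewrite [u]flatmx0 !mulmx0 !mxE mulr0.
have [r [rA hw]] := symmetric_lambda Asym.
have [w w0 [h1 _ h2]] := hw u.
rewrite trmx_mul Asym mulmxA -(mulmxA u^T) h1 h2.
rewrite mulr_sumr; apply: ler_sum => i _; rewrite ler_wpM2r //.
have /andP[r1 r2] := rA i.
have r0 := le_trans A0 r1; have rc := le_trans r2 cA.
by rewrite lerXn2r ?nnegrE // (le_trans r0).
Qed.

End QuadraticForms.

(** * Gaussian characteristic functions *)

Section GaussianCF.
Variable R : realType.
Local Notation leb := (@lebesgue_measure R).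
Local Notation p := (normal_pdf (0 : R) 1).

Lemma std_normal_pdfE x : p x = normal_peak 1 * expR (- (x ^+ 2 / 2)).
Proof.
rewrite normal_pdfE ?oner_eq0 // /normal_fun subr0 expr1n.
by rewrite mulNr.
Qed.

Lemma is_derive_std_normal_pdf (x : R) : is_derive x (1 : R) p (- x * p x).
Proof.
have -> : p = (fun x => normal_peak 1 * expR (- (x ^+ 2 / 2))).
  by apply/funext => y; exact: std_normal_pdfE.
apply: trigger_derive; rewrite /GRing.scale /=.
by field.
Qed.

(** Half of the Gaussian exponent absorbs the factor: [|x| exp (- x^2 / 4)] is bounded, which leaves
    a multiple of the normal density of variance 2. *)
Lemma integrable_normr_std_normal :
  leb.-integrable [set: R] (fun x => (`|x| * p x)%:E).
Proof.
pose s := Num.sqrt 2 : R.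
have s0 : s != 0 by rewrite gt_eqF // sqrtr_gt0.
have nE x : `|x| * p x <=
    2 * (normal_peak 1 / normal_peak s) * normal_pdf 0 s x.
  rewrite std_normal_pdfE (normal_pdfE _ s0) /normal_fun subr0 sqr_sqrtr //.
  have -> : - (x ^+ 2 / 2) = - x ^+ 2 / (2 *+ 2) + - x ^+ 2 / (2 *+ 2) :> R by field.
  rewrite expRD.
  set e := expR _.
  rewrite [leRHS](_ : _ = normal_peak 1 * 2 * e); last first.
    by rewrite !mulrA [LHS]mulrAC -[_ / _ * _ * _]mulrA; field; rewrite gt_eqF // normal_peak_gt0.
  rewrite mulrCA -mulrA ler_wpM2l ?normal_peak_ge0 // mulrA ler_wpM2r ?expR_ge0 //.
  have -> : e = (expR (x ^+ 2 / (2 *+ 2)))^-1 by rewrite -expRN /e mulNr.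
  rewrite ler_pdivrMr ?expR_gt0 //.
  have := expR_ge1Dx (x ^+ 2 / (2 *+ 2)).
  have := sqr_ge0 (`|x| - 2); rewrite sqrrB real_normK ?num_real //.
  have -> : 2 *+ 2 = 4 :> R by ring.
  move: (x ^+ 2) `|x| => y z; have := expR_ge0 (y / 4).
  move: (expR (y / 4)) => E *; lra.
have mp := measurable_normal_pdf (0 : R) 1.
have ig : leb.-integrable [set: R]
    (fun x => (2 * (normal_peak 1 / normal_peak s) * normal_pdf 0 s x)%:E).
  under eq_fun do rewrite EFinM.
  by apply: integrableZl => //; exact: integrable_normal_pdf.
apply: le_integrable ig => //.
- by apply/measurable_EFinP/measurable_funM => //; exact: measurableT_comp.
- move=> x _; rewrite /= lee_fin ger0_norm ?mulr_ge0 ?normal_pdf_ge0 //.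
  by rewrite (le_trans (nE x)) // ler_norm.
Qed.

(** Reduces integrals over the line to segments, where the fundamental theorem of calculus
    applies. *)
Lemma integral_indic_segment_cvg (h : R -> R) :
  leb.-integrable [set: R] (EFin \o h) ->
  (fun n : nat => (\int[leb]_(x in `[(- n.+1%:R)%R, n.+1%:R]) (h x)%:E)%E) @ \oo
    --> (\int[leb]_x (h x)%:E)%E.
Proof.
move=> ih.
have mh : measurable_fun [set: R] h.
  by apply/measurable_EFinP; exact: measurable_int ih.
pose D (n : nat) : set R := [set` `[(- n.+1%:R)%R, n.+1%:R]%R].
have mD n : measurable (D n) by exact: measurable_itv.
pose f_ n x := ((EFin \o h) \_ (D n)) x.
have -> : (fun n : nat => (\int[leb]_(x in `[(- n.+1%:R)%R, n.+1%:R]) (h x)%:E)%E)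
    = (fun n => (\int[leb]_x f_ n x)%E).
  by apply/funext => n; rewrite [LHS]integral_mkcond.
apply: (@dominated_cvg _ _ _ leb [set: R] measurableT f_ (EFin \o h)
   (fun x => `|h x|%:E)) => //.
- move=> n; apply/(measurable_restrict _ (mD n)) => //.
  by rewrite setTI; apply: measurable_funTS; exact/measurable_EFinP.
- move=> x _; apply: cvg_near_cst.
  have [N xN] : exists N : nat, `|x| <= N%:R.
    exists (Num.bound `|x|); apply: ltW; exact: archi_boundP.
  exists N => // n /= Nn; rewrite /f_ patchE mem_set //= /D /= in_itv /=.
  by rewrite -ler_norml (le_trans xN) // ler_nat ltnW.
- exact: integrable_norm.
- move=> n x _; rewrite /f_ patchE; case: ifPn => _ /=; rewrite ?lee_fin //.
  by rewrite normr0 normr_ge0.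
Qed.

Section TrigonometricIntegral.
Variables b : R.
Let F (a : R) := (\int[leb]_x (sin (a * x + b) * p x)).

Let integrable_trig (g : R -> R) : measurable_fun [set: R] g ->
  (forall x, `|g x| <= 1) -> leb.-integrable [set: R] (fun x => (g x * p x)%:E).
Proof.
move=> mg g1; have ip : leb.-integrable [set: R] (EFin \o p) by exact: integrable_normal_pdf.
apply: le_integrable ip => //.
- by apply/measurable_EFinP/measurable_funM => //; exact: measurable_normal_pdf.
- move=> x _; rewrite /= lee_fin normrM ler_piMl //.
Qed.

Let integrable_xtrig (g : R -> R) : measurable_fun [set: R] g ->
  (forall x, `|g x| <= 1) -> leb.-integrable [set: R] (fun x => (x * g x * p x)%:E).
Proof.
move=> mg g1.
apply: le_integrable integrable_normr_std_normal => //.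
- apply/measurable_EFinP/measurable_funM => //; last exact: measurable_normal_pdf.
  exact: measurable_funM.
- move=> x _; rewrite /= lee_fin !normrM normr_id ler_wpM2r // ler_piMr //.
Qed.

Let affine_cont (a : R) : continuous (fun x : R => a * x + b).
Proof. by move=> x; apply: cvgD; [apply: cvgMr; exact: cvg_id|exact: cvg_cst]. Qed.

Let msin (a : R) : measurable_fun [set: R] (fun x => sin (a * x + b)).
Proof.
apply: continuous_measurable_fun => x.
by apply: continuous_comp; [exact: affine_cont|exact: continuous_sin].
Qed.

Let mcos (a : R) : measurable_fun [set: R] (fun x => cos (a * x + b)).
Proof.
apply: continuous_measurable_fun => x.
by apply: continuous_comp; [exact: affine_cont|exact: continuous_cos].
Qed.

Let normr_sin_le1 (x : R) : `|sin x| <= 1.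
Proof. by rewrite ler_norml sin_le1 sin_geN1. Qed.

Let normr_cos_le1 (x : R) : `|cos x| <= 1.
Proof. by rewrite ler_norml cos_le1 cos_geN1. Qed.

(** Gaussian integration by parts: since [p' = - x p], the integrand and [a sin (a x + b) p] add up
    to minus the derivative of [cos (a x + b) p], which vanishes at infinity. *)
Let ibp (a : R) : \int[leb]_x (x * cos (a * x + b) * p x) = - a * F a.
Proof.
pose f x := - a * (sin (a * x + b) * p x) - x * cos (a * x + b) * p x.
pose G x := cos (a * x + b) * p x.
have dG x : is_derive x (1 : R) G (f x).
  have dp := is_derive_std_normal_pdf x.
  have d1 : is_derive x (1 : R) (fun x : R => a * x + b) a.
    by apply: trigger_derive; rewrite /GRing.scale /=; ring.
  have d2 : is_derive x (1 : R) (fun x : R => cos (a * x + b)) (- sin (a * x + b) * a).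
    by apply: is_derive1_comp.
  rewrite /G /f; apply: trigger_derive; rewrite /GRing.scale /=; ring.
have i1 : leb.-integrable [set: R] (fun x => (sin (a * x + b) * p x)%:E) by exact: integrable_trig.
have i2 : leb.-integrable [set: R] (fun x => (x * cos (a * x + b) * p x)%:E) by exact: integrable_xtrig.
have i1' : leb.-integrable [set: R] (fun x => (- a * (sin (a * x + b) * p x))%:E).
  by under eq_fun do rewrite EFinM; exact: integrableZl.
have fi : leb.-integrable [set: R] (EFin \o f).
  by rewrite /f /comp; under eq_fun do rewrite EFinB; exact: integrableB.
have pc : continuous p by apply: continuous_normal_pdf; exact: oner_neq0.
have fc : continuous f.
  move=> x; apply: cvgB; apply: cvgM; try exact: cvg_cst; try exact: pc.
    apply: cvgM; last exact: pc.
    by apply: continuous_comp; [exact: affine_cont|exact: continuous_sin].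
  apply: cvgM; first exact: cvg_id.
  by apply: continuous_comp; [exact: affine_cont|exact: continuous_cos].
have := integral_indic_segment_cvg fi.
have -> : (fun n : nat => (\int[leb]_(x in `[(- n.+1%:R)%R, n.+1%:R]) (f x)%:E)%E)
    = (fun n => (G n.+1%:R - G (- n.+1%:R))%:E).
  apply/funext => n; rewrite (@continuous_FTC2 _ f G) //.
  - by rewrite gtrN // ltr0n.
  - exact: continuous_subspaceT.
  - have Gc x : {for x, continuous G}.
      by apply: differentiable_continuous; apply/derivable1_diffP; have [] := dG x.
    split => [x _||].
    + by have [] := dG x.
    + by apply: cvg_at_right_filter; exact: Gc.
    + by apply: cvg_at_left_filter; exact: Gc.
  - by move=> x _; rewrite derive1E; have [] := dG x.
(* A decay in [1 / N] is enough for the boundary terms: [exp (N^2 / 2) >= 1 + N^2 / 2 >= N]. *)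
have pn n : p n.+1%:R <= normal_peak 1 * n.+1%:R^-1.
  rewrite std_normal_pdfE ler_wpM2l ?normal_peak_ge0 // expRN.
  rewrite lef_pV2 ?posrE ?expR_gt0 ?ltr0n //.
  apply: le_trans (expR_ge1Dx _); have := sqr_ge0 (n.+1%:R - 1 : R).
  by rewrite sqrrB1; lra.
have pN x : p (- x) = p x by rewrite !std_normal_pdfE sqrrN.
have Gn n : `|G n.+1%:R - G (- n.+1%:R)| <= (2 * normal_peak 1) * n.+1%:R^-1.
  apply: (le_trans (ler_normB _ _)); rewrite /G !normrM pN.
  rewrite (ger0_norm (normal_pdf_ge0 _ _ _)) -mulrDl -mulrA.
  apply: ler_pM => //; rewrite ?addr_ge0 ?normal_pdf_ge0 //.
  by rewrite (_ : 2 = 1 + 1) // lerD.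
have G0 : (fun n : nat => (G n.+1%:R - G (- n.+1%:R))%:E) @ \oo --> 0%:E.
  apply: cvg_EFin; first exact: nearW.
  apply/cvgr0Pnorm_le => e e0.
  have : (fun n : nat => (2 * normal_peak 1) * n.+1%:R^-1 : R) @ \oo --> (0 : R).
    by rewrite -[X in _ --> X](mulr0 (2 * normal_peak 1)); apply: cvgMr; exact: cvg_harmonic.
  move=> /cvgr0Pnorm_le /(_ e e0); apply: filterS => n.
  by apply: le_trans; rewrite (le_trans (Gn n)) // ler_norm.
move=> /(cvg_unique (@ereal_hausdorff R)) /(_ G0).
rewrite /f; under eq_integral do rewrite EFinB.
rewrite integralB //=; under eq_integral do rewrite EFinM.
rewrite integralZl //=.
have f1 := integrable_fin_num measurableT i1.
have f2 := integrable_fin_num measurableT i2.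
rewrite -(fineK f1) -(fineK f2) -EFinM -EFinB => -[] /eqP.
by rewrite subr_eq0 /F /Rintegral => /eqP ->.
Qed.

(** [F] solves [F' = - a F] with [F 0 = sin b], so that [F a * expR (a ^+ 2 / 2)] is constant. *)
Lemma integral_sin_std_normal a : F a = sin b * expR (- (a ^+ 2 / 2)).
Proof.
have dF (c : R) : is_derive c (1 : R) F (- c * F c).
  have cI : `]c - 1, c + 1[%classic c by rewrite /= in_itv /= ltrBlDr ltrDl ltr01.
  have dsin (x y : R) : is_derive x (1 : R) (fun t : R => sin (t * y + b) * p y) (y * cos (x * y + b) * p y).
    have d1 : is_derive x (1 : R) (fun t : R => t * y + b) y.
      by apply: trigger_derive; rewrite /GRing.scale /=; ring.
    have d2 : is_derive x (1 : R) (fun t : R => sin (t * y + b)) (cos (x * y + b) * y).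
      by apply: is_derive1_comp.
    by apply: trigger_derive; rewrite /GRing.scale /=; ring.
  have H1 (x : R) : `]c - 1, c + 1[%classic x -> leb.-integrable [set: R] (EFin \o (fun y => sin (x * y + b) * p y)).
    by move=> _; exact: integrable_trig.
  have H2 (x y : R) : `]c - 1, c + 1[%classic x -> [set: R] y -> derivable (fun t : R => sin (t * y + b) * p y) x 1.
    by move=> _ _; have [] := dsin x y.
  have H3 (y : R) : 0 <= `|y| * p y by rewrite mulr_ge0 ?normal_pdf_ge0.
  have H4 (x y : R) : `]c - 1, c + 1[%classic x -> [set: R] y ->
      `|partial1of2 (fun x y : R => sin (x * y + b) * p y) x y| <= `|y| * p y.
    move=> _ _; rewrite partial1of2E; have [_ ->] := dsin x y.
    by rewrite !normrM [`|p y|]ger0_norm ?normal_pdf_ge0 // ler_wpM2r ?normal_pdf_ge0 // ler_piMr.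
  have D1 := @derivable_under_integral R _ _ leb (fun x y : R => sin (x * y + b) * p y)
    _ measurableT c _ _ cI H1 H2 _ H3 integrable_normr_std_normal H4.
  have D2 := @differentiation_under_integral R _ _ leb (fun x y : R => sin (x * y + b) * p y)
    _ measurableT c _ _ cI H1 H2 _ H3 integrable_normr_std_normal H4.
  apply: DeriveDef => //.
  rewrite -derive1E D2 -ibp; apply: eq_Rintegral => y _.
  by rewrite partial1of2E; have [_ ->] := dsin c y.
have dE (c : R) : is_derive c (1 : R) (fun c : R => expR (c ^+ 2 / 2)) (c * expR (c ^+ 2 / 2)).
  by apply: trigger_derive; rewrite /GRing.scale /=; field.
have /(is_derive_0_is_cst _ _) : forall c, is_derive c (1 : R) (fun c : R => F c * expR (c ^+ 2 / 2)) 0.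
  move=> c; have := dF c; have := dE c => ? ?.
  by apply: trigger_derive; rewrite /GRing.scale /=; ring.
move=> /(_ a 0); rewrite expr0n /= mul0r expR0 mulr1.
have -> : F 0 = sin b.
  rewrite /F; under eq_Rintegral do rewrite mul0r add0r.
  rewrite RintegralZl //; last exact: integrable_normal_pdf.
  by rewrite /Rintegral integral_normal_pdf ?mulr1 // oner_neq0.
by rewrite expRN => <-; rewrite mulfK // gt_eqF // expR_gt0.
Qed.

End TrigonometricIntegral.

End GaussianCF.

(** * Integration against a law given by a density *)

Section Density.
Local Open Scope ereal_scope.
Context d (X : measurableType d) (R : realType).
Variables (nu mu : {measure set X -> \bar R}) (k : X -> R).
Hypotheses (mk : measurable_fun [set: X] k) (k0 : forall x, (0 <= k x)%R).
Hypothesis nuE : forall A, measurable A -> nu A = \int[mu]_(x in A) (k x)%:E.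

Import HBNNSimple.

(** Simple functions and monotone convergence; this covers an arbitrary dominating measure [mu]. *)
Lemma ge0_integral_density (g : X -> \bar R) :
  measurable_fun [set: X] g -> (forall x, 0 <= g x) ->
  \int[nu]_x g x = \int[mu]_x (g x * (k x)%:E).
Proof.
move=> mg g0; pose g_ := nnsfun_approx measurableT mg.
transitivity (limn (fun n => \int[nu]_x (g_ n x)%:E)).
  rewrite -monotone_convergence//.
  - apply: eq_integral => y _; apply/esym/cvg_lim => //.
    by apply: cvg_nnsfun_approx=> // *; apply: g0.
  - by move=> n; exact/measurable_EFinP/measurable_funP.
  - by move=> n y _; rewrite lee_fin.
  - by move=> y _ m n mn; rewrite lee_fin; exact/lefP/nd_nnsfun_approx.
rewrite [X in limn X](_ : _ = (fun n => \int[mu]_x ((g_ n x)%:E * (k x)%:E))).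
  rewrite -monotone_convergence//.
  - apply: eq_integral => y _; apply/cvg_lim => //.
    apply: cvgeZr => //.
    by apply: cvg_nnsfun_approx=> // *; apply: g0.
  - move=> n; apply/measurable_EFinP/measurable_funM => //.
  - by move=> n y _; rewrite -EFinM lee_fin mulr_ge0.
  - move=> y _ m n mn; rewrite -!EFinM lee_fin ler_wpM2r //.
    exact/lefP/nd_nnsfun_approx.
apply/funext => n.
have mA r : measurable (g_ n @^-1` [set r]) by [].
transitivity (\sum_(r \in range (g_ n))
    \int[mu]_x (r * \1_(g_ n @^-1` [set r]) x * k x)%:E).
  under eq_integral do rewrite fimfunE -fsumEFin//.
  rewrite ge0_integral_fsum//; last 2 first.
  - by move=> y; exact/measurable_EFinP/measurable_funM.
  - by move=> y x _; rewrite nnfun_muleindic_ge0.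
  apply: eq_fsbigr => r /[!inE] -[x _ gr].
  rewrite integralZl_indic_nnsfun // integral_indic // setIT nuE //.
  under [RHS]eq_integral do rewrite -mulrA EFinM.
  rewrite ge0_integralZl //.
  - congr (_ * _); rewrite [LHS]integral_mkcond; apply: eq_integral => y _.
    by rewrite patchE indicE; case: ifPn => yA; rewrite ?mul1r ?mul0r.
  - by apply/measurable_EFinP/measurable_funM.
  - by move=> y _; rewrite lee_fin mulr_ge0.
  - by rewrite lee_fin -gr.
rewrite -ge0_integral_fsum//.
- apply: eq_integral => x _; rewrite -EFinM fimfunE.
  by rewrite fsumEFin // -mulr_fsuml.
- by move=> r; apply/measurable_EFinP/measurable_funM => //; exact: measurable_funM.
- move=> r x _; rewrite lee_fin mulr_ge0 //.
  by have := nnfun_muleindic_ge0 (g_ n) r x; rewrite -EFinM lee_fin.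
Qed.

Lemma integrable_density (g : X -> R) : measurable_fun [set: X] g ->
  nu.-integrable [set: X] (EFin \o g) <->
  mu.-integrable [set: X] (fun x => (g x * k x)%:E).
Proof.
move=> mg.
have E : \int[nu]_x `|(g x)%:E| = \int[mu]_x `|(g x * k x)%:E|.
  rewrite ge0_integral_density //.
    apply: eq_integral => x _; rewrite EFinM abseM; congr (_ * _).
    by rewrite gee0_abs // lee_fin.
  by apply: measurableT_comp => //; exact/measurable_EFinP.
split=> /integrableP[_ h]; apply/integrableP; split.
- by apply/measurable_EFinP/measurable_funM.
- by rewrite -E.
- exact/measurable_EFinP.
- by rewrite E.
Qed.

Lemma integral_density (g : X -> R) : measurable_fun [set: X] g ->
  \int[nu]_x (g x)%:E = \int[mu]_x (g x * k x)%:E.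
Proof.
move=> mg; have mg' : measurable_fun [set: X] (EFin \o g) by exact/measurable_EFinP.
rewrite integralE [RHS]integralE !ge0_integral_density //.
- congr (_ - _).
    apply: eq_integral => x _; rewrite !funeposE /= EFinM.
    by rewrite maxeMl ?mul0e // lee_fin.
  apply: eq_integral => x _; rewrite !funenegE /= -mulNr EFinM.
  by rewrite maxeMl ?mul0e // lee_fin.
- exact: measurable_funeneg.
- exact: measurable_funepos.
Qed.

End Density.

Section StdGaussian.
Variable R : realType.

Lemma integral_sin_normal_prob (a b : R) :
  (\int[normal_prob (0 : R) 1]_x (sin (a * x + b))%:E)%E
  = (sin b * expR (- (a ^+ 2 / 2)))%:E.
Proof.
have msin : measurable_fun [set: R] (fun x : R => sin (a * x + b)).
  apply: continuous_measurable_fun => x.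
  apply: continuous_comp; last exact: continuous_sin.
  by apply: cvgD; [apply: cvgMr; exact: cvg_id|exact: cvg_cst].
rewrite (@integral_density _ _ _ (normal_prob (0 : R) 1) lebesgue_measure
  (normal_pdf 0 1)) //; last 2 first.
- exact: measurable_normal_pdf.
- by move=> x; exact: normal_pdf_ge0.
rewrite -integral_sin_std_normal /Rintegral fineK //.
apply: integrable_fin_num => //.
have ip := @integrable_normal_pdf R 0 1.
apply: le_integrable ip => //.
- by apply/measurable_EFinP/measurable_funM => //; exact: measurable_normal_pdf.
- move=> x _; rewrite /= lee_fin normrM ler_piMl //.
  by rewrite ler_norml sin_le1 sin_geN1.
Qed.

Lemma measurable_lincomb d (T : measurableType d) (I : finType) (c : I -> R)
    (Y : I -> T -> R) : (forall i, measurable_fun [set: T] (Y i)) ->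
  measurable_fun [set: T] (fun w => \sum_i c i * Y i w).
Proof.
move=> mY; apply: measurable_sum => i.
by apply: measurable_funM.
Qed.

Lemma measurable_sinD d (T : measurableType d) (b : R) (Y : T -> R) :
  measurable_fun [set: T] Y -> measurable_fun [set: T] (fun w => sin (Y w + b)).
Proof.
move=> mY; apply: measurableT_comp; last exact: measurable_funD.
by apply: continuous_measurable_fun; exact: continuous_sin.
Qed.

Lemma measurable_sinD2 d (T : measurableType d) (Y Z : T -> R) :
  measurable_fun [set: T] Y -> measurable_fun [set: T] Z ->
  measurable_fun [set: T] (fun w => sin (Y w + Z w)).
Proof.
move=> mY mZ; apply: measurableT_comp; last exact: measurable_funD.
by apply: continuous_measurable_fun; exact: continuous_sin.
Qed.

Lemma bounded_prob_integrable d (T : measurableType d) (P : probability T R)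
    (h : T -> R) (K : R) : measurable_fun [set: T] h ->
  (forall x, `|h x| <= K) -> P.-integrable [set: T] (EFin \o h).
Proof.
move=> mh hK; apply: measurable_bounded_integrable => //.
  by rewrite -ge0_fin_numE // fin_num_measure.
exists K; split; first exact: num_real.
by move=> M KM x _ /=; apply: (le_trans (hK x)); rewrite ltW.
Qed.

(** Induction on the dimension by Fubini. The free phase makes it work: in the inner integral the
    first coordinate, held fixed, is merely part of the phase. *)
Lemma integral_sin_std_gauss q (c : 'I_q -> R) (b : R) :
  (\int[std_gauss q]_z (sin (\sum_i c i * tnth z i + b))%:E)%E
  = (sin b * expR (- (\sum_i c i ^+ 2) / 2))%:E.
Proof.
elim: q c b => [|q IH] c b.
  rewrite /= big_ord0 oppr0 mul0r expR0 mulr1 integral_dirac ?diracT ?mul1e //=.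
    by rewrite big_ord0 add0r.
  by apply/measurable_EFinP/measurable_sinD/measurable_lincomb => i; exact: measurable_tnth.
have mlin n (c' : 'I_n -> R) : measurable_fun [set: n.-tuple (measurableTypeR R)]
    (fun z => \sum_i c' i * tnth z i).
  by apply: measurable_lincomb => i; exact: measurable_tnth.
have sin1 (x : R) : `|sin x| <= 1 by rewrite ler_norml sin_le1 sin_geN1.
have mf' : measurable_fun [set: q.+1.-tuple (measurableTypeR R)]
   (fun z => sin (\sum_i c i * tnth z i + b)).
  by apply: measurable_sinD; exact: mlin.
have mf : measurable_fun [set: q.+1.-tuple (measurableTypeR R)]
   (fun z => (sin (\sum_i c i * tnth z i + b))%:E).
  exact/measurable_EFinP.
rewrite [LHS]/= /distribution integral_pushforward //; last first.
  rewrite preimage_setT.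
  apply: (@bounded_prob_integrable _ _ _ (fun z => sin (\sum_i c i * tnth (tuple_cons z) i + b)) 1) => //.
  exact: (measurableT_comp mf' (@measurable_tuple_cons R q)).
rewrite preimage_setT.
pose g (z : measurableTypeR R * q.-tuple (measurableTypeR R)) :=
  sin (\sum_i c (lift ord0 i) * tnth z.2 i + (c ord0 * z.1 + b)).
have gE z : sin (\sum_i c i * tnth (tuple_cons z) i + b) = g z.
  rewrite big_ord_recl /tuple_cons tnth0 /g; congr sin.
  rewrite addrAC addrC; congr (_ + _).
  by apply: eq_bigr => i _; rewrite tnthS.
under eq_integral do rewrite /= gE.
have mg : measurable_fun setT g.
  apply: measurable_sinD2.
  - apply: (measurableT_comp (mlin q (fun i => c (lift ord0 i)))).
    exact: measurable_snd.
  - by apply: measurable_funD => //; apply: measurable_funM => //; exact: measurable_fst.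
have ig : (normal_prob (0 : R) 1 \x std_gauss q)%E.-integrable setT (EFin \o g).
  by apply: (@bounded_prob_integrable _ _ _ g 1) => // z; exact: sin1.
rewrite -(integral12_prod_meas1 ig) /fubini_F /=.
pose K := expR (- (\sum_i c (lift ord0 i) ^+ 2) / 2).
transitivity (\int[normal_prob (0 : R) 1]_x ((sin (c ord0 * x + b))%:E * K%:E))%E.
  by apply: eq_integral => x _; rewrite -EFinM -(IH (fun i => c (lift ord0 i))).
rewrite integralZr //; last first.
  have ms : measurable_fun [set: measurableTypeR R] (fun x => sin (c ord0 * x + b)).
    by apply: measurable_sinD; exact: measurable_funM.
  exact: (@bounded_prob_integrable _ _ (normal_prob (0 : R) 1) _ 1 ms (fun x => sin1 _)).
rewrite integral_sin_normal_prob -EFinM -mulrA -expRD big_ord_recl.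
by congr (_ * expR _)%:E; field.
Qed.

End StdGaussian.

(** * Convergence of characteristic functions *)

(** Heine-Cantor in a form where [z] may lie outside [K]; the covering compactness of [K] yields a
    radius common to all its points. *)
Lemma compact_uniform_continuity (R : realType) (U : pseudoMetricType R)
    (h : U -> R) (K : set U) : compact K ->
  (forall x, K x -> {for x, continuous h}) -> forall e : R, 0 < e ->
  exists2 e' : R, 0 < e' &
    forall x, K x -> forall z, ball x e' z -> `|h z - h x| < e.
Proof.
move=> /compact_near_coveringP cK hc e e0.
have e2 : 0 < e / 2 by rewrite divr_gt0.
have hP x : K x -> \forall x' \near x & i \near (0 : R)^'+,
    forall z, ball x' i z -> `|h z - h x'| < e.
  move=> Kx; have /cvgrPdist_lt/(_ _ e2)/nbhs_ballP[r /= r0 rP] := hc x Kx.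
  have r2 : 0 < r / 2 by rewrite divr_gt0.
  exists (ball x (r / 2), [set i | i < r / 2]) => /=.
    by split; [exact: nbhsx_ballx|exact: nbhs_right_lt].
  move=> [y i] /= [xy ir] z yz.
  have xy' : ball x r y by apply: le_ball xy; lra.
  have xz : ball x r z.
    by rewrite (splitr r); apply: ball_triangle xy (le_ball (ltW ir) yz).
  have := rP _ xy'; have := rP _ xz => /= h1 h2.
  rewrite (splitr e) -(subrKA (h x)) (le_lt_trans (ler_normD _ _)) // ltrD //.
  by rewrite distrC.
have := cK R 0^'+ (fun i x => forall z, ball x i z -> `|h z - h x| < e) _ hP.
move=> H; have FF : ProperFilter (0 : R)^'+ by exact: at_right_proper_filter.
have [i [iK i0]] := filter_ex (filterI (H _) (@nbhs_right_gt _ (0 : R))).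
by exists i.
Qed.

(** * Approximation by trigonometric polynomials *)

Section TrigonometricPolynomials.
Variables (R : realType) (q : nat).
Implicit Types (x : 'cV[R]_q).

(** With a free phase, sines alone give the constants and the cosines: this is the real span of the
    real and imaginary parts of the characters. *)
Inductive trigpoly : ('cV[R]_q -> R) -> Prop :=
| trigpoly_sin a (c : 'I_q -> R) b :
    trigpoly (fun x => a * sin (\sum_i c i * x i ord0 + b))
| trigpoly_add f g : trigpoly f -> trigpoly g -> trigpoly (fun x => f x + g x).

Lemma trigpoly_cst a : trigpoly (fun=> a).
Proof.
have -> : (fun=> a) = (fun x : 'cV[R]_q =>
    a * sin (\sum_i (fun=> 0) i * x i ord0 + pi / 2)).
  apply/funext => x; rewrite big1 ?add0r ?sin_pihalf ?mulr1 // => i _.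
  by rewrite mul0r.
exact: trigpoly_sin.
Qed.

Lemma trigpoly_scale a f : trigpoly f -> trigpoly (fun x => a * f x).
Proof.
elim=> [a' c b|f1 f2 _ IH1 _ IH2].
  under eq_fun do rewrite mulrA; exact: trigpoly_sin.
by under eq_fun do rewrite mulrDr; exact: trigpoly_add.
Qed.

(** The product formula [2 sin u sin v = cos (v - u) - cos (v + u)], with cosines written as sines
    shifted by [pi / 2]. *)
Lemma trigpoly_mulsin k th f : trigpoly f ->
  trigpoly (fun x => sin (th * x k ord0) * f x).
Proof.
elim=> [a c b|f1 f2 _ IH1 _ IH2]; last first.
  by under eq_fun do rewrite mulrDr; exact: trigpoly_add.
pose c1 i := c i - th *+ (i == k); pose c2 i := c i + th *+ (i == k).
have -> : (fun x : 'cV[R]_q => sin (th * x k ord0) *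
      (a * sin (\sum_i c i * x i ord0 + b)))
    = (fun x => a / 2 * sin (\sum_i c1 i * x i ord0 + (b + pi / 2))
        + - (a / 2) * sin (\sum_i c2 i * x i ord0 + (b + pi / 2))).
  apply/funext => x; rewrite !addrA !sinDpihalf.
  have sE (e : R) : \sum_i (c i + e *+ (i == k)) * x i ord0
      = \sum_i c i * x i ord0 + e * x k ord0.
    under eq_bigr do rewrite mulrDl; rewrite big_split /=; congr (_ + _).
    rewrite (bigD1 k) //= eqxx mulr1n big1 ?addr0 // => i /negbTE ->.
    by rewrite mulr0n mul0r.
  have -> : \sum_i c1 i * x i ord0 = \sum_i c i * x i ord0 - th * x k ord0.
    by rewrite -mulNr -sE; apply: eq_bigr => i _; rewrite /c1 mulNrn.
  rewrite /c2 sE; move: (\sum_i _) (th * _) => A B.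
  rewrite [A - B + b]addrAC [A + B + b]addrAC.
  by move: (A + b) => C; rewrite cosB cosD; field.
by apply: trigpoly_add; exact: trigpoly_sin.
Qed.

Lemma trigpoly_bounded f : trigpoly f -> exists K : R, forall x, `|f x| <= K.
Proof.
elim=> [a c b|f1 f2 _ [K1 h1] _ [K2 h2]].
  by exists `|a| => x; rewrite normrM ler_piMr // ler_norml sin_le1 sin_geN1.
by exists (K1 + K2) => x; rewrite (le_trans (ler_normD _ _)) // lerD.
Qed.

Lemma trigpoly_measurable d (T : measurableType d) (W : T -> 'cV[R]_q) f :
  (forall i, measurable_fun [set: T] (fun w => W w i ord0)) -> trigpoly f ->
  measurable_fun [set: T] (f \o W).
Proof.
move=> mW; elim=> [a c b|f1 f2 _ h1 _ h2]; last exact: measurable_funD.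
apply: measurable_funM => //; apply: measurable_sinD.
exact: (measurable_lincomb _ (fun i => mW i)).
Qed.

End TrigonometricPolynomials.

Section RandomWalk.
Variables (R : realType) (I : finType).
Implicit Types (t : I -> R) (phi : (I -> nat) -> R) (k : I -> nat).

Definition step i k : I -> nat := fun j => (k j + (j == i))%N.

(* The expectation of [phi] at the end of a random walk starting from [k] which
   at each of the successive times [i] of [s] increments its [i]-th coordinate
   with probability [t i]; an operator form of the Bernstein polynomials. *)
Fixpoint walk t (s : seq I) phi k : R :=
  if s is i :: s' then
    t i * walk t s' phi (step i k) + (1 - t i) * walk t s' phi k
  else phi k.

Lemma walk_cst t s a k : walk t s (fun=> a) k = a.
Proof. by elim: s k => //= i s IH k; rewrite !IH; ring. Qed.

Lemma walkD t s phi psi k :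
  walk t s (fun k => phi k + psi k) k = walk t s phi k + walk t s psi k.
Proof. by elim: s k => //= i s IH k; rewrite !IH; ring. Qed.

Lemma walkZ t s a phi k :
  walk t s (fun k => a * phi k) k = a * walk t s phi k.
Proof. by elim: s k => //= i s IH k; rewrite !IH; ring. Qed.

Lemma walk_sum t s (J : finType) (F : J -> (I -> nat) -> R) k :
  walk t s (fun k => \sum_j F j k) k = \sum_j walk t s (F j) k.
Proof.
elim: s k => //= i s IH k; rewrite !IH !mulr_sumr -big_split /=.
by apply: eq_bigr => j _.
Qed.

Lemma le_walk t s phi psi k : (forall i, 0 <= t i <= 1) ->
  (forall k, phi k <= psi k) -> walk t s phi k <= walk t s psi k.
Proof.
move=> t01 le; elim: s k => //= i s IH k; have /andP[t0 t1] := t01 i.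
by rewrite lerD // ler_wpM2l // subr_ge0.
Qed.

Lemma walk_norm t s phi psi k : (forall i, 0 <= t i <= 1) ->
  (forall k, `|phi k| <= psi k) -> `|walk t s phi k| <= walk t s psi k.
Proof.
move=> t01 le; rewrite ler_norml -mulN1r -walkZ.
by apply/andP; split; apply: le_walk => // k'; have := le k';
  rewrite ler_norml ?mulN1r => /andP[].
Qed.

(** Variance plus squared bias: coordinate [i] ends at [k i] plus a binomial variable with
    parameters [count_mem i s] and [t i]. *)
Lemma walk_variance t s i a k :
  walk t s (fun k => ((k i)%:R - a) ^+ 2) k
  = (count_mem i s)%:R * (t i * (1 - t i))
    + ((k i)%:R + (count_mem i s)%:R * t i - a) ^+ 2.
Proof.
elim: s k => [|j s IH] k /=; first by rewrite !mul0r add0r addr0.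
rewrite !IH /step natrD; have [->|ij] := eqVneq j i.
  by rewrite !natrD /=; ring.
by rewrite addr0 add0n; ring.
Qed.

End RandomWalk.

Section TrigonometricApproximation.
Variables (R : realType) (q : nat).

(** The transition probabilities are affine in sines, and a product with such a sine stays in the
    class. *)
Lemma trigpoly_walk th (s : seq 'I_q) phi k :
  trigpoly (fun x : 'cV[R]_q =>
    walk (fun i => (1 + sin (th * x i ord0)) / 2) s phi k).
Proof.
elim: s k => [|i s IH] k /=; first exact: trigpoly_cst.
pose w (x : 'cV[R]_q) k := walk (fun i => (1 + sin (th * x i ord0)) / 2) s phi k.
have -> : (fun x : 'cV[R]_q => (1 + sin (th * x i ord0)) / 2 * w x (step i k)
      + (1 - (1 + sin (th * x i ord0)) / 2) * w x k)
    = (fun x => (2^-1 * w x (step i k) + 2^-1 * (sin (th * x i ord0) * w x (step i k)))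
      + (2^-1 * w x k + - 2^-1 * (sin (th * x i ord0) * w x k))).
  by apply/funext => x; field.
by do 2?apply: trigpoly_add; apply: trigpoly_scale; try apply: trigpoly_mulsin; exact: IH.
Qed.

Lemma compact_box (L : R) : compact [set x : 'cV[R]_q | forall i, `|x i ord0| <= L].
Proof.
have -> : [set x : 'cV[R]_q | forall i, `|x i ord0| <= L]
    = trmx @` [set v : 'rV[R]_q | forall i, `[- L, L]%classic (v ord0 i)].
  apply/seteqP; split=> [x xL|_ [v vL <-] i] /=.
    exists x^T; last by rewrite trmxK.
    by move=> i /=; rewrite mxE in_itv /= -ler_norml.
  by have := vL i; rewrite /= mxE in_itv /= -ler_norml.
apply: continuous_compact; last first.
  have H := @rV_compact R q (fun=> `[- L, L]%classic) (fun _ => @segment_compact R _ _).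
  exact: H.
apply: continuous_subspaceT => v A /nbhs_ballP[e /= e0 eA]; apply/nbhs_ballP.
exists e => //= w [_ vw]; apply: eA; split=> // i j; rewrite !mxE; exact: vw.
Qed.

(** A Bernstein operator in the variables [(1 + sin (th * x i)) / 2], applied to [g] read through
    the arcsine. Being an average of values of [g], it keeps the bound [M] on the whole space, on
    which the control of the tails relies. *)
Lemma trigpoly_approx (g : 'cV[R]_q -> R) (M L e : R) : continuous g ->
  (forall x, `|g x| <= M) -> 0 < L -> 0 < e -> exists f : 'cV[R]_q -> R,
  [/\ trigpoly f, forall x, `|f x| <= M
    & forall x : 'cV[R]_q, (forall i, `|x i ord0| <= L) -> `|f x - g x| <= e].
Proof.
move=> cg gM L0 e0.
have M0 : 0 <= M by apply: le_trans (gM 0).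
have e2 : 0 < e / 2 by rewrite divr_gt0.
have [d d0 gd] := compact_uniform_continuity (@compact_box L) (fun x _ => cg x) e2.
(* On the cube, [th * x i] stays in [[- pi / 4, pi / 4]]: the sine is injective there and its values
   stay away from the ends of the domain of the arcsine. *)
pose th : R := pi / (4 * L).
have th0 : 0 < th by rewrite divr_gt0 ?pi_gt0 // mulr_gt0.
have thL : th * L = pi / 4 by rewrite /th; field; rewrite gt_eqF.
have pi4 : 0 < pi / 4 :> R by rewrite divr_gt0 // pi_gt0.
pose S : R := sin (pi / 4).
have S1 : S < 1.
  have p0 := pi_gt0 R; rewrite -(sin_pihalf R) /S ltr_sin ?in_itv /=; last 2 first.
  - by apply/andP; split; lra.
  - by apply/andP; split; lra.
  lra.
have asin_uc : exists2 d' : R, 0 < d' & forall y, `|y| <= S -> forall z, `|z - y| < d' ->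
    `|asin z - asin y| < th * d.
  have [||d' d'0 H] := @compact_uniform_continuity R R (@asin R) `[- S, S]%classic
    (@segment_compact _ _ _) _ (th * d).
  - move=> y; rewrite /= in_itv /= => /andP[yS1 yS2].
    by apply: continuous_asin; apply/andP; split; lra.
  - exact: mulr_gt0.
  exists d' => // y yS z zy; apply: H; last by rewrite /ball /= distrC.
  by rewrite /= in_itv /= -ler_norml.
have [d' d'0 asind] := asin_uc.
(* The number of steps in each coordinate; it makes the Chebyshev error [2 M q / (m d'^2)] less than
   [e / 2]. *)
pose m := (Num.bound (2 * M * q%:R / (d' ^+ 2 * (e / 2)))).+1.
(* The point that corresponds to the frequencies [k i / m]: for [k i <= m], its coordinates satisfy
   [sin (th * y i) = 2 (k i) / m - 1]. *)
pose node (k : 'I_q -> nat) : 'cV[R]_q :=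
  \col_i (asin (2 * (k i)%:R / m%:R - 1) / th).
pose s : seq 'I_q := flatten (nseq m (enum 'I_q)).
have s_count i : count_mem i s = m.
  rewrite /s count_flatten map_nseq sumn_nseq count_uniq_mem ?enum_uniq //.
  by rewrite mem_enum mul1n.
pose t (x : 'cV[R]_q) i := (1 + sin (th * x i ord0)) / 2.
have t01 x i : 0 <= t x i <= 1.
  rewrite /t; have := sin_le1 (th * x i ord0); have := sin_geN1 (th * x i ord0).
  by move=> h1 h2; apply/andP; split; lra.
exists (fun x => walk (t x) s (g \o node) (fun=> 0%N)); split.
- exact: trigpoly_walk.
- move=> x; rewrite -[leRHS](walk_cst (t x) s M (fun=> 0%N)).
  by apply: walk_norm => [|k]; [exact: t01|exact: gM].
move=> x xL; set k0 := fun=> 0%N.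
rewrite -[g x in leLHS](walk_cst (t x) s (g x) k0) -mulN1r -walkZ -walkD.
(* A majorant of [|g (node k) - g x|]: uniform continuity gives [e / 2] if all the rescaled
   deviations are below [d']; otherwise one term of the sum is at least 1, and [2 * M] bounds the
   difference. *)
pose V k := e / 2 + 2 * M * \sum_i d' ^- 2 * (2 / m%:R) ^+ 2 * ((k i)%:R - m%:R * t x i) ^+ 2.
apply: (@le_trans _ _ (walk (t x) s V k0)).
  apply: walk_norm => // k; rewrite /= mulN1r /V.
  have vy i : 2 * (k i)%:R / m%:R - 1 - sin (th * x i ord0)
      = (2 / m%:R) * ((k i)%:R - m%:R * t x i).
    by rewrite /t; field; rewrite pnatr_eq0.
  have S0 i : 0 <= d' ^- 2 * (2 / m%:R) ^+ 2 * ((k i)%:R - m%:R * t x i) ^+ 2.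
    by apply: mulr_ge0 (sqr_ge0 _); apply: mulr_ge0 (sqr_ge0 _); rewrite invr_ge0 sqr_ge0.
  have [far|] := pselect (exists i, d' <= `|(2 / m%:R) * ((k i)%:R - m%:R * t x i)|).
    have {far}[i far] := far.
    apply: (@le_trans _ _ (2 * M)).
      by rewrite (le_trans (ler_normB _ _)) // (_ : 2 * M = M + M) ?lerD //; ring.
    rewrite -[leLHS]add0r lerD ?(ltW e2) // ler_peMr ?mulr_ge0 //.
    rewrite (bigD1 i) //= -[leLHS]addr0 lerD ?sumr_ge0 //.
    rewrite -mulrA -exprMn mulrC ler_pdivlMr ?exprn_gt0 // mul1r.
    by rewrite -[leRHS]real_normK ?num_real // lerXn2r // ?nnegrE ?(ltW d'0).
  move=> /forallNP near; rewrite -[leLHS]addr0 lerD ?mulr_ge0 ?sumr_ge0 //.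
  apply/ltW/gd => //; split=> // i j; rewrite ord1 mxE /ball /=.
  have {near} near_i : `|2 * (k i)%:R / m%:R - 1 - sin (th * x i ord0)| < d'.
    by rewrite vy ltNge; apply/negP/near.
  have p0 := pi_gt0 R.
  have thx : `|th * x i ord0| <= pi / 4.
    by rewrite normrM gtr0_norm // -thL ler_wpM2l // ltW.
  move: (thx); rewrite ler_norml => /andP[thx1 thx2].
  have yS : `|sin (th * x i ord0)| <= S.
    have sin_le (u v : R) : - (pi / 2) <= u -> u <= v -> v <= pi / 2 -> sin u <= sin v.
      move=> u1 uv v2; rewrite leNgt ltr_sin ?in_itv /= -?leNgt //.
        by apply/andP; split; lra.
      by apply/andP; split; lra.
    by rewrite ler_norml -sinN /S; apply/andP; split; apply: sin_le; lra.
  have := asind _ yS _ near_i; rewrite sinK ?in_itv /=; last by apply/andP; split; lra.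
  move=> hd; set v := asin _ in hd *.
  rewrite [X in `|X|](_ : _ = - (v - th * x i ord0) / th); last first.
    by rewrite (_ : x i 0 = x i ord0) //; field; rewrite gt_eqF.
  by rewrite normrM normrN normfV (gtr0_norm th0) ltr_pdivrMr // [d * th]mulrC.
rewrite /V walkD walk_cst walkZ walk_sum.
have -> : \sum_j walk (t x) s (fun k => d' ^- 2 * (2 / m%:R) ^+ 2 * ((k j)%:R - m%:R * t x j) ^+ 2) k0
   = \sum_j d' ^- 2 * (2 / m%:R) ^+ 2 * (m%:R * (t x j * (1 - t x j))).
  apply: eq_bigr => j _; rewrite walkZ walk_variance s_count add0r subrr expr0n.
  by rewrite addr0.
have m0 : 0 < m%:R :> R by rewrite ltr0n.
rewrite [leRHS](splitr e) lerD2l.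
apply: (@le_trans _ _ (2 * M * \sum_(j < q) d' ^- 2 / m%:R)).
  rewrite ler_wpM2l ?mulr_ge0 //; apply: ler_sum => j _.
  rewrite -mulrA ler_wpM2l ?invr_ge0 ?sqr_ge0 // expr_div_n mulrA.
  have -> : 2 ^+ 2 / m%:R ^+ 2 * (m%:R * t x j * (1 - t x j))
      = (4 * (t x j * (1 - t x j))) * m%:R^-1 :> R.
    by field; rewrite gt_eqF.
  rewrite ler_piMl ?invr_ge0 ?ler0n //.
  (* The variance factor: [4 t (1 - t) <= 1]. *)
  have := sqr_ge0 (t x j - 2^-1); lra.
rewrite sumr_const card_ord -mulr_natr.
have mb : 2 * M * q%:R / (d' ^+ 2 * (e / 2)) < m%:R.
  apply: (@lt_le_trans _ _ (Num.bound (2 * M * q%:R / (d' ^+ 2 * (e / 2))))%:R).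
    apply: archi_boundP; rewrite divr_ge0 ?mulr_ge0 ?sqr_ge0 //; lra.
  by rewrite ler_nat.
rewrite ltr_pdivrMr ?mulr_gt0 ?exprn_gt0 // in mb.
rewrite [leLHS](_ : _ = 2 * M * q%:R / (m%:R * d' ^+ 2)); last by field; rewrite !gt_eqF.
rewrite ler_pdivrMr ?mulr_gt0 ?exprn_gt0 //.
by apply: ltW; rewrite [X in _ < X](_ : _ = m%:R * (d' ^+ 2 * (e / 2))) //; field.
Qed.

End TrigonometricApproximation.

(** * Integrals, tail events and measurability *)

Section ProbabilityIntegrals.
Context (R : realType) d (T : measurableType d) (P : probability T R).
Implicit Types (h : T -> R) (A : set T).

Lemma EFin_Rintegral h : P.-integrable [set: T] (EFin \o h) ->
  (\int[P]_w (h w)%:E)%E = (\int[P]_w h w)%:E.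
Proof. by move=> ih; rewrite fineK //; exact: integrable_fin_num. Qed.

Lemma le_bound_Rintegral h A e K : measurable A -> measurable_fun [set: T] h ->
  (forall w, `|h w| <= e + K * \1_A w) ->
  `|\int[P]_w h w| <= e + K * fine (P A).
Proof.
move=> mA mh hb.
have mA1 : measurable_fun [set: T] (fun w => \1_A w : R) by exact: measurable_indic.
have i1 : P.-integrable [set: T] (EFin \o (fun w => \1_A w : R)).
  apply: (@bounded_prob_integrable _ _ _ _ _ 1) => // w.
  by rewrite indicE; case: (_ \in _); rewrite ?normr1 ?normr0.
have ie : P.-integrable [set: T] (EFin \o (fun w => e)).
  by apply: (@bounded_prob_integrable _ _ _ _ _ `|e|).
have iK : P.-integrable [set: T] (EFin \o (fun w => K * \1_A w)).
  by rewrite /comp; under eq_fun do rewrite EFinM; exact: integrableZl.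
have ib : P.-integrable [set: T] (EFin \o (fun w => e + K * \1_A w)).
  by rewrite /comp; under eq_fun do rewrite EFinD; exact: integrableD.
have ih : P.-integrable [set: T] (EFin \o h).
  apply: le_integrable ib => //; first exact/measurable_EFinP.
  by move=> w _; rewrite /= lee_fin (le_trans (hb w)) // ler_norm.
apply: (le_trans (le_normr_Rintegral measurableT ih)).
apply: (@le_trans _ _ (\int[P]_w (e + K * \1_A w))).
  by apply: le_Rintegral => //; exact: integrable_norm.
rewrite RintegralD // RintegralZl // Rintegral_cst //.
rewrite (_ : fine _ = 1) ?mulr1; last by rewrite [X in fine X](probability_setT P).
by rewrite /Rintegral integral_indic // setIT.
Qed.

Lemma probability_bigcup_le (I : finType) (A : I -> set T) (e : R) :
  (forall i, measurable (A i)) -> (forall i, (P (A i) <= e%:E)%E) ->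
  (P (\bigcup_(i in [set: I]) A i) <= (#|I|%:R * e)%:E)%E.
Proof.
move=> mA Ae.
have -> : \bigcup_(i in [set: I]) A i = \big[setU/set0]_(i <- enum I) A i.
  rewrite -bigcup_seq; apply: eq_bigcupl; split=> i //= _.
  by rewrite mem_enum.
rewrite cardE; elim: (enum I) => [|i s IH].
  by rewrite big_nil measure0 mul0r.
rewrite big_cons (le_trans (measureU2 _ _ _)) //; first exact: bigsetU_measurable.
by rewrite /= -natr1 mulrDl mul1r addrC EFinD leeD.
Qed.

Lemma measurable_abs_gt h L : measurable_fun [set: T] h ->
  measurable [set w | L < `|h w|].
Proof.
move=> mh; rewrite -[X in measurable X]setTI.
rewrite (_ : [set w | L < `|h w|] = (fun w => `|h w|) @^-1` `]L, +oo[%classic).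
  have mnh : measurable_fun [set: T] (fun w => `|h w|) by exact: measurableT_comp.
  by apply: mnh => //; exact: measurable_itv.
by apply/seteqP; split=> w /=; rewrite in_itv /= andbT.
Qed.

(** The events [n < |h|] decrease to the empty set. *)
Lemma probability_tight h (e : R) : measurable_fun [set: T] h -> 0 < e ->
  exists L : R, forall L', L <= L' -> (P [set w | (L' < `|h w|)%R] <= e%:E)%E.
Proof.
move=> mh e0; pose F (n : nat) := [set w | n%:R < `|h w|].
have F0 : \bigcap_n F n = set0.
  rewrite -subset0 => w /(_ (Num.bound `|h w|) I) /=.
  by rewrite /F /= ltNge ltW // archi_boundP.
have : P (F n) @[n --> \oo] --> P (\bigcap_n F n).
  apply: nonincreasing_cvg_mu.
  - by rewrite -ge0_fin_numE // fin_num_measure //; exact: measurable_abs_gt.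
  - by move=> n; exact: measurable_abs_gt.
  - by apply: bigcap_measurable => // n _; exact: measurable_abs_gt.
  - move=> m n mn; apply/subsetPset => w; apply: le_lt_trans.
    by rewrite ler_nat.
rewrite F0 measure0 => /fine_cvgP[_ /cvgr0Pnorm_le /(_ e e0)[N _ NP]].
exists N%:R => L' NL'; apply: (@le_trans _ _ (P (F N))).
  apply: le_measure; rewrite ?inE; try exact: measurable_abs_gt.
  by move=> w; exact: le_lt_trans.
rewrite -[leLHS]fineK ?fin_num_measure //; last exact: measurable_abs_gt.
by rewrite lee_fin (le_trans (ler_norm _)) //; apply: NP => /=.
Qed.

End ProbabilityIntegrals.

(** Measurability is known for the coordinates only; [g \o W] is a pointwise limit of trigonometric
    polynomials in [W], which are built from the coordinates. *)
Lemma measurable_comp_continuous (R : realType) d (T : measurableType d) q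
    (W : T -> 'cV[R]_q) (g : 'cV[R]_q -> R) (M : R) :
  (forall i, measurable_fun [set: T] (fun w => W w i ord0)) ->
  continuous g -> (forall x, `|g x| <= M) -> measurable_fun [set: T] (g \o W).
Proof.
move=> mW cg gM.
have /choice[f fP] : forall n : nat, exists f : 'cV[R]_q -> R, trigpoly f /\
    forall x : 'cV[R]_q, (forall i, `|x i ord0| <= n.+1%:R) -> `|f x - g x| <= n.+1%:R^-1.
  move=> n; have n0 : 0 < n.+1%:R^-1 :> R by rewrite invr_gt0.
  have [f [f1 _ f3]] := @trigpoly_approx R q g M n.+1%:R _ cg gM (ltr0Sn _ _) n0.
  by exists f.
apply: (@measurable_fun_cvg _ _ _ _ (fun n => f n \o W)) => //.
  by move=> n; apply: trigpoly_measurable => //; have [] := fP n.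
move=> w _; apply/cvgrPdist_le => e e0.
have [N xN] : exists N : nat, forall i, `|W w i ord0| <= N%:R.
  exists (Num.bound (\sum_i `|W w i ord0|)) => i; apply: ltW.
  apply: (@le_lt_trans _ _ (\sum_i `|W w i ord0|)).
    by rewrite (bigD1 i) //= lerDl sumr_ge0.
  by apply: archi_boundP; exact: sumr_ge0.
near=> n; rewrite /= distrC.
have [_ /(_ (W w))] := fP n; move/(_ _)/le_trans; apply.
  by move=> i; rewrite (le_trans (xN i)) // ler_nat; apply: leqW; near: n; exact: nbhs_infty_ge.
have : n.+1%:R^-1 < e by near: n; exact: near_infty_natSinv_lt (PosNum e0).
exact: ltW.
Unshelve. all: by end_near. Qed.

(** * From characteristic functions and tightness to weak convergence *)

Section LevyContinuity.
Context (R : realType) (dT : nat -> measure_display).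
Context (T : forall n, measurableType (dT n)) (P : forall n, probability (T n) R).
Context (q : nat) (W : forall n, T n -> 'cV[R]_q).
Context dS (S : measurableType dS) (Q : probability S R) (Y : S -> 'cV[R]_q).
Hypothesis mW : \forall n \near \oo,
  forall i, measurable_fun [set: T n] (fun w => @W n w i ord0).
Hypothesis mY : forall i, measurable_fun [set: S] (fun z => Y z i ord0).
Hypothesis tight : forall e : R, 0 < e -> exists L : R, \forall n \near \oo,
  forall i, (P n [set w | (L < `|@W n w i ord0|)%R] <= e%:E)%E.
Hypothesis cf : forall (c : 'I_q -> R) (b : R),
  (fun n => \int[P n]_w sin (\sum_i c i * @W n w i ord0 + b)) @ \oo -->
  \int[Q]_z sin (\sum_i c i * Y z i ord0 + b).

Lemma trigpoly_integrable d (U : measurableType d) (Pr : probability U R)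
    (Z : U -> 'cV[R]_q) f : (forall i, measurable_fun [set: U] (fun w => Z w i ord0)) ->
  trigpoly f -> Pr.-integrable [set: U] (EFin \o (f \o Z)).
Proof.
move=> mZ tf; have [K fK] := trigpoly_bounded tf.
apply: (@bounded_prob_integrable _ _ _ _ _ K) => [|x]; last exact: fK.
exact: trigpoly_measurable.
Qed.

Lemma cvg_trigpoly f : trigpoly f ->
  (fun n => \int[P n]_w f (@W n w)) @ \oo --> \int[Q]_z f (Y z).
Proof.
have tsin (c : 'I_q -> R) b :
    trigpoly (fun x : 'cV[R]_q => sin (\sum_i c i * x i ord0 + b)).
  by have := trigpoly_sin 1 c b; under eq_fun do rewrite mul1r.
elim=> [a c b|f1 f2 t1 h1 t2 h2].
  rewrite RintegralZl //; last exact: (trigpoly_integrable Q mY (tsin c b)).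
  have H : (fun n => a * \int[P n]_w sin (\sum_i c i * @W n w i ord0 + b)) @ \oo
      --> a * \int[Q]_z sin (\sum_i c i * Y z i ord0 + b).
    by apply: cvgMr; exact: cf.
  apply: cvg_trans H; apply: near_eq_cvg.
  near=> n; rewrite RintegralZl //.
  by apply: (trigpoly_integrable (P n) _ (tsin c b)); near: n.
rewrite RintegralD //; try exact: (trigpoly_integrable Q mY).
apply: cvg_trans (cvgD h1 h2); apply: near_eq_cvg.
near=> n; rewrite RintegralD //.
- by apply: (trigpoly_integrable (P n) _ t1); near: n.
- by apply: (trigpoly_integrable (P n) _ t2); near: n.
Unshelve. all: by end_near. Qed.

(** The trigonometric polynomial shares the bound [M] of [g], so replacing one by the other costs
    [r] on a large cube and at most [2 * M] on the event of leaving it, for all large [n] alike. *)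
Lemma cvg_bounded_continuous (g : 'cV[R]_q -> R) (M : R) : continuous g ->
  (forall x, `|g x| <= M) ->
  (fun n => (\int[P n]_w (g (@W n w))%:E)%E) @ \oo --> (\int[Q]_z (g (Y z))%:E)%E.
Proof.
move=> cg gM.
have M0 : 0 <= M by apply: le_trans (gM 0).
have far d (U : measurableType d) (Pr : probability U R) (Z : U -> 'cV[R]_q) (L e : R)
    (f : 'cV[R]_q -> R) : (forall i, measurable_fun [set: U] (fun w => Z w i ord0)) ->
    0 < e -> (forall i, (Pr [set w | (L < `|Z w i ord0|)%R] <= e%:E)%E) -> trigpoly f ->
    (forall x, `|f x| <= M) ->
    (forall x : 'cV[R]_q, (forall i, `|x i ord0| <= L) -> `|f x - g x| <= e) ->
    `|\int[Pr]_w f (Z w) - \int[Pr]_w g (Z w)| <= e + 2 * M * (q%:R * e).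
  move=> mZ e0 PL tf fM fg.
  pose A := \bigcup_(i in [set: 'I_q]) [set w | L < `|Z w i ord0|].
  have mLi i : measurable [set w | L < `|Z w i ord0|] by exact: measurable_abs_gt.
  have mA : measurable A by apply: fin_bigcup_measurable => //.
  have mg : measurable_fun [set: U] (g \o Z) by exact: measurable_comp_continuous gM.
  have mf : measurable_fun [set: U] (f \o Z) by exact: trigpoly_measurable.
  rewrite -RintegralB //; last 2 first.
  - exact: trigpoly_integrable.
  - by apply: (@bounded_prob_integrable _ _ _ _ _ M) => // x; exact: gM.
  apply: (le_trans (@le_bound_Rintegral _ _ _ Pr _ A e (2 * M) mA _ _)).
  - exact: measurable_funB.
  - move=> w; rewrite indicE; have [wA|wA] := boolP (w \in A).
      rewrite mulr1 -[leLHS]add0r lerD ?(ltW e0) //.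
      by rewrite (le_trans (ler_normB _ _)) // (_ : 2 * M = M + M) ?lerD //; ring.
    rewrite mulr0 addr0; apply: fg => i; rewrite leNgt; apply/negP => Li.
    by move/negP: wA; apply; rewrite inE; exists i.
  rewrite lerD2l ler_wpM2l ?mulr_ge0 // -lee_fin fineK ?fin_num_measure //.
  rewrite /= -[X in (X%:R * e)%R](card_ord q).
  exact: (probability_bigcup_le mLi PL).
(* Two replacement errors [r + 2 M q r] and one convergence error [r] add up to [K * r = e]. *)
pose K := 2 * (1 + 2 * M * q%:R) + 1.
have K0 : 0 < K by rewrite ltr_pwDr // !mulr_ge0 // addr_ge0 // !mulr_ge0.
have ig n : (forall i, measurable_fun [set: T n] (fun w => @W n w i ord0)) ->
    (P n).-integrable [set: T n] (EFin \o (g \o @W n)).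
  move=> mWn; apply: (@bounded_prob_integrable _ _ _ _ _ M) => [|x]; last exact: gM.
  exact: measurable_comp_continuous gM.
have igQ : Q.-integrable [set: S] (EFin \o (g \o Y)).
  apply: (@bounded_prob_integrable _ _ _ _ _ M) => [|x]; last exact: gM.
  exact: measurable_comp_continuous gM.
rewrite (EFin_Rintegral igQ); apply/fine_cvgP; split.
  apply: filterS mW => n /ig /(integrable_fin_num measurableT); exact.
apply/cvgrPdist_le => e e0.
pose r := e / K; have r0 : 0 < r by rewrite divr_gt0.
have [L1 L1P] := tight r0.
have /choice[L2 L2P] := fun i => probability_tight Q (mY i) r0.
(* One cube for the sequence and for the limit; the term 1 makes its size positive. *)
pose L := 1 + `|L1| + \sum_i `|L2 i|.
have sL2 : 0 <= \sum_i `|L2 i| by exact: sumr_ge0.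
have L10 := normr_ge0 L1; have L1n := ler_norm L1.
have L0 : 0 < L by rewrite /L; lra.
have [f [tf fM fg]] := trigpoly_approx cg gM L0 r0.
have hQ := far _ S Q Y L r f mY r0 _ tf fM fg.
have {}hQ := hQ (fun i => L2P i L _).
have fc := cvg_trigpoly tf.
move/cvgrPdist_le : fc => /(_ r r0) fc.
near=> n.
have mWn : forall i, measurable_fun [set: T n] (fun w => @W n w i ord0) by near: n.
have L1n' : forall i, (P n [set w | (L1 < `|@W n w i ord0|)%R] <= r%:E)%E by near: n.
have hP := far _ (T n) (P n) (@W n) L r f mWn r0 _ tf fM fg.
have {}hP : `|\int[P n]_w f (@W n w) - \int[P n]_w g (@W n w)| <= r + 2 * M * (q%:R * r).
  apply: hP => i; apply: (@le_trans _ _ (P n [set w | L1 < `|@W n w i ord0|])).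
    apply: le_measure; rewrite ?inE; try exact: measurable_abs_gt.
    by move=> w; apply: le_lt_trans; rewrite /L; lra.
  exact: L1n'.
have {}hQ : `|\int[Q]_w f (Y w) - \int[Q]_w g (Y w)| <= r + 2 * M * (q%:R * r).
  apply: hQ => i; have := ler_norm (L2 i).
  have : `|L2 i| <= \sum_i `|L2 i| by rewrite [leRHS](bigD1 i) //= lerDl sumr_ge0.
  by rewrite /L; lra.
have hf : `|\int[Q]_w f (Y w) - \int[P n]_w f (@W n w)| <= r by near: n.
rewrite /= -/(Rintegral _ _ _).
rewrite [leRHS](_ : e = (r + 2 * M * (q%:R * r)) + (r + 2 * M * (q%:R * r)) + r); last first.
  by rewrite /r /K; field; rewrite gt_eqF.
move: hP hQ hf; rewrite !ler_norml => /andP[? ?] /andP[? ?] /andP[? ?].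
by apply/andP; split; lra.
Unshelve. all: by end_near. Qed.

End LevyContinuity.

(** * Sums of independent variables *)

Lemma unit_simple_approx (R : realType) d (X : measurableType d) (h : X -> R)
    (m : nat) : measurable_fun [set: X] h -> (forall x, 0 <= h x <= 1) ->
  exists2 A : 'I_m.+2 -> set X, forall j, measurable (A j) &
    forall x, `|h x - \sum_(j < m.+2) j%:R / m.+1%:R * \1_(A j) x| <= m.+1%:R^-1.
Proof.
move=> mh h01; have m0 : 0 < m.+1%:R :> R by rewrite ltr0n.
(* Level sets of [h] of height [1 / m.+1]; the last index [m.+1] is there for the value 1. *)
exists (fun j => h @^-1` `[j%:R / m.+1%:R, j.+1%:R / m.+1%:R[%classic).
  by move=> j; rewrite -[X in measurable X]setTI; apply: mh => //; exact: measurable_itv.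
move=> x; have /andP[h0 h1] := h01 x.
have t0 : 0 <= h x * m.+1%:R by rewrite mulr_ge0 // ltW.
have /andP[t1 t2] := truncn_itv t0.
set t := Num.truncn _ in t1 t2.
have tm : (t < m.+2)%N.
  rewrite -(ltr_nat R); apply: (le_lt_trans t1); apply: (@le_lt_trans _ _ m.+1%:R).
    by rewrite ler_piMl // ltW.
  by rewrite ltr_nat.
rewrite (bigD1 (Ordinal tm)) //= big1 ?addr0 => [|j jt]; last first.
  rewrite indicE memNset ?mulr0 //= in_itv /= ler_pdivrMr // ltr_pdivlMr //.
  move=> /andP[j1 j2]; move/negP: jt; apply; apply/eqP/val_inj => /=.
  by rewrite /t; apply/esym/eqP; rewrite truncn_eq // j1 j2.
rewrite indicE mem_set ?mulr1 /=; last first.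
  by rewrite in_itv /= ler_pdivrMr // ltr_pdivlMr // t1 t2.
rewrite -[leRHS]mul1r ler_pdivlMr // -[X in _ * X](gtr0_norm m0) -normrM mulrBl divfK ?gt_eqF //.
rewrite ger0_norm ?subr_ge0 // lerBlDr; rewrite -[t.+1%:R]natr1 in t2.
by rewrite addrC ltW.
Qed.

(** The nonnegative sum of the [(a i * B - b i * S) ^+ 2] equals [B * (A * B - S ^+ 2)], which
    leaves only the case [B = 0]. *)
Lemma cauchy_schwarz_sum (R : realDomainType) (I : finType) (a b : I -> R) :
  (\sum_i a i * b i) ^+ 2 <= (\sum_i a i ^+ 2) * (\sum_i b i ^+ 2).
Proof.
set S := \sum_i _ * _; set A := \sum_i a i ^+ 2; set B := \sum_i b i ^+ 2.
have B0 : 0 <= B by apply: sumr_ge0 => i _; exact: sqr_ge0.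
have E : \sum_i (a i * B - b i * S) ^+ 2 = B * (A * B - S ^+ 2).
  transitivity (\sum_i (B ^+ 2 * a i ^+ 2 + (- 2 * B * S) * (a i * b i) + S ^+ 2 * b i ^+ 2)).
    by apply: eq_bigr => i _; ring.
  by rewrite !big_split /= -!mulr_sumr -/A -/B -/S; ring.
have : 0 <= B * (A * B - S ^+ 2) by rewrite -E; apply: sumr_ge0 => i _; exact: sqr_ge0.
have [B00|B00] := eqVneq B 0; last by rewrite pmulr_rge0 ?subr_ge0 // lt_neqAle eq_sym B00.
rewrite B00 mulr0 => _; suff -> : S = 0 by rewrite expr0n.
move: B00 => /psumr_eq0P Bi; apply: big1 => i _.
have /eqP := Bi (fun i _ => sqr_ge0 (b i)) i isT.
by rewrite sqrf_eq0 => /eqP ->; rewrite mulr0.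
Qed.

Section RintegralSum.
Context (R : realType) d (T : measurableType d) (mu : {measure set T -> \bar R}).

Lemma integrable_Rsum (I : Type) (s : seq I) (F : I -> T -> R) :
  (forall i, mu.-integrable [set: T] (EFin \o F i)) ->
  mu.-integrable [set: T] (EFin \o (fun w => \sum_(i <- s) F i w)).
Proof.
move=> iF; rewrite /comp; under eq_fun do rewrite -sumEFin.
by apply: integrable_sum => // i _; exact: iF.
Qed.

Lemma Rintegral_sum (I : Type) (s : seq I) (F : I -> T -> R) :
  (forall i, mu.-integrable [set: T] (EFin \o F i)) ->
  \int[mu]_w (\sum_(i <- s) F i w) = \sum_(i <- s) \int[mu]_w F i w.
Proof.
move=> iF; elim: s => [|i s IH].
  by rewrite big_nil; under eq_Rintegral do rewrite big_nil; rewrite /Rintegral integral0.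
rewrite big_cons -IH -RintegralD //; last exact: integrable_Rsum.
by apply: eq_Rintegral => w _; rewrite big_cons.
Qed.

Lemma integrable_Rscale (a : R) (F : T -> R) :
  mu.-integrable [set: T] (EFin \o F) ->
  mu.-integrable [set: T] (EFin \o (fun w => a * F w)).
Proof.
by move=> iF; rewrite /comp; under eq_fun do rewrite EFinM; exact: integrableZl.
Qed.

End RintegralSum.

Section Iid.
Context (R : realType) (dT dX : measure_display).
Context (T : measurableType dT) (X : measurableType dX).
Context (P : probability T R) (nu : probability X R).
Context (n : nat) (V : 'I_n -> {RV P >-> X}).
Hypothesis indep : mutually_independent V.
Hypothesis law : forall i A, measurable A -> P (V i @^-1` A) = nu A.

Lemma measurable_law i dY (Y : measurableType dY) (h : X -> Y) :
  measurable_fun [set: X] h -> measurable_fun [set: T] (fun w => h (V i w)).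
Proof. by move=> mh; exact: (measurableT_comp mh (measurable_funPT (V i))). Qed.

Lemma ge0_integral_law i (h : X -> \bar R) : measurable_fun [set: X] h ->
  (forall x, (0 <= h x)%E) -> (\int[P]_w h (V i w) = \int[nu]_x h x)%E.
Proof.
move=> mh h0; rewrite -[LHS](ge0_integral_distribution (V i)) //.
by apply: eq_measure_integral => A mA _; exact: law.
Qed.

Lemma integrable_law i (h : X -> R) : nu.-integrable [set: X] (EFin \o h) ->
  P.-integrable [set: T] (EFin \o (h \o V i)).
Proof.
move=> /integrableP[mh hoo]; apply/integrableP; split.
  exact: (measurableT_comp mh (measurable_funPT (V i))).
by rewrite (ge0_integral_law i (h := fun x => `|(h x)%:E|%E)) //; exact: measurableT_comp.
Qed.

Lemma Rintegral_law i (h : X -> R) : nu.-integrable [set: X] (EFin \o h) ->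
  \int[P]_w h (V i w) = \int[nu]_x h x.
Proof.
move=> ih; rewrite /Rintegral; congr fine.
have mh : measurable_fun [set: X] (EFin \o h) by exact: measurable_int ih.
rewrite -[LHS](integral_distribution mh (integrable_law i ih)).
by apply: eq_measure_integral => A mA _; exact: law.
Qed.

(** Linearity extends the factorization from indicators to simple functions, uniform approximation
    extends it to [0 <= h <= 1], and an affine change covers every bounded [h]. *)
Lemma independent_bounded (Y : T -> R) (K C : R) k (h : X -> R) :
  measurable_fun [set: T] Y -> (forall w, `|Y w| <= K) ->
  (forall A, measurable A ->
     \int[P]_w (Y w * \1_A (V k w)) = (\int[P]_w Y w) * fine (nu A)) ->
  measurable_fun [set: X] h -> (forall x, `|h x| <= C) ->
  \int[P]_w (Y w * h (V k w)) = (\int[P]_w Y w) * \int[nu]_x h x.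
Proof.
move=> mY YK YV.
(* A point of [T] shows that [K] is nonnegative; an empty [T] cannot carry mass 1. *)
have [w0|noT] := pselect (exists w : T, True); last first.
  have T0 : [set: T] = set0 by rewrite -subset0 => w _; apply: noT; exists w.
  have := @probability_setT _ _ _ P; rewrite T0 measure0 => /eqP.
  by rewrite eqe eq_sym oner_eq0.
have K0 : 0 <= K by have [w _] := w0; exact: le_trans (YK w).
have iY : P.-integrable [set: T] (EFin \o Y) by exact: bounded_prob_integrable YK.
have iYh (g : X -> R) (G : R) : measurable_fun [set: X] g -> (forall x, `|g x| <= G) ->
    P.-integrable [set: T] (EFin \o (fun w => Y w * g (V k w))).
  move=> mg gG; apply: (@bounded_prob_integrable _ _ _ _ _ (K * G)) => [|w].
    by apply: measurable_funM => //; exact: measurable_law.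
  by rewrite normrM ler_pM.
have unit (g : X -> R) : measurable_fun [set: X] g -> (forall x, 0 <= g x <= 1) ->
    \int[P]_w (Y w * g (V k w)) = (\int[P]_w Y w) * \int[nu]_x g x.
  move=> mg g01; apply/eqP; rewrite -subr_eq0 -normr_le0; apply/ler_addgt0Pr => e e0.
  rewrite add0r.
  (* Makes the two approximation errors [K / m.+1] add up to at most [e]. *)
  pose m := Num.bound (2 * K / e).
  have [A mA Ag] := unit_simple_approx m mg g01.
  pose s x : R := \sum_(j < m.+2) j%:R / m.+1%:R * \1_(A j) x.
  have ms : measurable_fun [set: X] s.
    by apply: measurable_sum => j; apply: measurable_funM => //; exact: measurable_indic.
  have i1 j : nu.-integrable [set: X] (EFin \o (\1_(A j) : X -> R)) by exact: integrable_indic.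
  have iYA (j : 'I_m.+2) : P.-integrable [set: T] (EFin \o (fun w => Y w * \1_(A j) (V k w))).
    apply: (iYh _ 1) => [|x]; first exact: measurable_indic.
    by rewrite indicE; case: (_ \in _); rewrite ?normr1 ?normr0.
  have sP : \int[P]_w (Y w * s (V k w)) = (\int[P]_w Y w) * \int[nu]_x s x.
    rewrite /s Rintegral_sum; last by move=> j; exact: integrable_Rscale.
    rewrite mulr_sumr.
    transitivity (\int[P]_w (\sum_(j < m.+2) j%:R / m.+1%:R * (Y w * \1_(A j) (V k w)))).
      by apply: eq_Rintegral => w _; rewrite mulr_sumr; apply: eq_bigr => j _; rewrite mulrCA.
    rewrite Rintegral_sum; last by move=> j; exact: integrable_Rscale.
    apply: eq_bigr => j _; rewrite RintegralZl // YV // RintegralZl // mulrCA.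
    by congr (_ * (_ * _)); rewrite /Rintegral integral_indic // setIT.
  have ig : nu.-integrable [set: X] (EFin \o g).
    apply: (@bounded_prob_integrable _ _ _ _ _ 1) => // x.
    by have /andP[? ?] := g01 x; rewrite ger0_norm.
  have is_ : nu.-integrable [set: X] (EFin \o s).
    by apply: integrable_Rsum => j; exact: integrable_Rscale.
  have gs x : `|g x - s x| <= m.+1%:R^-1 by exact: Ag.
  have mgs : measurable_fun [set: X] (fun x => g x - s x) by exact: measurable_funB.
  have igs : nu.-integrable [set: X] (EFin \o (fun x => g x - s x)).
    exact: bounded_prob_integrable gs.
  have iYgs := iYh _ _ mgs gs.
  have iYg : P.-integrable [set: T] (EFin \o (fun w => Y w * g (V k w))).
    by apply: (iYh _ 1) => // x; have /andP[? ?] := g01 x; rewrite ger0_norm.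
  have iYs : P.-integrable [set: T] (EFin \o (fun w => Y w * s (V k w))).
    have -> : (fun w => Y w * s (V k w)) = (fun w => Y w * g (V k w) - Y w * (g (V k w) - s (V k w))).
      by apply/funext => w; ring.
    by rewrite /comp; under eq_fun do rewrite EFinB; exact: integrableB.
  have -> : \int[P]_w (Y w * g (V k w)) - (\int[P]_w Y w) * \int[nu]_x g x
      = \int[P]_w (Y w * (g (V k w) - s (V k w))) - (\int[P]_w Y w) * \int[nu]_x (g x - s x).
    rewrite RintegralB //; under [in RHS]eq_Rintegral do rewrite mulrBr.
    by rewrite RintegralB // sP; ring.
  have b1 : `|\int[P]_w (Y w * (g (V k w) - s (V k w)))| <= K * m.+1%:R^-1.
    apply: (le_trans (@le_bound_Rintegral _ _ _ P _ set0 (K * m.+1%:R^-1) 0 measurable0 _ _)).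
    - by apply: measurable_funM => //; exact: (measurable_law k mgs).
    - by move=> w; rewrite mul0r addr0 normrM ler_pM.
    - by rewrite mul0r addr0.
  have b2 : `|\int[nu]_x (g x - s x)| <= m.+1%:R^-1.
    apply: (le_trans (@le_bound_Rintegral _ _ _ nu _ set0 (m.+1%:R^-1) 0 measurable0 mgs _)).
    - by move=> w; rewrite mul0r addr0.
    - by rewrite mul0r addr0.
  have b3 : `|\int[P]_w Y w| <= K.
    apply: (le_trans (@le_bound_Rintegral _ _ _ P _ set0 K 0 measurable0 mY _)).
    - by move=> w; rewrite mul0r addr0.
    - by rewrite mul0r addr0.
  apply: (le_trans (ler_normB _ _)); rewrite normrM.
  apply: (@le_trans _ _ (K * m.+1%:R^-1 + K * m.+1%:R^-1)); first by rewrite lerD // ler_pM.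
  have : 2 * K / e < m%:R by apply: archi_boundP; rewrite divr_ge0 ?mulr_ge0 // ltW.
  rewrite ltr_pdivrMr // => me.
  rewrite -mulrDl ler_pdivrMr ?ltr0n // -natr1 mulrDr; lra.
move=> mh hC.
have C0 : 0 < `|C| + 1 by rewrite ltr_pwDr.
pose g x := (h x + (`|C| + 1)) / (2 * (`|C| + 1)).
have mg : measurable_fun [set: X] g.
  by apply: measurable_funM => //; exact: measurable_funD.
have g01 x : 0 <= g x <= 1.
  have := le_trans (hC x) (ler_norm C); rewrite ler_norml => /andP[h1 h2].
  by rewrite /g divr_ge0 ?ler_pdivrMr ?mulr_gt0 //=; lra.
have hE x : h x = (2 * (`|C| + 1)) * g x - (`|C| + 1).
  by rewrite /g; field; rewrite gt_eqF.
have ig : nu.-integrable [set: X] (EFin \o g).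
  apply: (@bounded_prob_integrable _ _ _ _ _ 1) => // x.
  by have /andP[? ?] := g01 x; rewrite ger0_norm.
have iYg : P.-integrable [set: T] (EFin \o (fun w => Y w * g (V k w))).
  by apply: (iYh _ 1) => // x; have /andP[? ?] := g01 x; rewrite ger0_norm.
have icst : nu.-integrable [set: X] (EFin \o (fun _ => `|C| + 1)).
  by apply: (@bounded_prob_integrable _ _ _ _ _ (`|C| + 1)) => // x; rewrite gtr0_norm.
have -> : \int[nu]_x h x = 2 * (`|C| + 1) * \int[nu]_x g x - (`|C| + 1).
  under eq_Rintegral do rewrite hE.
  rewrite RintegralB //; last exact: integrable_Rscale.
  rewrite RintegralZl // Rintegral_cst // [X in fine X](_ : _ = 1%E) ?mulr1 //.
  exact: probability_setT.
transitivity (\int[P]_w (2 * (`|C| + 1) * (Y w * g (V k w)) - (`|C| + 1) * Y w)).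
  by apply: eq_Rintegral => w _; rewrite hE; ring.
rewrite RintegralB //; try exact: integrable_Rscale.
by rewrite !RintegralZl // unit //; ring.
Qed.

(* [Y] is bounded and independent of the [V i] with [k <= i], as far as
   expectations of products can tell. *)
Definition prefix_independent (k : nat) (Y : T -> R) : Prop :=
  [/\ measurable_fun [set: T] Y, exists K, forall w, `|Y w| <= K
    & forall A : 'I_n -> set X, (forall i, measurable (A i)) ->
      \int[P]_w (Y w * \prod_(i < n | (k <= i)%N) \1_(A i) (V i w))
      = (\int[P]_w Y w) * \prod_(i < n | (k <= i)%N) fine (nu (A i))].

Lemma prod_indic_bounds (J : pred 'I_n) (A : 'I_n -> set X) (w : T) :
  `|\prod_(i < n | J i) \1_(A i) (V i w) : R| <= 1.
Proof.
rewrite normr_prod; apply: prodr_ile1 => i _.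
by rewrite indicE; case: (_ \in _); rewrite ?normr1 ?normr0 ?lexx ?ler01.
Qed.

Lemma measurable_prod_indic (J : pred 'I_n) (A : 'I_n -> set X) :
  (forall i, measurable (A i)) ->
  measurable_fun [set: T] (fun w => \prod_(i < n | J i) \1_(A i) (V i w) : R).
Proof.
move=> mA; rewrite (_ : (fun w => _) = (fun w => \prod_(i < n) if J i then \1_(A i) (V i w) else 1)).
  apply: measurable_prod => i _; case: (J i); last exact: measurable_cst.
  by apply: measurable_law; exact: measurable_indic.
by apply/funext => w; rewrite big_mkcond.
Qed.

Lemma prefix_independent0 : prefix_independent 0 (fun=> 1).
Proof.
split=> [||A mA].
- exact: measurable_cst.
- by exists 1 => w; rewrite normr1.
pose B := \bigcap_(i in [set i | i \in [set: 'I_n]%SET]) (V i @^-1` A i).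
transitivity (\int[P]_w (\1_B w)).
  apply: eq_Rintegral => w _; rewrite mul1r [RHS]indicE.
  have [wB|wB] := boolP (w \in B).
    rewrite big1 // => i _; rewrite indicE mem_set //.
    by move: wB; rewrite inE => /(_ i); apply; rewrite /= inE.
  have /existsNP[i /not_implyP[_ wi]] : ~ B w by move=> Bw; move/negP: wB; apply; rewrite inE.
  by rewrite (bigD1 i) //= indicE memNset ?mul0r.
rewrite Rintegral_cst // mul1r.
have mVA i : measurable (V i @^-1` A i).
  by rewrite -[X in measurable X]setTI; apply: measurable_funPT.
rewrite /Rintegral integral_indic //; last first.
  by apply: fin_bigcap_measurable.
have PB : P B = (\prod_(i in [set: 'I_n]%SET) P (V i @^-1` A i))%E by exact: indep.
transitivity (fine (P B)); first by rewrite setIT.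
rewrite PB.
have -> : (\prod_(i in [set: 'I_n]%SET) P (V i @^-1` A i))%E
    = (\prod_(i < n | (0 <= i)%N) fine (nu (A i)))%:E.
  rewrite (big_morph EFin EFinM erefl); apply: eq_big => [i|i _]; first by rewrite inE.
  by rewrite law // fineK ?fin_num_measure.
by rewrite [X in _ = fine X * _](probability_setT P) mul1r.
Qed.

(** The indicators of the later observations are multiplied into [Y]; the product still factorizes
    against the indicators of [V k], so that [independent_bounded] applies to it. *)
Lemma prefix_independent_step (k : 'I_n) (Y : T -> R) (h : X -> R) (C : R) :
  prefix_independent k Y -> measurable_fun [set: X] h ->
  (forall x, `|h x| <= C) ->
  prefix_independent k.+1 (fun w => Y w * h (V k w)) /\
  \int[P]_w (Y w * h (V k w)) = (\int[P]_w Y w) * \int[nu]_x h x.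
Proof.
move=> [mY [K YK] YA] mh hC.
have mYh : measurable_fun [set: T] (fun w => Y w * h (V k w)).
  by apply: measurable_funM => //; exact: (measurable_law k mh).
have main (A : 'I_n -> set X) : (forall i, measurable (A i)) ->
   \int[P]_w (Y w * h (V k w) * \prod_(i < n | (k < i)%N) \1_(A i) (V i w))
   = (\int[P]_w Y w) * \int[nu]_x h x * \prod_(i < n | (k < i)%N) fine (nu (A i)).
  move=> mA.
  pose Y' w := Y w * \prod_(i < n | (k < i)%N) \1_(A i) (V i w).
  have YB B : measurable B -> \int[P]_w (Y' w * \1_B (V k w))
      = (\int[P]_w Y w) * \prod_(i < n | (k < i)%N) fine (nu (A i)) * fine (nu B).
    move=> mB; pose A' i := if i == k then B else A i.
    have mA' i : measurable (A' i) by rewrite /A'; case: ifP.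
    have pE (F : 'I_n -> set X -> R) : \prod_(i < n | (k <= i)%N) F i (A' i)
        = F k B * \prod_(i < n | (k < i)%N) F i (A i).
      rewrite (bigD1 k) //= {1}/A' eqxx; congr (_ * _).
      apply: eq_big => [i|i /andP[_ /negbTE ik]]; last by rewrite /A' ik.
      by rewrite ltn_neqAle eq_sym andbC.
    transitivity (\int[P]_w (Y w * \prod_(i < n | (k <= i)%N) \1_(A' i) (V i w))).
      apply: eq_Rintegral => w _.
      by rewrite (pE (fun i A => \1_A (V i w))) /Y'; ring.
    by rewrite YA // (pE (fun i A => fine (nu A))); ring.
  have YT : \int[P]_w Y' w = (\int[P]_w Y w) * \prod_(i < n | (k < i)%N) fine (nu (A i)).
    have := YB setT measurableT; rewrite [X in _ = _ * fine X](probability_setT nu) mulr1 => <-.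
    by apply: eq_Rintegral => w _; rewrite indicT mulr1.
  transitivity (\int[P]_w (Y' w * h (V k w))).
    by apply: eq_Rintegral => w _; rewrite /Y'; ring.
  rewrite (@independent_bounded Y' (K * 1) C k h) //.
  - by rewrite YT; ring.
  - by apply: measurable_funM => //; exact: measurable_prod_indic.
  - by move=> w; rewrite normrM ler_pM // prod_indic_bounds.
  - by move=> B mB; rewrite YB // YT.
have mainT : \int[P]_w (Y w * h (V k w)) = (\int[P]_w Y w) * \int[nu]_x h x.
  have := main (fun=> setT) (fun=> measurableT).
  rewrite [X in _ = _ * X]big1 ?mulr1 => [<-|i _]; last by rewrite [X in fine X](probability_setT nu).
  by apply: eq_Rintegral => w _; rewrite big1 ?mulr1 // => i _; rewrite indicT.
split=> //; split=> [//||A mA]; last by rewrite main // mainT.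
by exists (K * C) => w; rewrite normrM ler_pM.
Qed.

(** The addition formulas express the sine and cosine of a longer sum as linear combinations of
    products; this is the closure property that they require. *)
Lemma prefix_independentB k a b (Y Z : T -> R) :
  prefix_independent k Y -> prefix_independent k Z ->
  prefix_independent k (fun w => a * Y w + b * Z w) /\
  \int[P]_w (a * Y w + b * Z w) = a * (\int[P]_w Y w) + b * \int[P]_w Z w.
Proof.
move=> [mY [K YK] YA] [mZ [L ZL] ZA].
have iY : P.-integrable [set: T] (EFin \o Y) by exact: bounded_prob_integrable YK.
have iZ : P.-integrable [set: T] (EFin \o Z) by exact: bounded_prob_integrable ZL.
have E : \int[P]_w (a * Y w + b * Z w) = a * (\int[P]_w Y w) + b * \int[P]_w Z w.
  by rewrite RintegralD ?RintegralZl //; exact: integrable_Rscale.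
split=> //; split=> [||A mA].
- by apply: measurable_funD; apply: measurable_funM.
- exists (`|a| * K + `|b| * L) => w; rewrite (le_trans (ler_normD _ _)) //.
  by rewrite !normrM lerD // ler_wpM2l.
have iYA (U : T -> R) M : measurable_fun [set: T] U -> (forall w, `|U w| <= M) ->
   P.-integrable [set: T] (EFin \o (fun w => U w * \prod_(i < n | (k <= i)%N) \1_(A i) (V i w))).
  move=> mU UM; apply: (@bounded_prob_integrable _ _ _ _ _ (M * 1)) => [|w].
    by apply: measurable_funM => //; exact: measurable_prod_indic.
  by rewrite normrM ler_pM // prod_indic_bounds.
rewrite E mulrDl -!mulrA -YA // -ZA //.
transitivity (\int[P]_w (a * (Y w * \prod_(i < n | (k <= i)%N) \1_(A i) (V i w)) +
    b * (Z w * \prod_(i < n | (k <= i)%N) \1_(A i) (V i w)))).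
  by apply: eq_Rintegral => w _; ring.
have iYA' := iYA _ _ mY YK; have iZA' := iYA _ _ mZ ZL.
by rewrite RintegralD ?RintegralZl //; exact: integrable_Rscale.
Qed.

(* Each summand multiplies the mean of [exp(i S)] by [a + ib], where [a] and [b]
   are the integrals on the right; replacing this factor by [rho] changes the
   result by at most [|a - rho| + |b|]. *)
Lemma iid_sum_sin (xi : X -> R) (rho beta : R) :
  measurable_fun [set: X] xi -> 0 <= rho <= 1 ->
  `|\int[P]_w sin (\sum_i xi (V i w) + beta) - sin beta * rho ^+ n|
  <= 2 * n%:R * (`|\int[nu]_x cos (xi x) - rho| + `|\int[nu]_x sin (xi x)|).
Proof.
move=> mxi /andP[rho0 rho1].
set a := \int[nu]_x _; set b := \int[nu]_x _; set eta := _ + `|b|.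
pose S k w := \sum_(i < n | (i < k)%N) xi (V i w).
have mcos : measurable_fun [set: X] (fun x => cos (xi x)).
  by apply: measurableT_comp mxi; apply: continuous_measurable_fun; exact: continuous_cos.
have msin : measurable_fun [set: X] (fun x => sin (xi x)).
  by apply: measurableT_comp mxi; apply: continuous_measurable_fun; exact: continuous_sin.
have cos1 (x : R) : `|cos x| <= 1 by rewrite ler_norml cos_le1 cos_geN1.
have sin1 (x : R) : `|sin x| <= 1 by rewrite ler_norml sin_le1 sin_geN1.
have le1 (Y : T -> R) : measurable_fun [set: T] Y -> (forall w, `|Y w| <= 1) -> `|\int[P]_w Y w| <= 1.
  move=> mY Y1.
  apply: (le_trans (@le_bound_Rintegral _ _ _ P _ set0 1 0 measurable0 mY _)).
  - by move=> w; rewrite mul0r addr0.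
  - by rewrite mul0r addr0.
have eta0 : 0 <= eta by rewrite addr_ge0.
have ind k : (k <= n)%N -> [/\ prefix_independent k (fun w => cos (S k w)),
    prefix_independent k (fun w => sin (S k w)),
    `|\int[P]_w cos (S k w) - rho ^+ k| <= k%:R * eta
    & `|\int[P]_w sin (S k w)| <= k%:R * eta].
  elim: k => [_|k IH kn].
    have S0 w : S 0%N w = 0 by rewrite /S big_pred0.
    have c0 : (fun w => cos (S 0%N w)) = (fun=> 1) by apply/funext => w; rewrite S0 cos0.
    have s0 : (fun w => sin (S 0%N w)) = (fun w => 0 * 1 + 0 * 1).
      by apply/funext => w; rewrite S0 sin0; ring.
    have [z0 _] := prefix_independentB 0 0 prefix_independent0 prefix_independent0.
    rewrite c0 s0; split => //; first exact: prefix_independent0.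
      by rewrite Rintegral_cst // [X in fine X](probability_setT P) expr0 mulr1 subrr normr0 mul0r.
    by rewrite mulr1 addr0 Rintegral_cst // !mul0r normr0.
  have [gc gs hc hs] := IH (ltnW kn).
  pose ik := Ordinal kn.
  have SS w : S k.+1 w = S k w + xi (V ik w).
    rewrite /S (bigD1 ik) ?ltnSn //= addrC; congr (_ + _); apply: eq_bigl => i.
    by rewrite ltnS -(inj_eq val_inj) /= andbC -ltn_neqAle.
  have [gcc Ecc] := prefix_independent_step (k := ik) gc mcos (fun x => cos1 _).
  have [gcs Ecs] := prefix_independent_step (k := ik) gc msin (fun x => sin1 _).
  have [gsc Esc] := prefix_independent_step (k := ik) gs mcos (fun x => cos1 _).
  have [gss Ess] := prefix_independent_step (k := ik) gs msin (fun x => sin1 _).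
  have [gC EC] := prefix_independentB 1 (-1) gcc gss.
  have [gS ES] := prefix_independentB 1 1 gsc gcs.
  have cE : (fun w => cos (S k.+1 w)) = (fun w => 1 * (cos (S k w) * cos (xi (V ik w))) + -1 * (sin (S k w) * sin (xi (V ik w)))).
    by apply/funext => w; rewrite SS cosD; ring.
  have sE : (fun w => sin (S k.+1 w)) = (fun w => 1 * (sin (S k w) * cos (xi (V ik w))) + 1 * (cos (S k w) * sin (xi (V ik w)))).
    by apply/funext => w; rewrite SS sinD; ring.
  have c1 : `|\int[P]_w cos (S k w)| <= 1 by case: gc => mc _ _; exact: le1.
  have s1 : `|\int[P]_w sin (S k w)| <= 1 by case: gs => mc _ _; exact: le1.
  rewrite cE sE; split=> //.
    rewrite EC Ecc Ess -/a -/b.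
    set c := \int[P]_w cos _ in hc c1 *; set s := \int[P]_w sin _ in hs s1 *.
    (* The new error splits into the replacement of [a] by [rho], the previous error damped by
       [rho], and the sine term. *)
    rewrite [X in `|X|](_ : _ = c * (a - rho) + (c - rho ^+ k) * rho - s * b); last by rewrite exprS; ring.
    apply: (le_trans (ler_normB _ _)); rewrite (le_trans (lerD (ler_normD _ _) (lexx _))) //.
    rewrite !normrM (ger0_norm rho0) -natr1 mulrDl mul1r /eta.
    have h1 : `|c| * `|a - rho| <= `|a - rho| by rewrite ler_piMl.
    have h2 : `|s| * `|b| <= `|b| by rewrite ler_piMl.
    have h3 : `|c - rho ^+ k| * rho <= k%:R * eta by rewrite (le_trans _ hc) // ler_piMr.
    by rewrite /eta in h3; lra.
  rewrite ES Esc Ecs -/a -/b.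
  set c := \int[P]_w cos _ in hc c1 *; set s := \int[P]_w sin _ in hs s1 *.
  rewrite [X in `|X|](_ : _ = s * (a - rho) + s * rho + c * b); last by ring.
  rewrite (le_trans (ler_normD _ _)) // (le_trans (lerD (ler_normD _ _) (lexx _))) //.
  rewrite !normrM (ger0_norm rho0) -natr1 mulrDl mul1r.
  have h1 : `|s| * `|a - rho| <= `|a - rho| by rewrite ler_piMl.
  have h2 : `|c| * `|b| <= `|b| by rewrite ler_piMl.
  have h3 : `|s| * rho <= k%:R * eta by rewrite (le_trans _ hs) // ler_piMr.
  by rewrite /eta in h3 *; lra.
have [gc gs hc hs] := ind n (leqnn n).
have SE w : \sum_i xi (V i w) = S n w by rewrite /S; apply: eq_bigl => i; rewrite ltn_ord.
have [_ E] := prefix_independentB (cos beta) (sin beta) gs gc.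
have -> : \int[P]_w sin (\sum_i xi (V i w) + beta)
    = \int[P]_w (cos beta * sin (S n w) + sin beta * cos (S n w)).
  by apply: eq_Rintegral => w _; rewrite SE sinD; ring.
rewrite E.
set c := \int[P]_w cos _ in hc *; set s := \int[P]_w sin _ in hs *.
rewrite [X in `|X|](_ : _ = cos beta * s + sin beta * (c - rho ^+ n)); last by ring.
rewrite (le_trans (ler_normD _ _)) // !normrM.
have h1 : `|cos beta| * `|s| <= n%:R * eta by rewrite (le_trans _ hs) // ler_piMl.
have h2 : `|sin beta| * `|c - rho ^+ n| <= n%:R * eta by rewrite (le_trans _ hc) // ler_piMl.
by rewrite -mulrA; lra.
Qed.

(** The joint law of [(V i, V j)] agrees with [nu \x nu] on rectangles, hence everywhere; by Fubini
    the inner integral vanishes. *)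
Lemma pair_orthogonal i j (h : X -> R) : i != j -> measurable_fun [set: X] h ->
  nu.-integrable [set: X] (EFin \o (fun x => h x ^+ 2)) ->
  \int[nu]_x h x = 0 ->
  P.-integrable [set: T] (EFin \o (fun w => h (V i w) * h (V j w))) /\
  \int[P]_w (h (V i w) * h (V j w)) = 0.
Proof.
move=> ij mh ih2 h0.
have ih : nu.-integrable [set: X] (EFin \o h).
  have i1 : nu.-integrable [set: X] (EFin \o (fun x => 1 + h x ^+ 2)).
    rewrite /comp; under eq_fun do rewrite EFinD; apply: integrableD => //.
    by apply: (@bounded_prob_integrable _ _ _ _ _ 1) => // x; rewrite normr1.
  apply: le_integrable i1 => //; first exact/measurable_EFinP.
  move=> x _; rewrite /= lee_fin [leRHS]ger0_norm ?addr_ge0 ?sqr_ge0 //.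
  have := sqr_ge0 (`|h x| - 1); rewrite sqrrB1 real_normK ?num_real //.
  have := sqr_ge0 (h x); lra.
pose phi w := (V i w, V j w).
have mphi : measurable_fun [set: T] phi.
  by apply: measurable_fun_pair; exact: measurable_funPT.
pose phi' : {RV P >-> (X * X)%type} := HB.pack phi (isMeasurableFun.Build _ _ _ _ phi mphi).
have lawE A : measurable A -> (nu \x nu)%E A = distribution P phi' A.
  apply: product_measure_unique => B C mB mC.
  have := @indep [set i; j]%SET (fun k => if k == i then B else C).
  have -> : \bigcap_(k in [set k | k \in [set i; j]%SET]) (V k @^-1` (if k == i then B else C))
     = phi @^-1` (B `*` C).
    apply/seteqP; split=> w /=.
      move=> H; split=> /=; first by have := H i; rewrite /= !inE eqxx; exact.
      by have := H j; rewrite /= !inE eqxx orbT eq_sym (negbTE ij); exact.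
    by move=> [Bw Cw] k; rewrite /= !inE => /orP[]/eqP -> //=;
      rewrite ?eqxx // eq_sym (negbTE ij).
  move=> H; transitivity (P (phi @^-1` (B `*` C))); first by [].
  rewrite H; last by move=> k; case: ifP.
  rewrite (bigD1 i) ?inE ?eqxx //= (big_pred1 j) => [|k]; last first.
    rewrite !inE; case: (eqVneq k i) => [->|_] /=; first by rewrite (negbTE ij).
    by rewrite andbT.
  by rewrite eq_sym (negbTE ij) !law.
pose F (z : X * X) : R := h z.1 * h z.2.
have mF : measurable_fun [set: X * X] F.
  by apply: measurable_funM; apply: measurableT_comp => //.
have iF : P.-integrable [set: T] (EFin \o (fun w => h (V i w) * h (V j w))).
  have i2 : P.-integrable [set: T] (EFin \o (fun w => h (V i w) ^+ 2 + h (V j w) ^+ 2)).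
    rewrite /comp; under eq_fun do rewrite EFinD.
    by apply: integrableD => //; [exact: (integrable_law i ih2)|exact: (integrable_law j ih2)].
  apply: le_integrable i2 => //.
    by apply/measurable_EFinP/measurable_funM; exact: measurable_law.
  move=> w _; rewrite /= lee_fin [leRHS]ger0_norm ?addr_ge0 ?sqr_ge0 // normrM.
  have := sqr_ge0 (`|h (V i w)| - `|h (V j w)|).
  rewrite sqrrB !real_normK ?num_real //.
  have := sqr_ge0 (h (V i w)); have := sqr_ge0 (h (V j w)); lra.
split=> //; rewrite /Rintegral.
have mEF : measurable_fun [set: X * X] (EFin \o F).
  exact/measurable_EFinP.
rewrite -[X in fine X](@integral_distribution _ _ _ _ _ P phi' _ mEF iF).
have E : (\int[distribution P phi']_y (EFin \o F) y
   = \int[(nu \x nu)%E]_y (EFin \o F) y)%E.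
  by apply: eq_measure_integral => A mA _; first [exact: lawE|exact: (esym (lawE _ mA))].
have iFnu : (nu \x nu)%E.-integrable setT (EFin \o F).
  apply/integrableP; split => //.
  rewrite (_ : (\int[_]_x _)%E = (\int[distribution P phi']_y `|(EFin \o F) y|)%E); last first.
    by apply: eq_measure_integral => A mA _; first [exact: lawE|exact: (esym (lawE _ mA))].
  rewrite ge0_integral_distribution //; last exact: measurableT_comp.
  by have /integrableP[] := iF.
rewrite E -(integral12_prod_meas1 iFnu) /fubini_F /=.
rewrite integral0_eq // => x _.
under eq_integral do rewrite EFinM.
transitivity ((h x)%:E * \int[nu]_y (EFin \o h) y)%E.
  by rewrite -integralZl.
by rewrite [X in (_ * X)%E]EFin_Rintegral // h0 mule0.
Qed.

Lemma iid_sum_sqr (h : X -> R) : measurable_fun [set: X] h ->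
  nu.-integrable [set: X] (EFin \o (fun x => h x ^+ 2)) ->
  \int[nu]_x h x = 0 ->
  P.-integrable [set: T] (EFin \o (fun w => (\sum_i h (V i w)) ^+ 2)) /\
  \int[P]_w ((\sum_i h (V i w)) ^+ 2) = n%:R * \int[nu]_x (h x ^+ 2).
Proof.
move=> mh ih2 h0.
have E : (fun w => (\sum_i h (V i w)) ^+ 2)
    = (fun w => \sum_i \sum_j h (V i w) * h (V j w)).
  apply/funext => w; rewrite expr2 mulr_suml; apply: eq_bigr => i _; by rewrite mulr_sumr.
have iij i j : P.-integrable [set: T] (EFin \o (fun w => h (V i w) * h (V j w))).
  have [->|ij] := eqVneq i j; last by have [] := pair_orthogonal ij mh ih2 h0.
  exact: (integrable_law j ih2).
rewrite E.
have ii i : P.-integrable [set: T] (EFin \o (fun w => \sum_j h (V i w) * h (V j w))).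
  exact: integrable_Rsum.
split; first exact: integrable_Rsum.
rewrite Rintegral_sum //.
transitivity (\sum_(i < n) \int[nu]_x (h x ^+ 2)); last first.
  by rewrite sumr_const card_ord mulr_natl.
apply: eq_bigr => i _; rewrite Rintegral_sum // (bigD1 i) //= big1 ?addr0 => [|j ji].
  by rewrite -(Rintegral_law i ih2).
by have [] := pair_orthogonal (i := i) (j := j) _ mh ih2 h0; rewrite // eq_sym.
Qed.

(** Serves the bounds on third derivatives, whose means are not zero: the cross terms remain, and
    Cauchy-Schwarz gives the order [n ^+ 2] instead of [n]. *)
Lemma sum_sqr_le (h : X -> R) : measurable_fun [set: X] h ->
  nu.-integrable [set: X] (EFin \o (fun x => h x ^+ 2)) ->
  P.-integrable [set: T] (EFin \o (fun w => (\sum_i h (V i w)) ^+ 2)) /\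
  \int[P]_w ((\sum_i h (V i w)) ^+ 2) <= n%:R ^+ 2 * \int[nu]_x (h x ^+ 2).
Proof.
move=> mh ih2.
have CS w : (\sum_i h (V i w)) ^+ 2 <= n%:R * \sum_i h (V i w) ^+ 2.
  have := cauchy_schwarz_sum (fun=> 1) (fun i => h (V i w)).
  under eq_bigr do rewrite mul1r; under [X in _ <= X * _]eq_bigr do rewrite expr1n.
  by rewrite sumr_const card_ord.
have i2 : P.-integrable [set: T] (EFin \o (fun w => \sum_i h (V i w) ^+ 2)).
  by apply: integrable_Rsum => i; exact: (integrable_law i ih2).
have i3 : P.-integrable [set: T] (EFin \o (fun w => (\sum_i h (V i w)) ^+ 2)).
  apply: le_integrable (integrable_Rscale n%:R i2) => //.
    apply/measurable_EFinP; apply: measurable_funX.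
    by apply: measurable_sum => i; exact: measurable_law.
  move=> w _; rewrite /= lee_fin ger0_norm ?sqr_ge0 // (le_trans (CS w)) //.
  exact: ler_norm.
split=> //; apply: (@le_trans _ _ (\int[P]_w (n%:R * \sum_i h (V i w) ^+ 2))).
  by apply: le_Rintegral => //; exact: integrable_Rscale.
rewrite RintegralZl // Rintegral_sum; last by move=> i; exact: (integrable_law i ih2).
rewrite (eq_bigr (fun=> \int[nu]_x (h x ^+ 2))).
  by rewrite sumr_const card_ord -[X in _ * X <= _]mulr_natl mulrA expr2.
by move=> i _; exact: (Rintegral_law i ih2).
Qed.

End Iid.

Lemma markov_le (R : realType) d (T : measurableType d) (P : probability T R)
    (Z : T -> R) (c e : R) : P.-integrable [set: T] (EFin \o Z) ->
  (forall w, 0 <= Z w) -> 0 < c -> \int[P]_w Z w <= e * c ->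
  (P [set w | (c < Z w)%R] <= e%:E)%E.
Proof.
move=> iZ Z0 c0 Ze.
have mZ : measurable_fun [set: T] Z by apply/measurable_EFinP; exact: measurable_int iZ.
have AE : [set w | c < Z w] = [set w | c < `|Z w|].
  by apply/seteqP; split=> w /=; rewrite ger0_norm.
have mA : measurable [set w | c < Z w] by rewrite AE; exact: measurable_abs_gt.
set A := [set w | _] in mA AE *.
rewrite -[leLHS]fineK ?fin_num_measure // lee_fin -(ler_pM2r c0).
apply: le_trans Ze.
have -> : fine (P A) * c = \int[P]_w (c * \1_A w).
  rewrite RintegralZl //; last exact: integrable_indic.
  by rewrite /Rintegral integral_indic // setIT mulrC.
apply: le_Rintegral => //.
  by apply: integrable_Rscale; exact: integrable_indic.
move=> w _; rewrite indicE; case: (boolP (w \in A)); rewrite ?mulr1 ?mulr0 // inE.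
exact: ltW.
Qed.

(** * Coordinatewise calculus *)

Section CoordinateCalculus.
Context (R : realType) (m : nat).
Implicit Types (F : 'cV[R]_m -> R) (x b : 'cV[R]_m) (k : 'I_m).
Local Notation e_ k := (delta_mx k ord0 : 'cV[R]_m).

Lemma is_derive_coordinate F x k (s : R) : pderivable F k (x + s *: e_ k) ->
  is_derive s (1 : R) (fun t : R => F (x + t *: e_ k)) (pd k F (x + s *: e_ k)).
Proof.
move=> dF.
have E : (fun h : R => h^-1 *: (((fun t : R => F (x + t *: e_ k)) \o shift s) (h *: 1) - F (x + s *: e_ k)))
   = (fun h : R => h^-1 *: ((F \o shift (x + s *: e_ k)) (h *: e_ k) - F (x + s *: e_ k))).
  apply/funext => h /=; congr (_ *: (F _ - _)).
  by rewrite scaler1 scalerDl addrCA addrC.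
apply: DeriveDef; first by rewrite /derivable E; exact: dF.
by rewrite /derive E.
Qed.

(** The conditions [|s| <= |t|] and [0 <= s * t] describe the segment between [0] and [t] for both
    signs of [t]. *)
Lemma coordinate_mvt F x k (t : R) :
  (forall s : R, `|s| <= `|t| -> 0 <= s * t -> pderivable F k (x + s *: e_ k)) ->
  exists2 s : R, `|s| <= `|t| &
    F (x + t *: e_ k) - F x = pd k F (x + s *: e_ k) * t.
Proof.
move=> dF; pose phi (s : R) := F (x + s *: e_ k).
have d s : `|s| <= `|t| -> 0 <= s * t -> is_derive s (1 : R) phi (pd k F (x + s *: e_ k)).
  by move=> s1 s2; apply/is_derive_coordinate/dF.
have phi0 : phi 0 = F x by rewrite /phi scale0r addr0.
have cont a c : (forall s, s \in `[a, c] -> derivable phi s 1) -> {within `[a, c], continuous phi}.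
  by move=> H; apply: derivable_within_continuous => s; exact: H.
have [t0|/ltW t0] := leP 0 t.
  have dom s : s \in `[0, t] -> `|s| <= `|t| /\ 0 <= s * t.
    by rewrite in_itv /= => /andP[s0 st]; rewrite !ger0_norm // mulr_ge0.
  have [||s sI] := @MVT_segment R phi (fun s => pd k F (x + s *: e_ k)) 0 t t0.
  - by move=> s /subset_itv_oo_cc /dom[]; exact: d.
  - by apply: cont => s /dom[s1 s2]; have [] := d _ s1 s2.
  by rewrite phi0 subr0 => E; exists s => //; have [] := dom _ sI.
have dom s : s \in `[t, 0] -> `|s| <= `|t| /\ 0 <= s * t.
  by rewrite in_itv /= => /andP[ts s0]; rewrite !ler0_norm // lerN2 mulr_le0.
have [||s sI] := @MVT_segment R phi (fun s => pd k F (x + s *: e_ k)) t 0 t0.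
- by move=> s /subset_itv_oo_cc /dom[]; exact: d.
- by apply: cont => s /dom[s1 s2]; have [] := d _ s1 s2.
rewrite phi0 sub0r mulrN => E; exists s; first by have [] := dom _ sI.
by rewrite -[RHS]opprK -E opprB.
Qed.

(** A box around [b0] rather than the segment to [b]: the paths move one coordinate at a time, and
    the box contains them while staying in the Euclidean ball of radius [enorm (b - b0)]. *)
Definition inbox b0 b x : Prop := forall i, `|x i ord0 - b0 i ord0| <= `|b i ord0 - b0 i ord0|.

Lemma inbox_enorm b0 b x : inbox b0 b x -> enorm (x - b0) <= enorm (b - b0).
Proof.
move=> xb; rewrite /enorm ler_wsqrtr // ler_sum // => i _; rewrite !mxE.
by rewrite -[leLHS]real_normK ?num_real // -[leRHS]real_normK ?num_real // lerXn2r ?nnegrE //; exact: xb.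
Qed.

(** With partial derivatives only, the coordinates of [b0] are replaced by those of [b] one at a
    time, and the increments telescope. *)
Lemma path_mvt F b0 b : (forall x, inbox b0 b x -> forall k, pderivable F k x) ->
  exists2 xi : 'I_m -> 'cV[R]_m, forall k, inbox b0 b (xi k) &
    F b - F b0 = \sum_k pd k F (xi k) * (b k ord0 - b0 k ord0).
Proof.
move=> dF.
pose c (n : nat) : 'cV[R]_m := \col_i (if (i < n)%N then b i ord0 else b0 i ord0).
have cS (k : 'I_m) : c k.+1 = c k + (b k ord0 - b0 k ord0) *: e_ k.
  apply/colP => i; rewrite !mxE ltnS leq_eqVlt andbT.
  have [->|ik] := eqVneq i k; first by rewrite eqxx ltnn mulr1 addrC subrK.
  by rewrite -(inj_eq val_inj) /= in ik; rewrite (negbTE ik) mulr0 addr0.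
have box (k : 'I_m) s : `|s| <= `|b k ord0 - b0 k ord0| -> inbox b0 b (c k + s *: e_ k).
  move=> sk i; rewrite !mxE andbT; have [->|ik] := eqVneq i k.
    by rewrite ltnn mulr1 addrAC subrr add0r.
  by rewrite mulr0 addr0; case: ifP => // _; rewrite subrr normr0.
have /choice[s sP] (k : 'I_m) : exists s : R, `|s| <= `|b k ord0 - b0 k ord0| /\
    F (c k.+1) - F (c k) = pd k F (c k + s *: e_ k) * (b k ord0 - b0 k ord0).
  have [|s s1 s2] := @coordinate_mvt F (c k) k (b k ord0 - b0 k ord0).
    by move=> s s1 _; apply: dF; exact: box.
  by exists s; rewrite cS.
exists (fun k => c k + s k *: e_ k) => [k|]; first by apply: box; have [] := sP k.
have -> : F b - F b0 = F (c m) - F (c 0%N).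
  by congr (F _ - F _); apply/colP => i; rewrite !mxE ?ltn_ord.
rewrite -(telescope_sumr (fun n => F (c n))) // big_mkord.
by apply: eq_bigr => k _; have [] := sP k.
Qed.

(** The path formula used twice: for [pd j F] up to [b], and for [pd k (pd j F)] up to the
    intermediate point, whose box lies inside the first one. *)
Lemma third_order_bound F (M : 'I_m -> 'I_m -> 'I_m -> R) b0 b j :
  (forall x, inbox b0 b x -> third_pderivable F x /\
     forall k l, `|pd l (pd k (pd j F)) x| <= M l k j) ->
  `|pd j F b - pd j F b0 - \sum_k pd k (pd j F) b0 * (b k ord0 - b0 k ord0)|
  <= \sum_k \sum_l M l k j * (`|b l ord0 - b0 l ord0| * `|b k ord0 - b0 k ord0|).
Proof.
move=> H.
have [|xi xiP ->] := @path_mvt (pd j F) b0 b.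
  by move=> x xb k; have [/(_ j k k)[]] := H x xb.
rewrite -sumrB (le_trans (ler_norm_sum _ _ _)) //; apply: ler_sum => k _.
rewrite -mulrBl normrM.
have sub x : inbox b0 (xi k) x -> inbox b0 b x.
  by move=> xx i; apply: le_trans (xx i) (xiP k i).
have [|zeta zP ->] := @path_mvt (pd k (pd j F)) b0 (xi k).
  by move=> x xb l; have [/(_ j k l)[]] := H x (sub _ xb).
under [leRHS]eq_bigr do rewrite mulrA; rewrite -mulr_suml ler_wpM2r //.
rewrite (le_trans (ler_norm_sum _ _ _)) //; apply: ler_sum => l _.
rewrite normrM; have [_ /(_ k l) Mb] := H _ (sub _ (zP l)).
apply: ler_pM => //; exact: (xiP k).
Qed.

Lemma local_max_derive (psi : R -> R) (d : R) : is_derive (0 : R) (1 : R) psi d ->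
  (\forall t \near (0 : R), psi t <= psi 0) -> d = 0.
Proof.
move=> [dpsi <-] /nbhs_ballP[r /= r0 rP].
have cv : (fun h : R => h^-1 *: (psi (h *: 1 + 0) - psi 0)) @ 0^' --> 'D_1 psi 0 by exact: dpsi.
apply/eqP; rewrite eq_le; apply/andP; split; rewrite leNgt; apply/negP => D.
  have [r' /= r'0 r'P] := cvgr_gt _ cv _ D.
  pose h := Num.min r r' / 2.
  have h0 : 0 < h by rewrite divr_gt0 // lt_min r0.
  have hr : h < r by rewrite /h ltr_pdivrMr // (le_lt_trans (_ : _ <= r)) ?ge_min ?lexx // ltr_pMr // ltr1n.
  have hr' : h < r' by rewrite /h ltr_pdivrMr // (le_lt_trans (_ : _ <= r')) ?ge_min ?lexx ?orbT // ltr_pMr // ltr1n.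
  have := r'P h; rewrite /ball /= sub0r normrN gtr0_norm // => /(_ hr' (lt0r_neq0 h0)).
  rewrite scaler1 addr0 pmulr_rgt0 ?invr_gt0 // subr_gt0 ltNge => /negP; apply.
  by apply: rP; rewrite /ball /= sub0r normrN gtr0_norm.
have [r' /= r'0 r'P] := cvgr_lt _ cv _ D.
pose h := Num.min r r' / 2.
have h0 : 0 < h by rewrite divr_gt0 // lt_min r0.
have hr : h < r by rewrite /h ltr_pdivrMr // (le_lt_trans (_ : _ <= r)) ?ge_min ?lexx // ltr_pMr // ltr1n.
have hr' : h < r' by rewrite /h ltr_pdivrMr // (le_lt_trans (_ : _ <= r')) ?ge_min ?lexx ?orbT // ltr_pMr // ltr1n.
have := r'P (- h); rewrite /ball /= sub0r opprK gtr0_norm // oppr_eq0 => /(_ hr' (lt0r_neq0 h0)).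
rewrite scaler1 addr0 invrN scaleNr oppr_lt0 pmulr_rgt0 ?invr_gt0 // subr_gt0 ltNge => /negP; apply.
by apply: rP; rewrite /ball /= sub0r opprK gtr0_norm.
Qed.

(** At a nonzero coordinate the absolute value is locally linear, so the criterion is differentiable
    along that coordinate; openness of [omega] makes the maximum over [Omega] an unconstrained one
    along it. *)
Lemma penalized_score_equation (Omega omega : set 'cV[R]_m) F (pen : R -> R) (c : R) b j :
  open omega -> omega `<=` Omega -> omega b ->
  local_maximizer Omega (fun b => F b - c * \sum_j pen `|b j ord0|) b ->
  pderivable F j b -> b j ord0 != 0 -> derivable pen `|b j ord0| 1 ->
  pd j F b = c * (pen1 pen `|b j ord0| * Num.sg (b j ord0)).
Proof.
move=> oo oO ob [_ bmax] dF bj dpen.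
pose psi (t : R) := F (b + t *: e_ j) - c * (pen `|b j ord0 + t| + \sum_(i | i != j) pen `|b i ord0|).
have dpsi : is_derive (0 : R) (1 : R) psi (pd j F b - c * (pen1 pen `|b j ord0| * Num.sg (b j ord0))).
  have d1 : is_derive (0 : R) (1 : R) (fun t : R => F (b + t *: e_ j)) (pd j F b).
    have := @is_derive_coordinate F b j 0.
    by rewrite scale0r addr0 => /(_ dF).
  have d2 : is_derive (0 : R) (1 : R) (fun t : R => pen `|b j ord0 + t|)
      (pen1 pen `|b j ord0| * Num.sg (b j ord0)).
    have sE : Num.sg (b j ord0) * (b j ord0 + 0) = `|b j ord0| by rewrite addr0 -normrEsg.
    (* The sign of [b j + t] is that of [b j] as long as [|t| < |b j|]. *)
    have E : {near (0 : R), (fun t : R => pen (Num.sg (b j ord0) * (b j ord0 + t)))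
        =1 (fun t : R => pen `|b j ord0 + t|)}.
      apply/nbhs_ballP; exists `|b j ord0|; first by rewrite /= normr_gt0.
      move=> t; rewrite /ball /= sub0r normrN => tb.
      congr pen; move: tb; have [bp|bn|b0] := ltgtP (b j ord0) 0.
      - rewrite ltr0_sg // mulN1r [X in _ < X]ltr0_norm // => tb; rewrite ltr0_norm //.
        by move: tb; rewrite ltr_norml => /andP[_]; lra.
      - rewrite gtr0_sg // mul1r [X in _ < X]gtr0_norm // => tb; rewrite gtr0_norm //.
        by move: tb; rewrite ltr_norml => /andP[]; lra.
      - by move: bj; rewrite b0 eqxx.
    apply: near_eq_is_derive E _.
    have dl : is_derive (0 : R) (1 : R) (fun t : R => Num.sg (b j ord0) * (b j ord0 + t)) (Num.sg (b j ord0)).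
      by apply: trigger_derive; rewrite /GRing.scale /=; ring.
    have dp : is_derive (Num.sg (b j ord0) * (b j ord0 + 0)) (1 : R) pen (pen1 pen `|b j ord0|).
      by rewrite sE; apply: DeriveDef => //; rewrite /pen1 derive1E.
    apply: is_derive1_comp.
  by rewrite /psi; apply: trigger_derive; rewrite /GRing.scale /= addr0.
apply/eqP; rewrite -subr_eq0; apply/eqP; apply: local_max_derive dpsi _.
have pE (t : R) : psi t = F (b + t *: e_ j) - c * \sum_i pen `|(b + t *: e_ j) i ord0|.
  rewrite /psi [X in _ = _ - _ * X](bigD1 j) //= !mxE !eqxx mulr1; congr (_ - _ * (_ + _)).
  by apply: eq_bigr => i /negbTE ij; rewrite !mxE ij mulr0 addr0.
rewrite pE scale0r addr0.
have : nbhs b (omega `&` (fun b' => Omega b' -> F b' - c * \sum_j pen `|b' j ord0|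
    <= F b - c * \sum_j pen `|b j ord0|)).
  by apply: filterI => //; exact: open_nbhs_nbhs.
move=> /nbhs_ballP[r /= r0 rP]; apply/nbhs_ballP; exists r => //= t.
rewrite /ball /= sub0r normrN => tr; rewrite pE.
have [|ob' H] := rP (b + t *: e_ j); last exact/H/oO.
split=> // i k; rewrite !mxE /ball /= opprD addrA subrr sub0r normrN.
rewrite normrM (le_lt_trans _ tr) // ler_piMr //.
by case: (_ && _); rewrite /= ?normr1 ?normr0.
Qed.

End CoordinateCalculus.

(** * The central limit theorem *)

Section TrigonometricInequalities.
Variable R : realType.

Lemma normr_sin_le (x : R) : `|sin x| <= `|x|.
Proof.
have pos (y : R) : 0 <= y -> `|sin y| <= y.
  move=> y0; have d (z : R) : z \in `]0, y[ -> is_derive z (1 : R) sin (cos z).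
    by move=> _; exact: is_derive_sin.
  have [|c _] := MVT_segment y0 d.
    by apply: continuous_subspaceT; exact: continuous_sin.
  rewrite sin0 !subr0 => ->; rewrite normrM (ger0_norm y0) ler_piMl //.
  exact: cos_max.
have [x0|/ltW x0] := leP 0 x; first by rewrite [leRHS]ger0_norm // pos.
by rewrite -normrN -sinN [leRHS]ler0_norm // pos // oppr_ge0.
Qed.

Lemma cos_half (x : R) : cos x = 1 - 2 * sin (x / 2) ^+ 2.
Proof.
have -> : cos x = cos (x / 2 + x / 2) by congr cos; field.
by rewrite cosD -!expr2 cos2sin2; ring.
Qed.

Lemma normr_subr_sin_le (x : R) : `|x - sin x| <= `|x| ^+ 3.
Proof.
have pos (y : R) : 0 <= y -> `|y - sin y| <= y ^+ 3.
  move=> y0; have d (z : R) : z \in `]0, y[ -> is_derive z (1 : R) (fun t => t - sin t) (1 - cos z).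
    by move=> _; apply: trigger_derive; rewrite /GRing.scale /=; ring.
  have [|c cI] := MVT_segment y0 d.
    apply: continuous_subspaceT => z; apply: cvgB; first exact: cvg_id.
    exact: continuous_sin.
  rewrite sin0 !subr0 => ->; rewrite normrM (ger0_norm y0) exprSr ler_wpM2r //.
  rewrite cos_half opprB addrCA subrr addr0 normrM normrX.
  have := normr_sin_le (c / 2); have [c0 cy] : 0 <= c /\ c <= y.
    by move: cI; rewrite in_itv /= => /andP[].
  rewrite [X in _ <= X -> _]ger0_norm ?divr_ge0 // => h.
  have h2 : `|sin (c / 2)| ^+ 2 <= (y / 2) ^+ 2.
    by rewrite lerXn2r ?nnegrE ?divr_ge0 // (le_trans h) // ler_wpM2r.
  by have := sqr_ge0 y; rewrite ger0_norm // expr_div_n in h2 *; lra.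
have [x0|/ltW x0] := leP 0 x; first by rewrite [X in _ <= X ^+ _]ger0_norm // pos.
have := pos (- x); rewrite oppr_ge0 sinN opprK => /(_ x0) h.
by rewrite (ler0_norm x0) -normrN opprB addrC.
Qed.

(** The half-angle formula factors the difference as [2 (x/2 - sin (x/2)) (x/2 + sin (x/2))], which
    reduces it to the estimates for the sine. *)
Lemma normr_cos_taylor (x : R) : `|cos x - (1 - x ^+ 2 / 2)| <= x ^+ 4.
Proof.
have -> : cos x - (1 - x ^+ 2 / 2) = 2 * ((x / 2 - sin (x / 2)) * (x / 2 + sin (x / 2))).
  by rewrite cos_half; field.
have h1 := normr_subr_sin_le (x / 2); have h2 := normr_sin_le (x / 2).
rewrite !normrM ger0_norm //.
have h3 : `|x / 2 + sin (x / 2)| <= 2 * `|x / 2|.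
  by rewrite (le_trans (ler_normD _ _)) // mulrDl mul1r lerD2l.
apply: (@le_trans _ _ (2 * (`|x / 2| ^+ 3 * (2 * `|x / 2|)))).
  by rewrite ler_wpM2l // ler_pM.
have -> : 2 * (`|x / 2| ^+ 3 * (2 * `|x / 2|)) = 4 * (`|x / 2| ^+ 2) ^+ 2 by ring.
rewrite real_normK ?num_real //; have : 0 <= x ^+ 4 by rewrite exprn_even_ge0.
by rewrite -[X in _ -> X <= _](_ : x ^+ 4 / 4 = _); [lra|field].
Qed.

(** [1 - y <= exp (- y) <= 1 / (1 + y) <= 1 - y + y^2]. *)
Lemma normr_expR_taylor (y : R) : 0 <= y -> `|1 - y - expR (- y)| <= y ^+ 2.
Proof.
move=> y0; rewrite ler_norml; have h1 := expR_ge1Dx (- y).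
have h2 := expR_ge1Dx y; have h3 := expR_gt0 y.
have E : expR (- y) <= (1 + y)^-1.
  by rewrite expRN lef_pV2 // ?posrE; lra.
have E2 : (1 + y)^-1 <= 1 - y + y ^+ 2.
  rewrite -[leLHS]mul1r ler_pdivrMr; last lra.
  have -> : (1 - y + y ^+ 2) * (1 + y) = 1 + y ^+ 3 by ring.
  by rewrite lerDl exprn_ge0.
by have := sqr_ge0 y => ?; apply/andP; split; lra.
Qed.

End TrigonometricInequalities.

Section RealIntegrable.
Context (R : realType) d (T : measurableType d) (mu : {measure set T -> \bar R}).
Variables (f g : T -> R).
Hypotheses (fi : mu.-integrable [set: T] (EFin \o f))
  (gi : mu.-integrable [set: T] (EFin \o g)).

Lemma integrable_RB : mu.-integrable [set: T] (EFin \o (fun w => f w - g w)).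
Proof. by rewrite /comp; under eq_fun do rewrite EFinB; exact: integrableB. Qed.

Lemma integrable_RD : mu.-integrable [set: T] (EFin \o (fun w => f w + g w)).
Proof. by rewrite /comp; under eq_fun do rewrite EFinD; exact: integrableD. Qed.

End RealIntegrable.

Section IidCharacteristicFunction.
Context (R : realType) (dT dX : measure_display).
Context (T : measurableType dT) (X : measurableType dX).
Context (P : probability T R) (nu : probability X R).
Context (n : nat) (V : 'I_n -> {RV P >-> X}).
Hypothesis indep : mutually_independent V.
Hypothesis law : forall i A, measurable A -> P (V i @^-1` A) = nu A.
Hypothesis n0 : (0 < n)%N.

Lemma integrable_dominated (h Y : X -> R) (c : R) : measurable_fun [set: X] h ->
  nu.-integrable [set: X] (EFin \o Y) ->
  (forall x, `|h x| <= c + Y x) -> nu.-integrable [set: X] (EFin \o h).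
Proof.
move=> mh iY hY.
have ic : nu.-integrable [set: X] (EFin \o (fun x => c + Y x)).
  by apply: integrable_RD => //; exact: (@bounded_prob_integrable _ _ _ _ _ `|c|).
apply: le_integrable ic => //; first exact/measurable_EFinP.
by move=> x _; rewrite /= lee_fin (le_trans (hY x)) // ler_norm.
Qed.

(** Per observation, the mean cosine is within [(m4 + v^2) / n^2] of [exp (- v / (2 n))], and the
    mean sine is at most [n^(-3/2)] times the third absolute moment, itself bounded by
    [th * v + m4 / th]. The parameter [th] is left free to balance a fourth moment that grows with
    the dimension. *)
Lemma iid_cf_bound (Y : X -> R) (th beta v m4 : R) : measurable_fun [set: X] Y ->
  nu.-integrable [set: X] (EFin \o (fun x => Y x ^+ 4)) ->
  \int[nu]_x Y x = 0 -> 0 < th ->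
  \int[nu]_x (Y x ^+ 2) = v -> \int[nu]_x (Y x ^+ 4) = m4 ->
  `|\int[P]_w sin ((Num.sqrt n%:R)^-1 * \sum_i Y (V i w) + beta)
      - sin beta * expR (- (v / 2))|
  <= 2 * ((m4 + v ^+ 2) / n%:R + (th * v + m4 / th) / Num.sqrt n%:R).
Proof.
move=> mY i4 Y0 th0 vE m4E.
pose r : R := (Num.sqrt n%:R)^-1.
have N0 : 0 < n%:R :> R by rewrite ltr0n.
have r0 : 0 < r by rewrite invr_gt0 sqrtr_gt0.
have r2 : r ^+ 2 = n%:R^-1 by rewrite exprVn sqr_sqrtr // ltW.
have sq4 (y : R) : y ^+ 4 = (y ^+ 2) ^+ 2 by ring.
have sq0 (y : R) := sqr_ge0 y.
have i2 : nu.-integrable [set: X] (EFin \o (fun x => Y x ^+ 2)).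
  apply: (integrable_dominated (c := 1) _ i4); first exact: measurable_funX.
  by move=> x; rewrite ger0_norm // sq4; have := sq0 (Y x ^+ 2 - 1); have := sq0 (Y x ^+ 2); rewrite sqrrB1; have := sq0 (Y x); lra.
have i1 : nu.-integrable [set: X] (EFin \o Y).
  apply: (integrable_dominated (c := 1) _ i2) => // x.
  have := sq0 (`|Y x| - 1); rewrite sqrrB1 real_normK ?num_real //; have := sq0 (Y x); lra.
pose xi x := r * Y x.
have mxi : measurable_fun [set: X] xi by exact: measurable_funM.
have mcos : measurable_fun [set: X] (fun x => cos (xi x)).
  by apply: measurableT_comp mxi; apply: continuous_measurable_fun; exact: continuous_cos.
have msin : measurable_fun [set: X] (fun x => sin (xi x)).
  by apply: measurableT_comp mxi; apply: continuous_measurable_fun; exact: continuous_sin.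
have icos : nu.-integrable [set: X] (EFin \o (fun x => cos (xi x))).
  by apply: (@bounded_prob_integrable _ _ _ _ _ 1) => // x; exact: cos_max.
have isin : nu.-integrable [set: X] (EFin \o (fun x => sin (xi x))).
  by apply: (@bounded_prob_integrable _ _ _ _ _ 1) => // x; exact: sin_max.
have int1 (c : R) : \int[nu]__ c = c.
  by rewrite Rintegral_cst // [X in fine X](probability_setT nu) mulr1.
have icst (c : R) : nu.-integrable [set: X] (EFin \o (fun _ => c)).
  exact: (@bounded_prob_integrable _ _ _ _ _ `|c|).
have v0 : 0 <= v by rewrite -vE; apply: Rintegral_ge0 => x _.
have m40 : 0 <= m4 by rewrite -m4E; apply: Rintegral_ge0 => x _; rewrite sq4.
(* The [n]-th root of the limiting factor [expR (- (v / 2))]. *)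
pose rho := expR (- (v / (2 * n%:R))).
have rho01 : 0 <= rho <= 1.
  by rewrite expR_ge0 expR_le1 oppr_le0 divr_ge0 // mulr_ge0 // ltW.
have rhon : rho ^+ n = expR (- (v / 2)).
  rewrite -expRM_natl mulrN; congr (expR (- _)); field.
  by rewrite gt_eqF.
have := iid_sum_sin indep law beta mxi rho01; rewrite rhon.
have -> : (fun w => sin (\sum_i xi (V i w) + beta)) = (fun w => sin (r * \sum_i Y (V i w) + beta)).
  by apply/funext => w; rewrite mulr_sumr.
move=> /le_trans; apply.
have hc : `|\int[nu]_x cos (xi x) - rho| <= m4 / n%:R ^+ 2 + (v / (2 * n%:R)) ^+ 2.
  have t1 : `|\int[nu]_x cos (xi x) - (1 - v / (2 * n%:R))| <= m4 / n%:R ^+ 2.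
    have -> : 1 - v / (2 * n%:R) = \int[nu]_x (1 - (2 * n%:R)^-1 * Y x ^+ 2).
      rewrite RintegralB //; last exact: integrable_Rscale.
      by rewrite int1 RintegralZl // vE mulrC.
    have id : nu.-integrable [set: X] (EFin \o (fun x => 1 - (2 * n%:R)^-1 * Y x ^+ 2)).
      by apply: integrable_RB => //; exact: integrable_Rscale.
    rewrite -RintegralB // (le_trans (le_normr_Rintegral _ _)) //.
      exact: integrable_RB.
    have -> : m4 / n%:R ^+ 2 = \int[nu]_x ((n%:R ^+ 2)^-1 * Y x ^+ 4) by rewrite RintegralZl // m4E mulrC.
    apply: le_Rintegral => //.
    - by apply: integrable_norm; exact: integrable_RB.
    - exact: integrable_Rscale.
    move=> x _; have := normr_cos_taylor (xi x); rewrite /xi !exprMn (_ : r ^+ 4 = (r ^+ 2) ^+ 2); last by ring.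
    rewrite r2 exprVn; apply: le_trans; rewrite le_eqVlt; apply/orP; left; apply/eqP.
    by congr `|_ - (_ - _)|; field; rewrite gt_eqF.
  have y0 : 0 <= v / (2 * n%:R) by rewrite divr_ge0 // mulr_ge0 // ltW.
  have t2 := normr_expR_taylor y0.
  rewrite -(subrKA (1 - v / (2 * n%:R))) (le_trans (ler_normD _ _)) // lerD //.
have hs : `|\int[nu]_x sin (xi x)| <= r * n%:R^-1 * (th * v + m4 / th).
  have -> : \int[nu]_x sin (xi x) = \int[nu]_x (sin (xi x) - r * Y x).
    rewrite RintegralB //; last exact: integrable_Rscale.
    by rewrite RintegralZl // Y0 mulr0 subr0.
  have id : nu.-integrable [set: X] (EFin \o (fun x => sin (xi x) - r * Y x)).
    by apply: integrable_RB => //; exact: integrable_Rscale.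
  rewrite (le_trans (le_normr_Rintegral _ _)) //.
  have -> : r * n%:R^-1 * (th * v + m4 / th)
      = \int[nu]_x (r * n%:R^-1 * th * Y x ^+ 2 + r * n%:R^-1 / th * Y x ^+ 4).
    rewrite RintegralD //; try exact: integrable_Rscale.
    by rewrite !RintegralZl // vE m4E; ring.
  apply: le_Rintegral => //.
  - exact: integrable_norm.
  - by apply: integrable_RD; exact: integrable_Rscale.
  move=> x _; rewrite -normrN opprB.
  apply: (le_trans (normr_subr_sin_le _)); rewrite /xi normrM (gtr0_norm r0) exprMn.
  have -> : r ^+ 3 = r * n%:R^-1 by rewrite -r2; ring.
  have -> : r / n%:R * th * Y x ^+ 2 + r / n%:R / th * Y x ^+ 4
      = r / n%:R * (th * Y x ^+ 2 + Y x ^+ 4 / th) by ring.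
  rewrite ler_wpM2l ?mulr_ge0 ?invr_ge0 ?(ltW r0) ?(ltW N0) //.
  have -> : Y x ^+ 2 = `|Y x| ^+ 2 by rewrite real_normK ?num_real.
  have -> : Y x ^+ 4 = `|Y x| ^+ 4 by rewrite [LHS]sq4 [RHS]sq4 real_normK ?num_real.
  have y0 := normr_ge0 (Y x); move: `|Y x| y0 => y y0.
  rewrite -subr_ge0.
  (* [y^3] is the geometric mean of [th y^2] and [y^4 / th]; the square is completed. *)
  have -> : th * y ^+ 2 + y ^+ 4 / th - y ^+ 3
     = ((th * y - y ^+ 2 / 2) ^+ 2 + 3 / 4 * y ^+ 4) / th.
    by field; rewrite gt_eqF.
  by rewrite divr_ge0 ?(ltW th0) // addr_ge0 // mulr_ge0 // sq4.
rewrite -mulrA ler_wpM2l //.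
apply: (@le_trans _ _ (n%:R * (m4 / n%:R ^+ 2 + (v / (2 * n%:R)) ^+ 2 + r * n%:R^-1 * (th * v + m4 / th)))).
  by rewrite ler_wpM2l ?ler0n // lerD.
have -> : n%:R * (m4 / n%:R ^+ 2 + (v / (2 * n%:R)) ^+ 2 + r / n%:R * (th * v + m4 / th))
   = (m4 + v ^+ 2 / 4) / n%:R + (th * v + m4 / th) * r.
  by field; rewrite !gt_eqF.
by rewrite lerD2r ler_wpM2r ?invr_ge0 ?ler0n // lerD2l ler_pdivrMr // ler_peMr // ler1n.
Qed.

End IidCharacteristicFunction.

(** * Measurable versions of the derivatives of the log-density *)

Section RegularVersions.
Context (R : realType) (dX : measure_display) (X : measurableType dX) (m : nat).
Context (mu : {measure set X -> \bar R}) (f : X -> 'cV[R]_m -> R) (b0 : 'cV[R]_m).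
Context (nu : probability X R).
Hypothesis mf : measurable_fun [set: X] (f ^~ b0).
Hypothesis f0 : forall x, 0 <= f x b0.
Hypothesis nuE : forall A, measurable A ->
  nu A = (\int[mu]_(x in A) (f x b0)%:E)%E.

(* The score and the Hessian are only measurable after multiplication by the
   density; [regular g] is a measurable function which agrees with [g] where
   the density does not vanish (and is [0] elsewhere, as [x / 0 = 0]). *)
Definition regular (g : X -> R) (x : X) : R := g x * f x b0 / f x b0.

Lemma regularE g x : 0 < f x b0 -> regular g x = g x.
Proof. by move=> fx; rewrite /regular mulfK // gt_eqF. Qed.

Lemma regular_mul g x : regular g x * f x b0 = g x * f x b0.
Proof.
rewrite /regular; have [->|fx] := eqVneq (f x b0) 0; first by rewrite !mulr0.
by rewrite divfK.
Qed.

Lemma measurable_regular (g : X -> R) : measurable_fun [set: X] (fun x => g x * f x b0) ->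
  measurable_fun [set: X] (regular g).
Proof.
move=> mg; apply: measurable_funM => //.
rewrite (_ : (fun x => _) = (fun x => f x b0 `^ (- 1))).
  exact: (measurableT_comp (measurable_powR (- 1)) mf).
by apply/funext => x; rewrite powR_inv1.
Qed.

Lemma integral_expect (G g : X -> R) : measurable_fun [set: X] G ->
  (forall x, G x * f x b0 = g x * f x b0) ->
  (\int[nu]_x (G x)%:E = expect mu f b0 g)%E.
Proof.
move=> mG GE; rewrite (@integral_density _ _ _ nu mu (f ^~ b0)) //.
by apply: eq_integral => x _; rewrite GE.
Qed.

Lemma integrable_expect (G g : X -> R) : measurable_fun [set: X] G ->
  (forall x, G x * f x b0 = g x * f x b0) -> integrable_at mu f b0 g ->
  nu.-integrable [set: X] (EFin \o G).
Proof.
move=> mG GE ig; apply/(@integrable_density _ _ _ nu mu (f ^~ b0)) => //.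
by under eq_fun do rewrite GE.
Qed.

Lemma bounded_expect (G g : X -> R) (C : R) : measurable_fun [set: X] G ->
  (forall x, 0 <= G x) -> (forall x, G x * f x b0 = g x * f x b0) ->
  (expect mu f b0 g < C%:E)%E ->
  nu.-integrable [set: X] (EFin \o G) /\ \int[nu]_x G x <= C.
Proof.
move=> mG G0 GE; rewrite -(integral_expect mG GE) => GC.
have iG : nu.-integrable [set: X] (EFin \o G).
  apply/integrableP; split; first exact/measurable_EFinP.
  under eq_integral do rewrite gee0_abs ?lee_fin //=.
  by apply: lt_trans GC _; rewrite ltry.
by split=> //; rewrite -lee_fin -EFin_Rintegral // ltW.
Qed.

(** The law of an observation is absolutely continuous, and it does not charge the zeros of its
    density, where regular versions may differ from the original functions. *)
Lemma null_set_nu (N : set X) : measurable N -> mu N = 0%E ->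
  nu (N `|` [set x | f x b0 = 0]) = 0%E.
Proof.
move=> mN N0.
have mZ : measurable [set x | f x b0 = 0].
  have -> : [set x | f x b0 = 0] = [set: X] `&` (f ^~ b0) @^-1` [set 0].
    by rewrite setTI.
  exact: mf.
apply: null_set_setU => //.
  transitivity (\int[mu]_(x in N) (f x b0)%:E)%E; first exact: nuE.
  apply: null_set_integral => //.
  by apply/measurable_funTS/measurable_EFinP.
transitivity (\int[mu]_(x in [set x | f x b0 = 0%R]) (f x b0)%:E)%E; first exact: nuE.
by rewrite integral0_eq // => x ->.
Qed.

End RegularVersions.

(** * Bounds on the sample derivatives *)

Lemma regular_mulE (R : realType) (d : measure_display) (X : measurableType d)
    (m : nat) (f : X -> 'cV[R]_m -> R) b0 (g h : X -> R) x :
  regular f b0 g x * regular f b0 h x * f x b0 = g x * h x * f x b0.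
Proof.
rewrite /regular; have [fx|fx] := eqVneq (f x b0) 0; first by rewrite fx !mulr0.
by rewrite !mulfK.
Qed.

Lemma regular_sqrE (R : realType) (d : measure_display) (X : measurableType d)
    (m : nat) (f : X -> 'cV[R]_m -> R) b0 (g h : X -> R) x :
  regular f b0 g x ^+ 2 * regular f b0 h x ^+ 2 * f x b0 = (g x * h x) ^+ 2 * f x b0.
Proof.
rewrite /regular; have [fx|fx] := eqVneq (f x b0) 0; first by rewrite fx !mulr0.
by rewrite !mulfK // exprMn.
Qed.

Section SampleBounds.
Context (R : realType) (dT dX : measure_display).
Context (T : measurableType dT) (X : measurableType dX) (m : nat).
Context (P : probability T R) (n : nat) (V : 'I_n -> {RV P >-> X}).
Context (mu : {measure set X -> \bar R}) (f : X -> 'cV[R]_m -> R) (b0 : 'cV[R]_m).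
Context (Good : X -> Prop) (M : 'I_m -> 'I_m -> 'I_m -> X -> R).
Hypothesis n0 : (0 < n)%N.
Hypothesis m0 : (0 < m)%N.
Hypothesis mf : measurable_fun [set: X] (f ^~ b0).
Hypothesis f0 : forall x, 0 <= f x b0.
Hypothesis indep : mutually_independent V.
Hypothesis hlaw : forall i, has_density mu (V i) (f ^~ b0).
Hypothesis hscore : score_identities mu f b0.
Hypothesis mM : forall j k l, measurable_fun [set: X] (M j k l).
Hypothesis hgood : {ae mu, forall x, 0 < f x b0 -> Good x}.
Variables C2 C3 C4 C5 : R.
Hypothesis hC2 : forall j, fisher mu f b0 j j <= C2.
Hypothesis hC3 : forall j k, (expect mu f b0
  (fun x => ((score f b0 j x * score f b0 k x) ^+ 2)%R) < C3%:E)%E.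
Hypothesis hC4 : forall j k, (expect mu f b0
  (fun x => (hess f b0 j k x ^+ 2)%R) < C4%:E)%E.
Hypothesis hC5 : forall j k l, (expect mu f b0
  (fun x => (M j k l x ^+ 2)%R) < C5%:E)%E.

Let i0 : 'I_n := Ordinal n0.
Let nu : probability X R := distribution P (V i0).

Lemma nu_density A : measurable A -> nu A = (\int[mu]_(x in A) (f x b0)%:E)%E.
Proof. by move=> mA; exact: hlaw. Qed.

Lemma sample_law i A : measurable A -> P (V i @^-1` A) = nu A.
Proof. by move=> mA; rewrite nu_density //; exact: hlaw. Qed.

Definition rscore (j : 'I_m) : X -> R := regular f b0 (score f b0 j).
Definition rhess (j k : 'I_m) : X -> R := regular f b0 (hess f b0 j k).

Lemma measurable_rscore j : measurable_fun [set: X] (rscore j).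
Proof.
have [/(_ j)[ij _] _] := hscore; apply: measurable_regular => //.
by apply/measurable_EFinP; exact: measurable_int ij.
Qed.

Lemma measurable_rhess j k : measurable_fun [set: X] (rhess j k).
Proof.
have [_ /(_ j k)[_ ij _]] := hscore; apply: measurable_regular => //.
by apply/measurable_EFinP; exact: measurable_int ij.
Qed.

Lemma rscore_mean j : nu.-integrable [set: X] (EFin \o rscore j) /\
  \int[nu]_x rscore j x = 0.
Proof.
have [/(_ j)[ij E] _] := hscore.
have GE x : rscore j x * f x b0 = score f b0 j x * f x b0 by exact: regular_mul.
split; first exact: (integrable_expect mf f0 nu_density (measurable_rscore j) GE).
by rewrite /Rintegral (integral_expect mf f0 nu_density (measurable_rscore j) GE) E.
Qed.

Lemma rscore_mulE j k x : rscore j x * rscore k x * f x b0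
  = score f b0 j x * score f b0 k x * f x b0.
Proof.
exact: regular_mulE.
Qed.

Lemma rscore_cov j k : nu.-integrable [set: X] (EFin \o (fun x => rscore j x * rscore k x)) /\
  \int[nu]_x (rscore j x * rscore k x) = fisher mu f b0 j k.
Proof.
have [_ /(_ j k)[ij _ _]] := hscore.
have mG : measurable_fun [set: X] (fun x => rscore j x * rscore k x).
  by apply: measurable_funM; exact: measurable_rscore.
split; first exact: (integrable_expect mf f0 nu_density mG (rscore_mulE j k)).
by rewrite /Rintegral (integral_expect mf f0 nu_density mG (rscore_mulE j k)) mxE.
Qed.

Lemma rhess_mean j k : nu.-integrable [set: X] (EFin \o rhess j k) /\
  \int[nu]_x rhess j k x = - fisher mu f b0 j k.
Proof.
have [_ /(_ j k)[_ ih E]] := hscore.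
have GE x : rhess j k x * f x b0 = hess f b0 j k x * f x b0 by exact: regular_mul.
split; first exact: (integrable_expect mf f0 nu_density (measurable_rhess j k) GE).
rewrite /Rintegral (integral_expect mf f0 nu_density (measurable_rhess j k) GE).
by rewrite mxE E fineN opprK.
Qed.

Lemma rscore_sqr j k :
  nu.-integrable [set: X] (EFin \o (fun x => rscore j x ^+ 2 * rscore k x ^+ 2)) /\
  \int[nu]_x (rscore j x ^+ 2 * rscore k x ^+ 2) <= C3.
Proof.
apply: (bounded_expect mf f0 nu_density _ _ _ (hC3 j k)).
- by apply: measurable_funM; apply: measurable_funX; exact: measurable_rscore.
- by move=> x; rewrite mulr_ge0 ?sqr_ge0.
by move=> x; exact: regular_sqrE.
Qed.

Lemma rhess_sqr j k :
  nu.-integrable [set: X] (EFin \o (fun x => rhess j k x ^+ 2)) /\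
  \int[nu]_x (rhess j k x ^+ 2) <= C4.
Proof.
apply: (bounded_expect mf f0 nu_density _ _ _ (hC4 j k)).
- by apply: measurable_funX; exact: measurable_rhess.
- by move=> x; rewrite sqr_ge0.
move=> x; rewrite /rhess; have [fx|] := eqVneq (f x b0) 0; first by rewrite fx !mulr0.
by move=> fx; rewrite regularE // lt_neqAle eq_sym fx f0.
Qed.

Lemma third_sqr j k l :
  nu.-integrable [set: X] (EFin \o (fun x => M j k l x ^+ 2)) /\
  \int[nu]_x (M j k l x ^+ 2) <= C5.
Proof.
apply: (bounded_expect mf f0 nu_density _ _ _ (hC5 j k l)) => //.
- exact: measurable_funX.
- by move=> x; rewrite sqr_ge0.
Qed.

(** Markov's inequality for three sums of squares, each at the cost [e], plus a null event where
    some observation is exceptional. Scores and Hessian deviations are centred, hence the factor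
    [n]; the functions [M] are not, hence [n ^+ 2]. *)
Lemma good_event (e K : R) : 0 < e -> 0 < K -> C2 <= e * K -> C4 <= e * K -> C5 <= e * K ->
  exists B : set T, [/\ measurable B, (P B <= (3 * e)%:E)%E & forall w, ~ B w ->
    [/\ forall i, Good (V i w) /\ 0 < f (V i w) b0,
        \sum_j (\sum_i score f b0 j (V i w)) ^+ 2 <= K * (n%:R * m%:R),
        \sum_j \sum_k (\sum_i hess f b0 k j (V i w) + n%:R * fisher mu f b0 k j) ^+ 2
          <= K * (n%:R * m%:R ^+ 2)
      & \sum_j \sum_k \sum_l (\sum_i M l k j (V i w)) ^+ 2
          <= K * (n%:R ^+ 2 * m%:R ^+ 3)]].
Proof.
move=> e0 K0 K2 K4 K5.
have n0' : 0 < n%:R :> R by rewrite ltr0n.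
have m0' : 0 < m%:R :> R by rewrite ltr0n.
pose Z1 w := \sum_j (\sum_i rscore j (V i w)) ^+ 2.
(* The mean of the Hessian is minus the information, so that [g] is centred. *)
pose g j k x := rhess k j x + fisher mu f b0 k j.
pose Z2 w := \sum_j \sum_k (\sum_i g j k (V i w)) ^+ 2.
pose Z3 w := \sum_j \sum_k \sum_l (\sum_i M l k j (V i w)) ^+ 2.
have sqrE (h : X -> R) : (fun x => h x ^+ 2) = (fun x => h x * h x).
  by apply/funext => x; rewrite expr2.
have b1 j : P.-integrable [set: T] (EFin \o (fun w => (\sum_i rscore j (V i w)) ^+ 2)) /\
    \int[P]_w ((\sum_i rscore j (V i w)) ^+ 2) <= n%:R * C2.
  have [ii E] := rscore_cov j j; have [_ E0] := rscore_mean j.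
  rewrite -sqrE in ii.
  have [i1 ->] := iid_sum_sqr indep sample_law (measurable_rscore j) ii E0.
  by split=> //; rewrite sqrE E ler_wpM2l // ltW.
have b2 j k : P.-integrable [set: T] (EFin \o (fun w => (\sum_i g j k (V i w)) ^+ 2)) /\
    \int[P]_w ((\sum_i g j k (V i w)) ^+ 2) <= n%:R * C4.
  have [ih Eh] := rhess_mean k j; have [ih2 Eh2] := rhess_sqr k j.
  have mg : measurable_fun [set: X] (g j k).
    by apply: measurable_funD => //; exact: measurable_rhess.
  have ic (c : R) : nu.-integrable [set: X] (EFin \o (fun=> c)).
    exact: (@bounded_prob_integrable _ _ _ nu _ `|c|).
  have int1 (c : R) : \int[nu]__ c = c.
    by rewrite Rintegral_cst // [X in fine X](probability_setT nu) mulr1.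
  have g0 : \int[nu]_x g j k x = 0.
    by rewrite /g RintegralD // Eh int1 addNr.
  have gE : (fun x => g j k x ^+ 2) = (fun x => (rhess k j x ^+ 2
      + (2 * fisher mu f b0 k j) * rhess k j x) + fisher mu f b0 k j ^+ 2).
    by apply/funext => x; rewrite /g; ring.
  have i1 : nu.-integrable [set: X] (EFin \o (fun x => rhess k j x ^+ 2
      + (2 * fisher mu f b0 k j) * rhess k j x)).
    by apply: integrable_RD => //; exact: integrable_Rscale.
  have ig2 : nu.-integrable [set: X] (EFin \o (fun x => g j k x ^+ 2)).
    by rewrite gE; apply: integrable_RD.
  have [i2 ->] := iid_sum_sqr indep sample_law mg ig2 g0.
  split=> //; rewrite ler_wpM2l ?ler0n // gE RintegralD // RintegralD //; last first.
    exact: integrable_Rscale.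
  (* The variance is the second moment minus the square of the information entry, hence at most
     [C4]. *)
  rewrite RintegralZl // Eh int1; have := sqr_ge0 (fisher mu f b0 k j).
  lra.
have b3 j k l : P.-integrable [set: T] (EFin \o (fun w => (\sum_i M l k j (V i w)) ^+ 2)) /\
    \int[P]_w ((\sum_i M l k j (V i w)) ^+ 2) <= n%:R ^+ 2 * C5.
  have [i1 E1] := third_sqr l k j.
  have [i2 h2] := sum_sqr_le sample_law (mM l k j) i1.
  by split=> //; rewrite (le_trans h2) // ler_wpM2l ?sqr_ge0.
have iZ1 : P.-integrable [set: T] (EFin \o Z1).
  by apply: integrable_Rsum => j; have [] := b1 j.
have iZ2 : P.-integrable [set: T] (EFin \o Z2).
  by apply: integrable_Rsum => j; apply: integrable_Rsum => k; have [] := b2 j k.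
have iZ3 : P.-integrable [set: T] (EFin \o Z3).
  apply: integrable_Rsum => j; apply: integrable_Rsum => k; apply: integrable_Rsum => l.
  by have [] := b3 j k l.
have sumc (a : 'I_m -> R) (c : R) : (forall j, a j <= c) -> \sum_j a j <= m%:R * c.
  move=> ac; apply: (@le_trans _ _ (\sum_(j < m) c)); first exact: ler_sum.
  by rewrite sumr_const card_ord mulr_natl.
have Z10 w : 0 <= Z1 w by apply: sumr_ge0 => j _; exact: sqr_ge0.
have Z20 w : 0 <= Z2 w by do 2?(apply: sumr_ge0 => ? _); exact: sqr_ge0.
have Z30 w : 0 <= Z3 w by do 3?(apply: sumr_ge0 => ? _); exact: sqr_ge0.
have p1 : (P [set w | (K * (n%:R * m%:R) < Z1 w)%R] <= e%:E)%E.
  apply: markov_le => //; first by rewrite !mulr_gt0.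
  rewrite /Z1 Rintegral_sum => [|j]; last by have [] := b1 j.
  apply: (@le_trans _ _ (m%:R * (n%:R * C2))); first by apply: (sumc) => j; have [] := b1 j.
  rewrite [leRHS](_ : _ = m%:R * (n%:R * (e * K))); last by ring.
  by rewrite !ler_wpM2l // ltW.
have p2 : (P [set w | (K * (n%:R * m%:R ^+ 2) < Z2 w)%R] <= e%:E)%E.
  apply: markov_le => //; first by rewrite !mulr_gt0 // exprn_gt0.
  rewrite /Z2 Rintegral_sum => [|j]; last by apply: integrable_Rsum => k; have [] := b2 j k.
  apply: (@le_trans _ _ (m%:R * (m%:R * (n%:R * C4)))).
    apply: (sumc) => j; rewrite Rintegral_sum => [|k]; last by have [] := b2 j k.
    apply: (sumc) => k.
    by have [] := b2 j k.
  rewrite [leRHS](_ : _ = m%:R * (m%:R * (n%:R * (e * K)))); last by ring.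
  by rewrite !ler_wpM2l // ltW.
have p3 : (P [set w | (K * (n%:R ^+ 2 * m%:R ^+ 3) < Z3 w)%R] <= e%:E)%E.
  apply: markov_le => //; first by rewrite !mulr_gt0 // exprn_gt0.
  rewrite /Z3 Rintegral_sum => [|j]; last first.
    by apply: integrable_Rsum => k; apply: integrable_Rsum => l; have [] := b3 j k l.
  apply: (@le_trans _ _ (m%:R * (m%:R * (m%:R * (n%:R ^+ 2 * C5))))).
    apply: (sumc) => j; rewrite Rintegral_sum => [|k]; last by apply: integrable_Rsum => l; have [] := b3 j k l.
    apply: (sumc) => k; rewrite Rintegral_sum => [|l]; last by have [] := b3 j k l.
    by apply: (sumc) => l; have [] := b3 j k l.
  rewrite [leRHS](_ : _ = m%:R * (m%:R * (m%:R * (n%:R ^+ 2 * (e * K))))); last by ring.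
  by rewrite !ler_wpM2l ?sqr_ge0 // ltW.
have mgt (Z : T -> R) c : P.-integrable [set: T] (EFin \o Z) -> (forall w, 0 <= Z w) ->
    measurable [set w | c < Z w].
  move=> iZ Z0; have mZ : measurable_fun [set: T] Z by apply/measurable_EFinP; exact: measurable_int iZ.
  have -> : [set w | c < Z w] = [set w | c < `|Z w|].
    by apply/seteqP; split=> w /=; rewrite ger0_norm.
  exact: measurable_abs_gt.
have [N [mN N0 NG]] := hgood.
pose A0 := N `|` [set x | f x b0 = 0].
have nuA0 : nu A0 = 0%E by exact: (null_set_nu mf nu_density mN N0).
have mA0 : measurable A0.
  apply: measurableU => //.
  have -> : [set x | f x b0 = 0] = [set: X] `&` (f ^~ b0) @^-1` [set 0] by rewrite setTI.
  exact: mf.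
(* Outside this null event every observation is [Good] and has positive density, so that regular
   versions can be replaced by the scores and Hessians themselves. *)
pose B0 := \bigcup_(i in [set: 'I_n]) (V i @^-1` A0).
have mVA i : measurable (V i @^-1` A0).
  by rewrite -[X in measurable X]setTI; apply: measurable_funPT.
have mB0 : measurable B0 by apply: fin_bigcup_measurable.
have PB0 : (P B0 <= 0%:E)%E.
  rewrite -[X in (_ <= X%:E)%E](mulr0 #|'I_n|%:R).
  by apply: probability_bigcup_le => // i; rewrite sample_law // nuA0.
exists (B0 `|` ([set w | K * (n%:R * m%:R) < Z1 w] `|` ([set w | K * (n%:R * m%:R ^+ 2) < Z2 w]
   `|` [set w | K * (n%:R ^+ 2 * m%:R ^+ 3) < Z3 w]))).
have m1 := mgt _ (K * (n%:R * m%:R)) iZ1 Z10.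
have m2 := mgt _ (K * (n%:R * m%:R ^+ 2)) iZ2 Z20.
have m3 := mgt _ (K * (n%:R ^+ 2 * m%:R ^+ 3)) iZ3 Z30.
split.
- by do 3?apply: measurableU.
- rewrite (le_trans (measureU2 _ _ _)) //; first by do 2?apply: measurableU.
  rewrite (_ : 3 * e = 0 + (e + (e + e))); last by ring.
  rewrite !EFinD leeD // (le_trans (measureU2 _ _ _)) //; first exact: measurableU.
  by rewrite leeD // (le_trans (measureU2 _ _ _)) // leeD.
move=> w /not_orP[w0 /not_orP[/negP w1 /not_orP[/negP w2 /negP w3]]].
have good i : Good (V i w) /\ 0 < f (V i w) b0.
  have VA : ~ A0 (V i w) by move=> VA; apply: w0; exists i.
  have fV : 0 < f (V i w) b0.
    rewrite lt_neqAle f0 andbT eq_sym; apply/eqP => fV0; apply: VA; by right.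
  split=> //; apply: contrapT => nG; apply: VA; left; apply: NG => /= H.
  by apply: nG; exact: H.
rewrite -leNgt in w1; rewrite -leNgt in w2; rewrite -leNgt in w3.
split=> //.
- apply: le_trans w1; rewrite le_eqVlt; apply/orP; left; apply/eqP; apply: eq_bigr => j _.
  congr (_ ^+ 2); apply: eq_bigr => i _; rewrite /rscore regularE //.
  by have [] := good i.
- apply: le_trans w2; rewrite le_eqVlt; apply/orP; left; apply/eqP; apply: eq_bigr => j _.
  apply: eq_bigr => k _; congr (_ ^+ 2); have -> : n%:R * fisher mu f b0 k j = \sum_(i < n) fisher mu f b0 k j.
    by rewrite sumr_const card_ord mulr_natl.
  rewrite -big_split; apply: eq_bigr => i _; rewrite /g /rhess regularE //.
  by have [] := good i.
Qed.

End SampleBounds.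

(** * The penalized score equation *)

Lemma cauchy_schwarz_sum2 (R : realDomainType) (I J : finType) (a b : I -> J -> R) :
  (\sum_i \sum_j a i j * b i j) ^+ 2
  <= (\sum_i \sum_j a i j ^+ 2) * (\sum_i \sum_j b i j ^+ 2).
Proof.
rewrite !pair_bigA /=.
exact: (cauchy_schwarz_sum (fun p : I * J => a p.1 p.2) (fun p => b p.1 p.2)).
Qed.

Section ScoreExpansion.
Context (R : realType) (d : measure_display) (X : measurableType d) (n m : nat).
Context (f : X -> 'cV[R]_m -> R) (v : 'I_n -> X) (b0 b : 'cV[R]_m).
Context (M : 'I_m -> 'I_m -> 'I_m -> X -> R).

Hypothesis hM : forall i x, inbox b0 b x -> third_pderivable (logf f (v i)) x /\
  forall j k l, `|third f x j k l (v i)| <= M j k l (v i).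
Context (I : 'M[R]_m).

Let dl := b - b0.

Lemma pderivable_logf i j : pderivable (logf f (v i)) j b.
Proof.
have bb : inbox b0 b b by move=> ?.
by have [/(_ j j j)[]] := hM i bb.
Qed.

Lemma loglikE : loglik f v = \sum_i logf f (v i).
Proof. by apply/funext => x; rewrite /loglik fct_sumE. Qed.

Lemma pderivable_loglik j : pderivable (loglik f v) j b.
Proof.
by rewrite /pderivable loglikE; apply: derivable_sum => i; exact: pderivable_logf.
Qed.

Lemma pd_loglik j : pd j (loglik f v) b = \sum_i score f b j (v i).
Proof.
rewrite /pd loglikE derive_sum // => i; exact: pderivable_logf.
Qed.

(* The remainder of the expansion of the score at [b0], with the Hessian of the
   log-likelihood replaced by its mean [- n I]. *)
Definition score_error j : R :=
  pd j (loglik f v) b - \sum_i score f b0 j (v i) + n%:R * (I *m dl) j ord0.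

(** Cauchy-Schwarz, separately on the deviation of the Hessian from its mean and on the third-order
    remainder. *)
Lemma score_error_le (j : 'I_m) :
  score_error j ^+ 2 <=
  2 * ((\sum_k (\sum_i hess f b0 k j (v i) + n%:R * I j k) ^+ 2) * (\sum_k dl k ord0 ^+ 2)
     + (\sum_k \sum_l (\sum_i M l k j (v i)) ^+ 2) * (\sum_k dl k ord0 ^+ 2) ^+ 2).
Proof.
pose H k := \sum_i hess f b0 k j (v i) + n%:R * I j k.
pose r := \sum_i (score f b j (v i) - score f b0 j (v i) - \sum_k hess f b0 k j (v i) * dl k ord0).
have rE : score_error j = \sum_k H k * dl k ord0 + r.
  rewrite /score_error pd_loglik /r !sumrB mxE mulr_sumr exchange_big /=.
  under [X in _ = X + _]eq_bigr do rewrite mulrDl mulr_suml -mulrA.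
  rewrite big_split /=; ring.
have rle : `|r| <= \sum_k \sum_l (\sum_i M l k j (v i)) * (`|dl l ord0| * `|dl k ord0|).
  apply: le_trans (ler_norm_sum _ _ _) _.
  under [leRHS]eq_bigr do under eq_bigr do rewrite mulr_suml.
  under [leRHS]eq_bigr do rewrite exchange_big.
  rewrite exchange_big /=; apply: ler_sum => i _.
  have dlE k : dl k ord0 = b k ord0 - b0 k ord0 by rewrite !mxE.
  under [leRHS]eq_bigr do under eq_bigr do rewrite !dlE.
  under [X in `|_ - X|]eq_bigr do rewrite dlE.
  have := @third_order_bound _ _ (logf f (v i)) (fun j k l => M j k l (v i)) b0 b j.
  apply => x xb; have [h1 h2] := hM i xb; split=> // k l; exact: h2.
have r2 : r ^+ 2 <= (\sum_k \sum_l (\sum_i M l k j (v i)) ^+ 2) * (\sum_k dl k ord0 ^+ 2) ^+ 2.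
  rewrite -real_normK ?num_real //.
  apply: (@le_trans _ _ ((\sum_k \sum_l (\sum_i M l k j (v i)) * (`|dl l ord0| * `|dl k ord0|)) ^+ 2)).
    by rewrite lerXn2r ?nnegrE ?(le_trans _ rle).
  apply: (le_trans (cauchy_schwarz_sum2 _ _)); rewrite le_eqVlt; apply/orP; left; apply/eqP.
  congr (_ * _); rewrite [in RHS]expr2 mulr_suml; apply: eq_bigr => k _.
  rewrite mulr_sumr; apply: eq_bigr => l _.
  by rewrite exprMn !real_normK ?num_real // mulrC.
have h2 := cauchy_schwarz_sum H (fun k => dl k ord0).
rewrite rE; apply: (@le_trans _ _ (2 * ((\sum_k H k * dl k ord0) ^+ 2 + r ^+ 2))).
  have := sqr_ge0 (\sum_k H k * dl k ord0 - r); lra.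
by rewrite ler_wpM2l // lerD.
Qed.

(** The Hessian part is of order [n m^2 * (m / n) = m^3] and the third derivatives of order
    [n^2 m^3 * (m / n)^2 = m^5]; the latter dominates and is where the fifth power of the dimension
    comes from. *)
Lemma score_error_sum_le (K : R) : 1 <= K -> (0 < n)%N -> (0 < m)%N ->
  \sum_k dl k ord0 ^+ 2 <= K * (m%:R / n%:R) ->
  \sum_j \sum_k (\sum_i hess f b0 k j (v i) + n%:R * I j k) ^+ 2 <= K * (n%:R * m%:R ^+ 2) ->
  \sum_j \sum_k \sum_l (\sum_i M l k j (v i)) ^+ 2 <= K * (n%:R ^+ 2 * m%:R ^+ 3) ->
  \sum_j score_error j ^+ 2 <= 4 * K ^+ 3 * m%:R ^+ 5.
Proof.
move=> K1 n0 m0 hD hH hM3; have K0 : 0 <= K by lra.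
have n0' : 0 < n%:R :> R by rewrite ltr0n.
have m1' : 1 <= m%:R :> R by rewrite ler1n.
set D := \sum_k dl k ord0 ^+ 2 in hD *.
have D0 : 0 <= D by apply: sumr_ge0 => k _; exact: sqr_ge0.
set S2 := \sum_j \sum_k _ in hH; set S3 := \sum_j \sum_k \sum_l _ in hM3.
have S20 : 0 <= S2 by do 2?(apply: sumr_ge0 => ? _); exact: sqr_ge0.
have S30 : 0 <= S3 by do 3?(apply: sumr_ge0 => ? _); exact: sqr_ge0.
apply: (@le_trans _ _ (2 * (S2 * D + S3 * D ^+ 2))).
  rewrite !mulr_suml -big_split mulr_sumr; apply: ler_sum => j _; exact: score_error_le.
have h2 : S2 * D <= K ^+ 2 * m%:R ^+ 3.
  apply: le_trans (ler_pM S20 D0 hH hD) _; rewrite le_eqVlt; apply/orP; left; apply/eqP.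
  by field; rewrite gt_eqF.
have h3 : S3 * D ^+ 2 <= K ^+ 3 * m%:R ^+ 5.
  have D2 : D ^+ 2 <= (K * (m%:R / n%:R)) ^+ 2 by rewrite lerXn2r ?nnegrE // (le_trans D0).
  apply: le_trans (ler_pM S30 (sqr_ge0 _) hM3 D2) _; rewrite le_eqVlt; apply/orP; left; apply/eqP.
  by field; rewrite gt_eqF.
have h4 : K ^+ 2 * m%:R ^+ 3 <= K ^+ 3 * m%:R ^+ 5.
  by rewrite ler_pM ?exprn_ge0 // ?ler_weXn2l // ltW.
lra.
Qed.

(** A cruder bound for a single coordinate of the gradient, for the proof of sparsity: [m ^+ 4 <= n]
    lets [n * m] absorb the error [m ^+ 5]. *)
Lemma stationary_sqr_le (K C2 : R) j : 1 <= K -> (0 < n)%N -> (0 < m)%N ->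
  m%:R ^+ 4 <= n%:R :> R ->
  \sum_k dl k ord0 ^+ 2 <= K * (m%:R / n%:R) ->
  \sum_k (I *m dl) k ord0 ^+ 2 <= C2 ^+ 2 * \sum_k dl k ord0 ^+ 2 ->
  \sum_k (\sum_i score f b0 k (v i)) ^+ 2 <= K * (n%:R * m%:R) ->
  \sum_k score_error k ^+ 2 <= 4 * K ^+ 3 * m%:R ^+ 5 ->
  pd j (loglik f v) b ^+ 2 <= 3 * (K + C2 ^+ 2 * K + 4 * K ^+ 3) * (n%:R * m%:R).
Proof.
move=> K1 n0 m0 mn hD hI hU he; have K0 : 0 <= K by lra.
have n0' : 0 < n%:R :> R by rewrite ltr0n.
have m0' : 0 < m%:R :> R by rewrite ltr0n.
have term (a : 'I_m -> R) : a j ^+ 2 <= \sum_k a k ^+ 2.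
  by rewrite (bigD1 j) //= lerDl sumr_ge0 // => k _; exact: sqr_ge0.
set U := fun k => \sum_i score f b0 k (v i).
have hU' : U j ^+ 2 <= K * (n%:R * m%:R) by apply: le_trans (term U) hU.
have he' : score_error j ^+ 2 <= 4 * K ^+ 3 * (n%:R * m%:R).
  apply: le_trans (term score_error) (le_trans he _); rewrite ler_wpM2l ?mulr_ge0 ?exprn_ge0 //.
  by rewrite exprSr ler_wpM2r // ltW.
have hI' : (n%:R * (I *m dl) j ord0) ^+ 2 <= C2 ^+ 2 * K * (n%:R * m%:R).
  rewrite exprMn; apply: (@le_trans _ _ (n%:R ^+ 2 * (C2 ^+ 2 * (K * (m%:R / n%:R))))).
    rewrite ler_wpM2l ?sqr_ge0 //; apply: le_trans (term (fun k => (I *m dl) k ord0)) _.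
    by apply: le_trans hI _; rewrite ler_wpM2l ?sqr_ge0.
  by rewrite le_eqVlt; apply/orP; left; apply/eqP; field; rewrite gt_eqF.
have -> : pd j (loglik f v) b = U j - n%:R * (I *m dl) j ord0 + score_error j.
  rewrite /score_error /U; ring.
set u := U j in hU' *; set w := _ * _ in hI' *; set e := score_error j in he' *.
have := sqr_ge0 (u + w); have := sqr_ge0 (u - e); have := sqr_ge0 (w + e).
nra.
Qed.

End ScoreExpansion.

(** Both points lie beyond the threshold [c], hence so does the segment between them, on which the
    second derivative exists and is Lipschitz. *)
Lemma pen1_taylor (R : realType) (pen : R -> R) (c D t0 t : R) :
  (forall u, 0 < u -> c < u -> derivable (pen1 pen) u 1) ->
  (forall u1 u2, 0 < u1 -> 0 < u2 -> c < u1 -> c < u2 ->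
     `|pen2 pen u1 - pen2 pen u2| <= D * `|u1 - u2|) ->
  0 < t0 -> c < t0 -> 0 < t -> c < t ->
  `|pen1 pen t - pen1 pen t0 - pen2 pen t0 * (t - t0)| <= D * (t - t0) ^+ 2.
Proof.
move=> dpen lip t00 ct0 tp ct.
pose l := Num.min t0 t; pose r := Num.max t0 t.
have lr : l <= r by rewrite /l /r ge_min !le_max lexx.
have inI u : u \in `[l, r] -> 0 < u /\ c < u.
  rewrite in_itv /= => /andP[lu _].
  by split; apply: lt_le_trans lu; rewrite /l lt_min; apply/andP.
have [||xi xiI E] := @MVT_segment R (pen1 pen) (pen2 pen) l r lr.
- move=> u uI; have [u0 cu] : 0 < u /\ c < u by apply: inI; exact: subset_itv_oo_cc uI.
  by rewrite /pen2 derive1E; apply: derivableP; exact: dpen.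
- apply: derivable_within_continuous => u /inI[u0 cu]; exact: dpen.
have [xi0 cxi] := inI _ xiI.
have EE : pen1 pen t - pen1 pen t0 = pen2 pen xi * (t - t0).
  move: E; rewrite /l /r; case: (leP t0 t) => // _ E.
  by rewrite -opprB E -mulrN opprB.
have D0 : 0 <= D * `|t - t0| by apply: le_trans (lip t t0 _ _ _ _).
rewrite EE -mulrBl normrM; apply: (@le_trans _ _ (D * `|xi - t0| * `|t - t0|)).
  by rewrite ler_wpM2r //; apply: lip.
rewrite -[(t - t0) ^+ 2]real_normK ?num_real // expr2 [leRHS]mulrA mulrAC ler_wpM2l //.
move: xiI; rewrite in_itv /l /r /=; case: (leP t0 t) => [tt|/ltW tt] /andP[h1 h2].
  by rewrite !ger0_norm ?subr_ge0 // lerD2r.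
by rewrite !ler0_norm ?subr_le0 // lerN2 lerD2r.
Qed.

(** This is how sparsity enters the expansion: once the last coordinates vanish, the first rows of
    the product involve the upper-left block only. *)
Lemma upper_left_mul (R : realType) (m s : nat) (hs : (s <= m)%N) (I : 'M[R]_m) (x : 'cV[R]_m) i :
  (forall j : 'I_m, (s <= j)%N -> x j ord0 = 0) ->
  (upper_left hs I *m subvec hs x) i ord0 = (I *m x) (widen_ord hs i) ord0.
Proof.
move=> x0; rewrite !mxE (bigID (fun j : 'I_m => (j < s)%N)) /= [X in _ = _ + X]big1 => [|j].
  by rewrite addr0 big_ord_narrow; apply: eq_bigr => k _; rewrite !mxE.
by rewrite -leqNgt => /x0 ->; rewrite mulr0.
Qed.

Lemma sum_widen_le (R : numDomainType) (m s : nat) (hs : (s <= m)%N) (F : 'I_m -> R) :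
  (forall j, 0 <= F j) -> \sum_(i < s) F (widen_ord hs i) <= \sum_j F j.
Proof.
move=> F0; rewrite [leRHS](bigID (fun j : 'I_m => (j < s)%N)) /= big_ord_narrow lerDl.
by apply: sumr_ge0.
Qed.

Lemma sum_sqr4_le (R : realDomainType) (I : finType) (a : I -> R) :
  \sum_i (a i ^+ 2) ^+ 2 <= (\sum_i a i ^+ 2) ^+ 2.
Proof.
rewrite [leRHS]expr2 mulr_suml; apply: ler_sum => i _; rewrite expr2 ler_wpM2l ?sqr_ge0 //.
by rewrite (bigD1 i) //= lerDl sumr_ge0 // => k _; exact: sqr_ge0.
Qed.

(** A true nonzero coordinate exceeds the error bound [l], so the estimate has the same sign; it
    also exceeds [c + l], so the estimate stays beyond the threshold [c] of smoothness. The two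
    terms of the bound are the score error and the Taylor remainder of the penalty. *)
Lemma linearization_error (R : realType) (m s : nat) (hs : (s <= m)%N) (I : 'M[R]_m)
    (b0 b : 'cV[R]_m) (pen : R -> R) (c D l N : R) (U e : 'I_m -> R) :
  (forall u, 0 < u -> c < u -> derivable (pen1 pen) u 1) ->
  (forall u1 u2, 0 < u1 -> 0 < u2 -> c < u1 -> c < u2 ->
     `|pen2 pen u1 - pen2 pen u2| <= D * `|u1 - u2|) ->
  (forall j, `|b j ord0 - b0 j ord0| <= l) ->
  (forall j : 'I_m, (j < s)%N -> l < `|b0 j ord0| /\ c + l < `|b0 j ord0|) ->
  (forall j : 'I_m, (s <= j)%N -> b j ord0 = 0 /\ b0 j ord0 = 0) ->
  (forall j : 'I_m, (j < s)%N -> N * (pen1 pen `|b j ord0| * Num.sg (b j ord0))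
     = U j - N * (I *m (b - b0)) j ord0 + e j) ->
  \sum_i (N * ((upper_left hs I + pen_Sigma pen (subvec hs b0)) *m (subvec hs b - subvec hs b0)
       + pen_bias pen (subvec hs b0)) i ord0 - U (widen_ord hs i)) ^+ 2
  <= 2 * (\sum_j e j ^+ 2 + (N * D * \sum_j (b - b0) j ord0 ^+ 2) ^+ 2).
Proof.
move=> dpen lip bl b0l bz stat.
have sub : subvec hs b - subvec hs b0 = subvec hs (b - b0) by apply/colP => i; rewrite !mxE.
have dz (j : 'I_m) : (s <= j)%N -> (b - b0) j ord0 = 0.
  by move=> /bz[b1 b2]; rewrite !mxE b1 b2 subr0.
apply: (@le_trans _ _ (\sum_i 2 * (e (widen_ord hs i) ^+ 2
    + (N * D) ^+ 2 * ((b - b0) (widen_ord hs i) ord0 ^+ 2) ^+ 2))); last first.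
  rewrite -mulr_sumr ler_wpM2l // big_split /= lerD //.
    by apply: sum_widen_le => j; exact: sqr_ge0.
  rewrite -mulr_sumr [leRHS]exprMn ler_wpM2l ?sqr_ge0 //.
  apply: (@le_trans _ _ (\sum_j ((b - b0) j ord0 ^+ 2) ^+ 2)); last exact: sum_sqr4_le.
  by apply: (@sum_widen_le _ _ _ hs (fun j => ((b - b0) j ord0 ^+ 2) ^+ 2)) => j; exact: sqr_ge0.
apply: ler_sum => i _; set j := widen_ord hs i.
have js : (j < s)%N by case: (i) @j => k /=.
have [h1 h2] := b0l j js; have h3 := bl j; have h4 := stat j js.
have l0 : 0 <= l by apply: le_trans h3.
have h5 : `|b0 j ord0| - l <= `|b j ord0|.
  by rewrite lerBlDl -lerBlDr (le_trans _ h3) // distrC lerB_dist.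
have b0p : 0 < `|b0 j ord0| by lra.
have bp : 0 < `|b j ord0| by lra.
have sgE : Num.sg (b j ord0) = Num.sg (b0 j ord0).
  move: h1 h3; rewrite ler_norml ltr_normr => /orP[h1|h1] /andP[h6 h7].
    by rewrite !gtr0_sg //; lra.
  by rewrite !ltr0_sg //; lra.
(* With equal signs, the increment of the absolute value is the signed increment of the
   coordinate. *)
have [t0 tt] : `|b j ord0| - `|b0 j ord0| = Num.sg (b0 j ord0) * (b - b0) j ord0 /\
    Num.sg (b0 j ord0) ^+ 2 = 1.
  rewrite !mxE mulrBr -{1}sgE -!normrEsg; split=> //.
  by rewrite sqr_sg -normr_gt0 b0p.
have T := pen1_taylor dpen lip b0p (_ : c < `|b0 j ord0|) bp (_ : c < `|b j ord0|).
have {T}T := T ltac:(lra) ltac:(lra).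
rewrite t0 exprMn tt mul1r in T.
set r := _ - _ - _ in T.
have -> : N * ((upper_left hs I + pen_Sigma pen (subvec hs b0)) *m
    (subvec hs b - subvec hs b0) + pen_bias pen (subvec hs b0)) i ord0 - U j
  = e j - N * (Num.sg (b0 j ord0) * r).
  rewrite mxE mulmxDl mxE sub upper_left_mul // /pen_Sigma mul_diag_mx !mxE -/j.
  rewrite sgE in h4; rewrite /r; set g := Num.sg _ in tt h4 *.
  have -> : e j = N * (pen1 pen `|b j ord0| * g) - U j + N * (I *m (b - b0)) j ord0.
    by rewrite h4; ring.
  set p2 := pen2 _ _; rewrite !mxE; transitivity
    (N * (\sum_k I j k * (b - b0) k ord0) + N * p2 * (b j ord0 - b0 j ord0) * g ^+ 2
      + N * (pen1 pen `|b0 j ord0| * g) - U j); first by rewrite tt; ring.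
  ring.
have r2 : r ^+ 2 <= D ^+ 2 * ((b - b0) j ord0 ^+ 2) ^+ 2.
  rewrite -exprMn -[leLHS]real_normK ?num_real // lerXn2r ?nnegrE //.
  exact: le_trans T.
apply: (@le_trans _ _ (2 * (e j ^+ 2 + N ^+ 2 * r ^+ 2))); last first.
  have := ler_wpM2l (sqr_ge0 N) r2; rewrite mulrA -exprMn; lra.
have -> : N ^+ 2 * r ^+ 2 = (N * (Num.sg (b0 j ord0) * r)) ^+ 2 by rewrite !exprMn tt mul1r.
set w := N * (_ * r); have := sqr_ge0 (e j + w); lra.
Qed.

(** * Sparsity and linearization *)

Lemma limn_einf_gt0 (R : realType) (u : (\bar R)^nat) : (0 < limn_einf u)%E ->
  exists2 c : R, 0 < c & \forall n \near \oo, (c%:E <= u n)%E.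
Proof.
rewrite limn_einf_lim (cvg_lim _ (@cvg_einfs_sup _ u)) // => /ereal_sup_gt[_ [N _ <-]].
move=> uN; have [c c0 cN] : exists2 c : R, 0 < c & (c%:E <= einfs u N)%E.
  case: (einfs u N) uN => [r| |] //; first by rewrite lte_fin => r0; exists r.
  by exists 1 => //; rewrite leey.
exists c => //; exists N => // k /= Nk; apply: le_trans cN _.
by apply: ereal_inf_lbound; exists k.
Qed.

Lemma fisher_sym (R : realType) (d : measure_display) (X : measurableType d) (m : nat)
    (mu : {measure set X -> \bar R}) (f : X -> 'cV[R]_m -> R) (b : 'cV[R]_m) :
  (fisher mu f b)^T = fisher mu f b.
Proof.
rewrite /fisher; move: (score f b) => g; apply/matrixP => j k; rewrite !mxE.
by congr (fine (expect _ _ _ _)); apply/funext => x; rewrite mulrC.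
Qed.

Lemma lambda_max_diag (R : realType) (m : nat) (A : 'M[R]_m) c j : A^T = A ->
  lambda_max A <= c -> A j j <= c.
Proof.
move=> sA Ac; have := lambda_max_quad (delta_mx j ord0) sA Ac.
rewrite sqnormE trmx_delta -rowE -colE [X in X <= _]mxE [X in X <= _]mxE.
rewrite (bigD1 j) //= big1 => [|k kj]; last by rewrite mxE (negbTE kj) expr0n.
by rewrite mxE !eqxx addr0 expr1n mulr1.
Qed.

Lemma enorm_sqr (R : realType) m (x : 'cV[R]_m) : enorm x ^+ 2 = \sum_i x i ord0 ^+ 2.
Proof. by rewrite sqr_sqrtr // sumr_ge0 // => i _; exact: sqr_ge0. Qed.

Lemma enorm_ge0 (R : realType) m (x : 'cV[R]_m) : 0 <= enorm x.
Proof. exact: sqrtr_ge0. Qed.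

Lemma coord_enorm (R : realType) m (x : 'cV[R]_m) i : `|x i ord0| <= enorm x.
Proof.
rewrite -ler_sqr ?nnegrE ?enorm_ge0 // enorm_sqr real_normK ?num_real //.
by rewrite (bigD1 i) //= lerDl sumr_ge0 // => k _; exact: sqr_ge0.
Qed.

Lemma measurable_enorm (R : realType) (d : measure_display) (T : measurableType d) m
    (x : T -> 'cV[R]_m) : (forall j, measurable_fun [set: T] (fun w => x w j ord0)) ->
  measurable_fun [set: T] (fun w => enorm (x w)).
Proof.
move=> mx; apply: (measurableT_comp (continuous_measurable_fun (@sqrt_continuous R))).
by apply: measurable_sum => j; exact: measurable_funX.
Qed.

Lemma pderivable_ln (R : realType) m (g : 'cV[R]_m -> R) k b : 0 < g b -> pderivable g k b ->
  pderivable (fun x => ln (g x)) k b /\ pd k (fun x => ln (g x)) b = pd k g b * (g b)^-1.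
Proof.
move=> gb dg.
have d1 := @is_derive_coordinate _ _ g b k 0.
rewrite scale0r addr0 in d1; have {}d1 := d1 dg.
have d2 : is_derive (g (b + (0 : R) *: (delta_mx k ord0 : 'cV[R]_m))) (1 : R) (@ln R) (g b)^-1.
  by rewrite scale0r addr0; exact: is_derive1_ln.
have [d3 E3] := @is_derive1_comp _ _ (fun t : R => g (b + t *: (delta_mx k ord0 : 'cV[R]_m))) _ _ _ d2 d1.
have E : (fun h : R => h^-1 *: ((((@ln R) \o (fun t : R => g (b + t *: (delta_mx k ord0 : 'cV[R]_m)))) \o shift 0) (h *: 1)
      - ((@ln R) \o (fun t : R => g (b + t *: (delta_mx k ord0 : 'cV[R]_m)))) 0))
   = (fun h : R => h^-1 *: (((fun x => ln (g x)) \o shift b) (h *: (delta_mx k ord0 : 'cV[R]_m)) - ln (g b))).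
  apply/funext => h /=; congr (_ *: (ln (g _) - ln (g _))).
    by rewrite scaler1 addr0 addrC.
  by rewrite scale0r addr0.
split; first by move: d3; rewrite /pderivable /derivable E.
by rewrite mulrC -E3 /pd /derive E.
Qed.

(** Each derivative of the logarithm is differentiated through a formula valid near the point; hence
    positivity and differentiability on an open set rather than at [b] alone. *)
Lemma third_pderivable_ln (R : realType) m (g : 'cV[R]_m -> R) (omega : set 'cV[R]_m) b :
  open omega -> (forall x, omega x -> 0 < g x /\ third_pderivable g x) -> omega b ->
  third_pderivable (fun x => ln (g x)) b.
Proof.
move=> oo H ob.
have near_o (Q : 'cV[R]_m -> Prop) x : omega x -> (forall y, omega y -> Q y) -> \forall y \near x, Q y.
  by move=> ox HQ; apply: filterS (open_nbhs_nbhs (conj oo ox)) => y; exact: HQ.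
pose ig := fun x => (g x)^-1.
have dig x k : omega x -> pderivable ig k x.
  by move=> ox; have [g0 /(_ k k k)[dg _ _]] := H x ox; apply: derivableV => //; rewrite gt_eqF.
have D1 x k : omega x -> pderivable (fun x => ln (g x)) k x /\
    pd k (fun x => ln (g x)) x = (pd k g * ig) x.
  by move=> ox; have [g0 /(_ k k k)[dg _ _]] := H x ox; apply: pderivable_ln.
have D2 x j k : omega x -> pderivable (pd j g * ig) k x.
  by move=> ox; have [g0 /(_ j k k)[_ dg _]] := H x ox; exact: derivableM dg (dig x k ox).
have E2 x j k : omega x -> pd k (pd j (fun x => ln (g x))) x
    = (pd j g * (- (ig * ig * pd k g)) + ig * pd k (pd j g)) x.
  move=> ox; transitivity (pd k (pd j g * ig) x).
    by apply: near_eq_derive; apply: near_o => // y oy; have [_ ->] := D1 y j oy.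
  have [g0 H3] := H x ox; have [_ dg _] := H3 j k k; have [dgk _ _] := H3 k k k.
  rewrite /pd (deriveM dg (dig x k ox)) (deriveV _ dgk) ?gt_eqF //.
  change (pd j g x * (- g x ^- 2 * pd k g x) + ig x * pd k (pd j g) x
    = pd j g x * - (ig x * ig x * pd k g x) + ig x * pd k (pd j g) x).
  by rewrite mulNr /ig -invfM expr2.
move=> j k l; split.
- by have [] := D1 b j ob.
- apply: (@near_eq_derivable _ _ _ (pd j g * ig)); last exact: D2.
  by apply: near_o => // y oy; have [_ ->] := D1 y j oy.
apply: (@near_eq_derivable _ _ _ (pd j g * (- (ig * ig * pd k g)) + ig * pd k (pd j g))).
  by apply: near_o => // y oy; rewrite E2.
have [g0 H3] := H b ob; have [dg1 dg2 dg3] := H3 j k l.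
have [_ dg4 _] := H3 j l l; have [_ dg5 _] := H3 k l l.
have di := dig b l ob.
exact: (derivableD (derivableM dg4 (derivableN (derivableM (derivableM di di) dg5)))
                   (derivableM di dg3)).
Qed.

(** * Events of high probability for the estimator *)

Section Asymptotics.
Unset Implicit Arguments.
Context (R : realType) (s p : nat -> nat) (hsp : forall n, (s n <= p n)%N).
Context (dX : nat -> measure_display) (X : forall n, measurableType (dX n)).
Context (mu : forall n, {measure set (X n) -> \bar R}).
Context (Omega : forall n, set 'cV[R]_(p n)).
Context (f : forall n, X n -> 'cV[R]_(p n) -> R) (b0 : forall n, 'cV[R]_(p n)).
Context (dT : nat -> measure_display) (T : forall n, measurableType (dT n)).
Context (P : forall n, probability (T n) R) (V : forall n, 'I_n -> {RV (P n) >-> X n}).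
Context (pen : R -> R -> R) (lam : nat -> R).
Context (omega : forall n, set 'cV[R]_(p n)).
Context (M : forall n, 'I_(p n) -> 'I_(p n) -> 'I_(p n) -> X n -> R).
Context (bhat : forall n, T n -> 'cV[R]_(p n)).
Set Implicit Arguments.
Hypothesis hs0 : forall n, (0 < s n)%N.
Hypothesis hdens : forall n, (0 < n)%N -> density_family (mu n) (f n) (Omega n).
Hypothesis hb0 : forall n, (0 < n)%N -> Omega n (b0 n).
Hypothesis hlam : forall n, (0 < n)%N -> 0 < lam n.
Hypothesis hindep : forall n, (0 < n)%N -> mutually_independent (V n).
Hypothesis hlaw : forall n, (0 < n)%N -> forall i : 'I_n,
  has_density (mu n) (V n i) ((f n) ^~ (b0 n)).
Hypothesis hscore : forall n, (0 < n)%N -> score_identities (mu n) (f n) (b0 n).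
Hypothesis hinfo : exists C1 C2 C3 C4 : R, 0 < C1 /\ forall n, (0 < n)%N ->
  [/\ C1 < lambda_min (fisher (mu n) (f n) (b0 n)),
      lambda_max (fisher (mu n) (f n) (b0 n)) < C2,
      forall j k : 'I_(p n),
        (expect (mu n) (f n) (b0 n) (fun x =>
           ((score (f n) (b0 n) j x * score (f n) (b0 n) k x) ^+ 2)%R)
         < C3%:E)%E
    & forall j k : 'I_(p n),
        (expect (mu n) (f n) (b0 n) (fun x =>
           (hess (f n) (b0 n) j k x ^+ 2)%R) < C4%:E)%E].
Hypothesis homega : forall n, (0 < n)%N ->
  [/\ open (omega n), omega n `<=` Omega n & omega n (b0 n)].
Hypothesis homega_large : forall K : R, 0 < K -> \forall n \near \oo,
  [set b | enorm (b - b0 n) <= K * Num.sqrt ((p n)%:R / n%:R)] `<=` omega n.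
Hypothesis hM : forall n, (0 < n)%N -> forall j k l : 'I_(p n),
  measurable_fun [set: X n] (M n j k l).
Hypothesis hthird : forall n, (0 < n)%N ->
  {ae mu n, forall x, 0 < f n x (b0 n) -> forall b, omega n b ->
     third_pderivable (f n x) b /\
     forall j k l : 'I_(p n), `|third (f n) b j k l x| <= M n j k l x}.
Hypothesis hM2 : exists C5 : R, forall n, (0 < n)%N -> forall j k l : 'I_(p n),
  (expect (mu n) (f n) (b0 n) (fun x => (M n j k l x ^+ 2)%R) < C5%:E)%E.
Hypothesis hz : forall n, (0 < n)%N -> forall j : 'I_(p n),
  (s n <= j)%N -> b0 n j ord0 = 0.
Hypothesis hsignal : (fun n => min_abs (subvec (hsp n) (b0 n)) / lam n) @ \oo --> +oo.
Hypothesis hpen_origin : forall K : R, 0 < K ->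
  (\forall n \near \oo, forall t : R,
     0 < t <= K * Num.sqrt ((p n)%:R / n%:R) -> derivable (pen (lam n)) t 1)
  /\ (0 < limn_einf (fun n => origin_slope (pen (lam n)) (lam n)
                                (K * Num.sqrt ((p n)%:R / n%:R))%R))%E.
Hypothesis hpen_smooth : exists C D : R, forall n, (0 < n)%N ->
  (forall t : R, 0 < t -> C * lam n < t ->
     derivable (pen (lam n)) t 1 /\ derivable (pen1 (pen (lam n))) t 1) /\
  (forall t1 t2 : R, 0 < t1 -> 0 < t2 -> C * lam n < t1 -> C * lam n < t2 ->
     `|pen2 (pen (lam n)) t1 - pen2 (pen (lam n)) t2| <= D * `|t1 - t2|).
Hypothesis hrate : (fun n => Num.sqrt (n%:R / (p n)%:R) * lam n) @ \oo --> +oo.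
Hypothesis hdim : (fun n => (p n)%:R ^+ 5 / n%:R : R) @ \oo --> (0 : R).
Hypothesis hbhat_meas : forall n, (0 < n)%N -> forall j : 'I_(p n),
  measurable_fun [set: T n] (fun w => bhat n w j ord0).
Hypothesis hbhat_max : wp_to_1 P (fun n => [set w |
  local_maximizer (Omega n)
    (penlik (f n) (pen (lam n)) (fun i => V n i w)) (bhat n w)]).
Hypothesis hbhat_cons : bigO_p P (fun n w => enorm (bhat n w - b0 n))
  (fun n => Num.sqrt ((p n)%:R / n%:R)).

Hypothesis hsupp : forall n, (0 < n)%N -> common_support (f n) (Omega n).

Let rate n : R := Num.sqrt ((p n)%:R / n%:R).

Lemma dim_gt0 n : (0 < p n)%N. Proof. exact: leq_trans (hs0 n) (hsp n). Qed.

Lemma rate_sqr n : rate n ^+ 2 = (p n)%:R / n%:R.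
Proof. by rewrite sqr_sqrtr // divr_ge0. Qed.

Lemma rate_ge0 n : 0 <= rate n. Proof. exact: sqrtr_ge0. Qed.

Lemma dim4_near : \forall n \near \oo, (p n)%:R ^+ 4 <= n%:R :> R.
Proof.
have h : \forall n \near \oo, ((p n)%:R ^+ 5 / n%:R : R) < 1 by apply: (cvgr_lt _ hdim).
near=> n; have n0 : (0 < n)%N by near: n; exact: nbhs_infty_gt.
have := near h n; rewrite ltr_pdivrMr ?ltr0n // mul1r => h1.
apply: le_trans (ltW (h1 _)); last by [].
by rewrite ler_weXn2l // ler1n dim_gt0.
Unshelve. all: end_near. Qed.

(** The common support carries the positivity of the density from [b0] to all of [omega], where the
    logarithm can then be differentiated. *)
Lemma regular_near n : (0 < n)%N -> {ae mu n, forall x, 0 < f n x (b0 n) ->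
  forall b, omega n b -> third_pderivable (logf (f n) x) b /\
    forall j k l : 'I_(p n), `|third (f n) b j k l x| <= M n j k l x}.
Proof.
move=> n0; have [oo oO ob0] := homega n0.
apply: filterS (hthird n0) => x H fx b ob; have [_ H2] := H fx b ob; split=> //.
apply: (third_pderivable_ln oo) => // y oy; split; last by have [] := H fx y oy.
have /seteqP[S _] := hsupp n0 (hb0 n0) (oO _ oy).
exact: (S x fx).
Qed.

(** The facts used about a fixed outcome, with a single constant. The score equation is conditional
    on differentiability of the penalty, which is assumed near the origin and beyond a multiple of
    [lam n], but not in between. *)
Definition bhat_event (K : R) n (w : T n) : Prop :=
  [/\ forall i, 0 < f n (V n i w) (b0 n),
      enorm (bhat n w - b0 n) <= K * rate n,
      forall j : 'I_(p n), bhat n w j ord0 != 0 ->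
        derivable (pen (lam n)) `|bhat n w j ord0| 1 ->
        pd j (loglik (f n) (fun i => V n i w)) (bhat n w)
        = n%:R * (pen1 (pen (lam n)) `|bhat n w j ord0| * Num.sg (bhat n w j ord0)),
      forall j : 'I_(p n), pd j (loglik (f n) (fun i => V n i w)) (bhat n w) ^+ 2
        <= K * (n%:R * (p n)%:R)
    & \sum_j score_error (f n) (fun i => V n i w) (b0 n) (bhat n w)
               (fisher (mu n) (f n) (b0 n)) j ^+ 2 <= K * (p n)%:R ^+ 5].

Lemma bhat_event_near (e : R) : 0 < e -> exists2 K : R, 1 <= K &
  \forall n \near \oo, exists B : set (T n),
    [/\ measurable B, (P n B <= e%:E)%E & forall w, ~ B w -> bhat_event K w].
Proof.
(* Three shares for the moment bounds, one for the maximizer and one for consistency. *)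
move=> e0; pose e5 := e / 5; have e50 : 0 < e5 by rewrite divr_gt0.
have [C1 [C2 [C3 [C4 [C10 hC]]]]] := hinfo; have [C5 hC5] := hM2.
have [K0 hK0] := hbhat_cons e50.
(* Large enough for Markov's inequality with the three moment constants, and above both [|K0|] and
   [K0 ^+ 2], as the consistency bound is also used squared. *)
pose K := 1 + K0 ^+ 2 + `|K0| + (`|C2| + `|C4| + `|C5|) / e5.
have K1 : 1 <= K.
  by rewrite /K -!addrA lerDl !addr_ge0 // ?sqr_ge0 // divr_ge0 ?addr_ge0 // ltW.
have KC c : `|c| <= `|C2| + `|C4| + `|C5| -> c <= e5 * K.
  move=> cC; apply: le_trans (le_trans (ler_norm c) cC) _.
  rewrite -ler_pdivrMl // mulrC /K lerDr !addr_ge0 // sqr_ge0 //.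
have KK0 : K0 ^+ 2 <= K.
  rewrite /K addrAC -addrA [1 + _]addrC -!addrA lerDl !addr_ge0 //.
  by rewrite divr_ge0 ?addr_ge0 // ltW.
pose K' := K + 3 * (K + C2 ^+ 2 * K + 4 * K ^+ 3) + 4 * K ^+ 3.
have Kp : 0 <= K by lra.
have Kp3 : 0 <= K ^+ 3 by rewrite exprn_ge0.
have Kc2 : 0 <= C2 ^+ 2 * K by rewrite mulr_ge0 ?sqr_ge0.
exists K'; first by rewrite /K'; lra.
have [F [mF FE PF]] := hbhat_max.
have PF1 : \forall n \near \oo, ((1 - e5)%:E < P n (F n))%E.
  have /fine_cvgP[fP PF1] := PF.
  have h : \forall n \near \oo, 1 - e5 < fine (P n (F n)).
    by apply: (cvgr_gt _ PF1); rewrite ltrBlDr ltrDl.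
  near=> n; have hn : P n (F n) \is a fin_num by near: n.
  by rewrite -(fineK hn) lte_fin; near: n.
have Kpos : 0 < K by lra.
near=> n; have n0 : (0 < n)%N by near: n; exact: nbhs_infty_gt.
have N0 : 0 < n%:R :> R by rewrite ltr0n.
have hdim4 : (p n)%:R ^+ 4 <= n%:R :> R by near: n; exact: dim4_near.
have hlarge : [set b | enorm (b - b0 n) <= K * rate n] `<=` omega n.
  by near: n; exact: homega_large.
have hcons : (P n [set w | (K0 * rate n < `|enorm (bhat n w - b0 n)|)%R] <= e5%:E)%E.
  by near: n; exact: hK0.
have hF : ((1 - e5)%:E < P n (F n))%E by near: n; exact: PF1.
have [mf f0 _] := hdens n0 (hb0 n0).
have [hCn1 hCn2 hCn3 hCn4] := hC n n0.
have sI := fisher_sym (mu n) (f n) (b0 n).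
have diagC j : fisher (mu n) (f n) (b0 n) j j <= C2 by apply: lambda_max_diag => //; exact: ltW.
have [oo oO ob0] := homega n0.
have [||| B0 [mB0 PB0 B0P]] := good_event n0 (dim_gt0 n) mf f0 (hindep n0) (hlaw n0) (hscore n0) (hM n0)
   (regular_near n0) diagC hCn4 (hC5 n n0) e50 Kpos.
- by apply: KC; rewrite -addrA lerDl addr_ge0.
- by apply: KC; rewrite addrAC lerDr addr_ge0.
- by apply: KC; rewrite lerDr addr_ge0.
have men : measurable_fun [set: T n] (fun w => enorm (bhat n w - b0 n)).
  apply: measurable_enorm => j.
  rewrite (_ : (fun w => _) = (fun w => bhat n w j ord0 - b0 n j ord0)).
    by apply: measurable_funB => //; exact: hbhat_meas.
  by apply/funext => w; rewrite !mxE.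
pose B1 := [set w | (K0 * rate n < `|enorm (bhat n w - b0 n)|)%R].
have mB1 : measurable B1 by exact: measurable_abs_gt.
have mF' : measurable (~` F n) by exact: measurableC.
exists (B0 `|` (~` F n `|` B1)); split.
- by do 2?apply: measurableU.
- rewrite (_ : e = 3 * e5 + (e5 + e5)); last by rewrite /e5; field.
  rewrite !EFinD (le_trans (measureU2 _ _ _)) //; first exact: measurableU.
  rewrite leeD // (le_trans (measureU2 _ _ _)) // leeD //.
  have := probability_setC (P n) (mF n); rewrite /= => ->.
  by rewrite leeBlDr ?fin_num_measure // addeC -leeBlDr // -EFinB; exact: ltW.
move=> w /not_orP[/B0P[G hU hH hM3] /not_orP[/contrapT/FE Fw /negP]].
rewrite -leNgt ger0_norm ?enorm_ge0 // => hen.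
have henK : enorm (bhat n w - b0 n) <= K * rate n.
  apply: le_trans hen _; rewrite ler_wpM2r ?rate_ge0 //.
  apply: le_trans (ler_norm K0) _; rewrite /K -addrA [leRHS]addrCA lerDl.
  by rewrite !addr_ge0 ?sqr_ge0 // divr_ge0 ?addr_ge0 // ltW.
have ob : omega n (bhat n w) by exact: hlarge.
have hD : \sum_k (bhat n w - b0 n) k ord0 ^+ 2 <= K * ((p n)%:R / n%:R).
  rewrite -enorm_sqr -rate_sqr.
  apply: (@le_trans _ _ ((K0 * rate n) ^+ 2)); first by rewrite lerXn2r ?nnegrE ?enorm_ge0 // (le_trans (enorm_ge0 _) hen).
  by rewrite exprMn ler_wpM2r ?sqr_ge0.
have hT i x : inbox (b0 n) (bhat n w) x -> third_pderivable (logf (f n) (V n i w)) x /\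
    forall j k l, `|third (f n) x j k l (V n i w)| <= M n j k l (V n i w).
  (* The box lies in the ball of radius [K * rate n], hence in [omega n] for large [n]. *)
  move=> xb; have [Gi _] := G i; apply: Gi; apply: hlarge => /=.
  exact: le_trans (inbox_enorm xb) henK.
have sE j k : fisher (mu n) (f n) (b0 n) j k = fisher (mu n) (f n) (b0 n) k j.
  by rewrite -{1}sI mxE.
have {}hH : \sum_j \sum_k (\sum_i hess (f n) (b0 n) k j (V n i w)
    + n%:R * fisher (mu n) (f n) (b0 n) j k) ^+ 2 <= K * (n%:R * (p n)%:R ^+ 2).
  by under eq_bigr do under eq_bigr do rewrite sE.
have he := score_error_sum_le hT K1 n0 (dim_gt0 n) hD hH hM3.
have p5 : 0 <= (p n)%:R ^+ 5 :> R by rewrite exprn_ge0.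
have np0 : 0 <= n%:R * (p n)%:R :> R by rewrite mulr_ge0.
split.
- by move=> i; have [] := G i.
- by apply: le_trans henK _; rewrite ler_wpM2r ?rate_ge0 // /K'; lra.
- move=> j bj dpen; apply: (penalized_score_equation oo oO ob Fw) => //.
  exact: pderivable_loglik hT j.
- move=> j.
  have hI : \sum_k (fisher (mu n) (f n) (b0 n) *m (bhat n w - b0 n)) k ord0 ^+ 2
      <= C2 ^+ 2 * \sum_k (bhat n w - b0 n) k ord0 ^+ 2.
    by rewrite -!sqnormE; apply: lambda_max_sqnorm => //; apply: ltW => //; exact: lt_trans hCn1.
  apply: le_trans (stationary_sqr_le j K1 n0 (dim_gt0 n) hdim4 hD hI hU he) _.
  by rewrite ler_wpM2r // /K'; lra.
- by apply: le_trans he _; rewrite ler_wpM2r // /K'; lra.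
Unshelve. all: end_near. Qed.

Lemma rate_lam_near (c : R) : \forall n \near \oo, c * rate n <= lam n.
Proof.
have h : \forall n \near \oo, c <= Num.sqrt (n%:R / (p n)%:R) * lam n.
  by move/cvgryPge: hrate; apply.
near=> n; have n0 : (0 < n)%N by near: n; exact: nbhs_infty_gt.
have hn : c <= Num.sqrt (n%:R / (p n)%:R) * lam n by near: n.
have N0 : 0 < n%:R :> R by rewrite ltr0n.
have p0 : 0 < (p n)%:R :> R by rewrite ltr0n dim_gt0.
have E : rate n * Num.sqrt (n%:R / (p n)%:R) = 1.
  rewrite /rate -sqrtrM ?divr_ge0 // mulrA divfK ?gt_eqF // divff ?gt_eqF //.
  exact: sqrtr1.
by rewrite -[leRHS]mul1r -E -mulrA mulrC ler_wpM2l // rate_ge0.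
Unshelve. all: end_near. Qed.

Lemma min_abs_near (c : R) : \forall n \near \oo, forall j : 'I_(p n), (j < s n)%N ->
  c * lam n <= `|b0 n j ord0|.
Proof.
have h : \forall n \near \oo, c <= min_abs (subvec (hsp n) (b0 n)) / lam n.
  by move/cvgryPge: hsignal; apply.
near=> n => j js; have n0 : (0 < n)%N by near: n; exact: nbhs_infty_gt.
have hn : c <= min_abs (subvec (hsp n) (b0 n)) / lam n by near: n.
move: hn; rewrite ler_pdivlMr ?hlam // => hn; apply: le_trans hn _.
apply: ge_inf; first by exists 0 => _ [i _ <-].
exists (Ordinal js) => //; rewrite mxE; congr (`|b0 n _ _|); exact: val_inj.
Unshelve. all: end_near. Qed.

Lemma sparse_near (e : R) : 0 < e -> \forall n \near \oo, exists B : set (T n),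
  [/\ measurable B, (P n B <= e%:E)%E &
    forall w, ~ B w -> forall j : 'I_(p n), (s n <= j)%N -> bhat n w j ord0 = 0].
Proof.
move=> e0; have [K K1 KB] := bhat_event_near e0; have K0 : 0 < K by lra.
have [pder /limn_einf_gt0[c c0 hc]] := hpen_origin K0.
(* This factor makes the derivative of the penalty at least [(K + 1) * rate n]; the contradiction is
   then [(K + 1) ^+ 2 > K]. *)
have hr := rate_lam_near ((K + 1) / c).
near=> n; have n0 : (0 < n)%N by near: n; exact: nbhs_infty_gt.
have N0 : 0 < n%:R :> R by rewrite ltr0n.
have p0 : 0 < (p n)%:R :> R by rewrite ltr0n dim_gt0.
have [B [mB PB BP]] : exists B : set (T n),
  [/\ measurable B, (P n B <= e%:E)%E & forall w, ~ B w -> bhat_event K w] by near: n.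
exists B; split=> // w /BP[_ hen stat bnd _] j sj; apply: contrapT => /eqP bj.
set t := `|bhat n w j ord0| in stat.
have t0 : 0 < t by rewrite normr_gt0.
(* The true coordinate is 0, so [t] is itself an estimation error and falls in the window of
   [origin_slope]. *)
have tK : t <= K * rate n.
  apply: le_trans hen; apply: le_trans (coord_enorm _ j).
  by rewrite !mxE hz // subr0.
have dt : derivable (pen (lam n)) t 1.
  have h : forall t : R, 0 < t <= K * rate n -> derivable (pen (lam n)) t 1 by near: n.
  by apply: h; rewrite t0.
have slope : c * lam n <= pen1 (pen (lam n)) t.
  have h : (c%:E <= origin_slope (pen (lam n)) (lam n) (K * rate n)%R)%E by near: n.
  rewrite -ler_pdivlMr ?hlam // -lee_fin; apply: le_trans h _.
  by apply: ereal_inf_lbound; exists t => //=; rewrite t0.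
have lamr : (K + 1) / c * rate n <= lam n by near: n.
have slope2 : (K + 1) * rate n <= pen1 (pen (lam n)) t.
  by apply: le_trans slope; rewrite -ler_pdivrMl // mulrA [_^-1 * _]mulrC.
have := bnd j; rewrite stat // !exprMn sqr_sg bj mulr1 => bnd'.
have : n%:R ^+ 2 * ((K + 1) * rate n) ^+ 2 <= K * (n%:R * (p n)%:R).
  apply: le_trans bnd'; rewrite ler_wpM2l ?sqr_ge0 // lerXn2r ?nnegrE ?(le_trans _ slope2) //.
    by rewrite mulr_ge0 ?rate_ge0 //; lra.
  by rewrite mulr_ge0 ?rate_ge0 //; lra.
rewrite exprMn rate_sqr [leLHS](_ : _ = (K + 1) ^+ 2 * (n%:R * (p n)%:R)); last first.
  by field; rewrite gt_eqF.
rewrite ler_pM2r ?mulr_gt0 //; nra.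
Unshelve. all: end_near. Qed.

Lemma linear_near (e : R) : 0 < e -> exists2 K : R, 0 <= K &
  \forall n \near \oo, exists B : set (T n),
  [/\ measurable B, (P n B <= e%:E)%E & forall w, ~ B w ->
    \sum_i (n%:R * ((upper_left (hsp n) (fisher (mu n) (f n) (b0 n))
          + pen_Sigma (pen (lam n)) (subvec (hsp n) (b0 n)))
          *m (subvec (hsp n) (bhat n w) - subvec (hsp n) (b0 n))
        + pen_bias (pen (lam n)) (subvec (hsp n) (b0 n))) i ord0
      - \sum_l rscore (f n) (b0 n) (widen_ord (hsp n) i) (V n l w)) ^+ 2
    <= K * (p n)%:R ^+ 5].
Proof.
move=> e0; pose e2 := e / 2; have e20 : 0 < e2 by rewrite divr_gt0.
have [K K1 KB] := bhat_event_near e20; have K0 : 0 < K by lra.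
have sp := sparse_near e20.
have [C [D CD]] := hpen_smooth.
(* Beyond the smoothness threshold, one multiple of [lam n] covers the estimation error and one
   makes the inequalities strict. *)
have hr := rate_lam_near K; have hm := min_abs_near (`|C| + 2).
exists (2 * (K + (D * K ^+ 2) ^+ 2)).
  by rewrite mulr_ge0 // addr_ge0 ?sqr_ge0 // ltW.
near=> n; have n0 : (0 < n)%N by near: n; exact: nbhs_infty_gt.
have N0 : 0 < n%:R :> R by rewrite ltr0n.
have p1 : 1 <= (p n)%:R :> R by rewrite ler1n dim_gt0.
have [B1 [mB1 PB1 B1P]] : exists B : set (T n),
  [/\ measurable B, (P n B <= e2%:E)%E & forall w, ~ B w -> bhat_event K w] by near: n.
have [B2 [mB2 PB2 B2P]] : exists B : set (T n), [/\ measurable B, (P n B <= e2%:E)%E &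
  forall w, ~ B w -> forall j : 'I_(p n), (s n <= j)%N -> bhat n w j ord0 = 0] by near: n.
exists (B1 `|` B2); split; first exact: measurableU.
  rewrite (_ : e = e2 + e2); last by rewrite /e2; field.
  by rewrite EFinD (le_trans (measureU2 _ _ _)) // leeD.
move=> w /not_orP[/B1P[fpos hen stat _ herr] /B2P bz].
have [dpen lip] := CD n n0.
have lam0 := hlam n0.
have rl : K * rate n <= lam n by near: n.
have hmn : forall j : 'I_(p n), (j < s n)%N -> (`|C| + 2) * lam n <= `|b0 n j ord0| by near: n.
have b0l (j : 'I_(p n)) : (j < s n)%N -> lam n < `|b0 n j ord0| /\ C * lam n + lam n < `|b0 n j ord0|.
  move=> js; have h := hmn j js.
  have h2 : C * lam n <= `|C| * lam n by rewrite ler_wpM2r ?ler_norm // ltW.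
  have h3 : 0 <= `|C| * lam n by rewrite mulr_ge0 // ltW.
  by split; lra.
have bl (j : 'I_(p n)) : `|bhat n w j ord0 - b0 n j ord0| <= lam n.
  apply: le_trans rl; apply: le_trans hen.
  by have := coord_enorm (bhat n w - b0 n) j; rewrite !mxE.
have dd t : 0 < t -> C * lam n < t -> derivable (pen1 (pen (lam n))) t 1.
  by move=> t0 ct; have [] := dpen t t0 ct.
have bz2 (j : 'I_(p n)) : (s n <= j)%N -> bhat n w j ord0 = 0 /\ b0 n j ord0 = 0.
  by move=> sj; rewrite bz // hz.
have st (j : 'I_(p n)) : (j < s n)%N ->
    n%:R * (pen1 (pen (lam n)) `|bhat n w j ord0| * Num.sg (bhat n w j ord0))
    = \sum_l rscore (f n) (b0 n) j (V n l w)
      - n%:R * (fisher (mu n) (f n) (b0 n) *m (bhat n w - b0 n)) j ord0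
      + score_error (f n) (fun i => V n i w) (b0 n) (bhat n w) (fisher (mu n) (f n) (b0 n)) j.
  move=> js; have [h1 h2] := b0l j js; have h3 := bl j.
  have h5 : `|b0 n j ord0| - lam n <= `|bhat n w j ord0|.
    by rewrite lerBlDl -lerBlDr (le_trans _ h3) // distrC lerB_dist.
  have bp : 0 < `|bhat n w j ord0| by lra.
  have cb : C * lam n < `|bhat n w j ord0| by lra.
  have bj : bhat n w j ord0 != 0 by rewrite -normr_gt0.
  have [dj _] := dpen _ bp cb.
  rewrite -(stat j bj dj).
  rewrite /score_error.
  have -> : \sum_l rscore (f n) (b0 n) j (V n l w) = \sum_i score (f n) (b0 n) j (V n i w).
    by apply: eq_bigr => l _; rewrite /rscore regularE.
  by ring.
apply: le_trans (linearization_error (hsp n) dd lip bl b0l bz2 st) _.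
rewrite -[leRHS]mulrA ler_wpM2l // mulrDl lerD //.
have hD : \sum_j (bhat n w - b0 n) j ord0 ^+ 2 <= K ^+ 2 * ((p n)%:R / n%:R).
  by rewrite -enorm_sqr -rate_sqr -exprMn lerXn2r ?nnegrE ?enorm_ge0 // (le_trans (enorm_ge0 _) hen).
have hD2 : (\sum_j (bhat n w - b0 n) j ord0 ^+ 2) ^+ 2 <= (K ^+ 2 * ((p n)%:R / n%:R)) ^+ 2.
  by rewrite lerXn2r ?nnegrE ?(le_trans _ hD) // sumr_ge0 // => j _; rewrite sqr_ge0.
rewrite exprMn; apply: (le_trans (ler_wpM2l (sqr_ge0 _) hD2)).
(* The squared penalty remainder is of order [p_n ^+ 2] only and is absorbed by [p_n ^+ 5]. *)
rewrite [leLHS](_ : _ = (D * K ^+ 2) ^+ 2 * (p n)%:R ^+ 2); last by field; rewrite gt_eqF.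
by rewrite ler_wpM2l ?sqr_ge0 // ler_weXn2l.
Unshelve. all: end_near. Qed.

End Asymptotics.

(** * Asymptotic normality *)

Section LinearCombination.
Context (R : realType) (d : measure_display) (X : measurableType d) (nu : probability X R).
Context (s : nat) (r : 'I_s -> X -> R) (J : 'M[R]_s) (C3 : R).
Hypothesis mr : forall i, measurable_fun [set: X] (r i).
Hypothesis r0 : forall i, nu.-integrable [set: X] (EFin \o r i) /\ \int[nu]_x r i x = 0.
Hypothesis r2 : forall i j,
  nu.-integrable [set: X] (EFin \o (fun x => r i x * r j x)) /\
  \int[nu]_x (r i x * r j x) = J i j.
Hypothesis r4 : forall i j,
  nu.-integrable [set: X] (EFin \o (fun x => r i x ^+ 2 * r j x ^+ 2)) /\
  \int[nu]_x (r i x ^+ 2 * r j x ^+ 2) <= C3.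

Definition lincomb (a : 'cV[R]_s) (x : X) : R := \sum_i a i ord0 * r i x.

Lemma measurable_lincomb_col a : measurable_fun [set: X] (lincomb a).
Proof. exact: measurable_lincomb. Qed.

Lemma lincomb_mean a : \int[nu]_x lincomb a x = 0.
Proof.
rewrite /lincomb Rintegral_sum => [|i]; last by apply: integrable_Rscale; have [] := r0 i.
by rewrite big1 // => i _; have [ir E] := r0 i; rewrite RintegralZl // E mulr0.
Qed.

Lemma lincomb_sqr a : nu.-integrable [set: X] (EFin \o (fun x => lincomb a x ^+ 2)) /\
  \int[nu]_x (lincomb a x ^+ 2) = (a^T *m J *m a) ord0 ord0.
Proof.
have E : (fun x => lincomb a x ^+ 2)
    = (fun x => \sum_i \sum_j a i ord0 * a j ord0 * (r i x * r j x)).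
  apply/funext => x; rewrite expr2 /lincomb mulr_suml; apply: eq_bigr => i _.
  by rewrite mulr_sumr; apply: eq_bigr => j _; rewrite mulrACA.
have ii i j : nu.-integrable [set: X] (EFin \o (fun x => a i ord0 * a j ord0 * (r i x * r j x))).
  by apply: integrable_Rscale; have [] := r2 i j.
rewrite E; split; first by do 2!(apply: integrable_Rsum => ?); exact: ii.
rewrite Rintegral_sum => [|i]; last by apply: integrable_Rsum => j; exact: ii.
rewrite [RHS]mxE; under [RHS]eq_bigr do rewrite mxE mulr_suml.
rewrite [RHS]exchange_big /=; apply: eq_bigr => i _; rewrite Rintegral_sum //.
apply: eq_bigr => j _; have [ij Eij] := r2 i j.
by rewrite RintegralZl // Eij mxE mulrAC.
Qed.

(** Cauchy-Schwarz bounds the fourth power by [|a|^4 (\sum_i r i ^+ 2)^2], whose expansion has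
    [s ^+ 2] terms: the price of a growing dimension. *)
Lemma lincomb_four a : nu.-integrable [set: X] (EFin \o (fun x => lincomb a x ^+ 4)) /\
  \int[nu]_x (lincomb a x ^+ 4) <= ((a^T *m a) ord0 ord0) ^+ 2 * (s%:R ^+ 2 * C3).
Proof.
set A := (a^T *m a) ord0 ord0.
pose F x := A ^+ 2 * \sum_i \sum_j (r i x ^+ 2 * r j x ^+ 2).
have le4 x : 0 <= lincomb a x ^+ 4 <= F x.
  rewrite -[4%N]/(2 * 2)%N exprM sqr_ge0 /=.
  have -> : F x = (A * \sum_i r i x ^+ 2) ^+ 2.
    rewrite exprMn /F; congr (_ * _); rewrite expr2 mulr_suml; apply: eq_bigr => i _.
    by rewrite mulr_sumr.
  have h : lincomb a x ^+ 2 <= A * \sum_i r i x ^+ 2.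
    by rewrite /A sqnormE; exact: cauchy_schwarz_sum.
  by rewrite lerXn2r ?nnegrE ?sqr_ge0 // (le_trans (sqr_ge0 _) h).
have i1 : nu.-integrable [set: X] (EFin \o (fun x => \sum_i \sum_j (r i x ^+ 2 * r j x ^+ 2))).
  by apply: integrable_Rsum => i; apply: integrable_Rsum => j; have [] := r4 i j.
have iF : nu.-integrable [set: X] (EFin \o F) by exact: integrable_Rscale.
have m4 : measurable_fun [set: X] (fun x => lincomb a x ^+ 4).
  by apply: measurable_funX; exact: measurable_lincomb_col.
have i4 : nu.-integrable [set: X] (EFin \o (fun x => lincomb a x ^+ 4)).
  apply: (@integrable_dominated _ _ _ _ _ F 0) => // x.
  by have /andP[h1 h2] := le4 x; rewrite add0r ger0_norm.
split=> //; apply: (@le_trans _ _ (\int[nu]_x F x)).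
  by apply: le_Rintegral => // x _; have /andP[] := le4 x.
rewrite /F RintegralZl // ler_wpM2l ?sqr_ge0 //.
rewrite Rintegral_sum => [|i]; last by apply: integrable_Rsum => j; have [] := r4 i j.
apply: (@le_trans _ _ (\sum_(i < s) \sum_(j < s) C3)); last first.
  by rewrite !sumr_const !card_ord -[leLHS]mulr_natl -[C3 *+ s]mulr_natl mulrA expr2.
apply: ler_sum => i _; rewrite Rintegral_sum => [|j]; last by have [] := r4 i j.
by apply: ler_sum => j _; have [] := r4 i j.
Qed.

End LinearCombination.

Lemma sin_lipschitz (R : realType) (x y : R) : `|sin x - sin y| <= `|x - y|.
Proof.
pose m := (x + y) / 2; pose h := (x - y) / 2.
have -> : sin x - sin y = 2 * (cos m * sin h).
  have {1}-> : x = m + h by rewrite /m /h; field.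
  have {1}-> : y = m - h by rewrite /m /h; field.
  by rewrite sinD sinB; ring.
have -> : `|x - y| = 2 * `|h| by rewrite /h normrM normfV [`|2|]ger0_norm //; field.
rewrite normrM ger0_norm // ler_wpM2l // normrM -[leRHS]mul1r.
by rewrite ler_pM // ?normr_sin_le // ler_norml cos_geN1 cos_le1.
Qed.

(** * Transfer between sequences that are close in probability *)

Section Slutsky.
Context (R : realType) (dT : nat -> measure_display) (T : forall n, measurableType (dT n)).
Context (P : forall n, probability (T n) R).
Unset Implicit Arguments.
Context (Y Z : forall n, T n -> R).
Set Implicit Arguments.
Hypothesis mY : \forall n \near \oo, measurable_fun [set: T n] (Y n).
Hypothesis mZ : \forall n \near \oo, measurable_fun [set: T n] (Z n).
Hypothesis close : forall e : R, 0 < e -> \forall n \near \oo, exists B : set (T n),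
  [/\ measurable B, (P n B <= e%:E)%E & forall w, ~ B w -> `|Z n w - Y n w| <= e].

(** The sine is bounded and 1-Lipschitz, so a change by [e] outside an event of probability [e]
    moves the mean by a multiple of [e]. *)
Lemma slutsky_sin (b l : R) : (fun n => \int[P n]_w sin (Y n w + b)) @ \oo --> l ->
  (fun n => \int[P n]_w sin (Z n w + b)) @ \oo --> l.
Proof.
move=> Yl; apply/cvgrPdist_le => e e0; pose e4 := e / 4; have e40 : 0 < e4 by rewrite divr_gt0.
move/cvgrPdist_le : Yl => /(_ e4 e40) Yl; have cl := close e40.
near=> n.
have mYn : measurable_fun [set: T n] (Y n) by near: n.
have mZn : measurable_fun [set: T n] (Z n) by near: n.
have [B [mB PB BP]] : exists B : set (T n),
  [/\ measurable B, (P n B <= e4%:E)%E & forall w, ~ B w -> `|Z n w - Y n w| <= e4] by near: n.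
have msin (U : T n -> R) : measurable_fun [set: T n] U -> measurable_fun [set: T n] (fun w => sin (U w + b)).
  exact: measurable_sinD.
have isin (U : T n -> R) : measurable_fun [set: T n] U ->
    (P n).-integrable [set: T n] (EFin \o (fun w => sin (U w + b))).
  move=> mU; apply: (@bounded_prob_integrable _ _ _ _ _ 1); first exact: msin.
  by move=> w; rewrite ler_norml sin_geN1 sin_le1.
have h1 : `|l - \int[P n]_w sin (Y n w + b)| <= e4 by near: n.
have h2 : `|\int[P n]_w (sin (Z n w + b) - sin (Y n w + b))| <= e4 + 2 * fine (P n B).
  apply: le_bound_Rintegral => //; first by apply: measurable_funB; exact: msin.
  move=> w; rewrite indicE; have [wB|wB] := boolP (w \in B).
    rewrite mulr1; apply: (@le_trans _ _ 2); last by rewrite lerDr ltW.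
    rewrite ler_norml; have := sin_geN1 (Z n w + b); have := sin_le1 (Z n w + b).
    have := sin_geN1 (Y n w + b); have := sin_le1 (Y n w + b); lra.
  rewrite mulr0 addr0; apply: le_trans (sin_lipschitz _ _) _.
  rewrite opprD addrACA subrr addr0; apply: BP => wB'; by rewrite mem_set in wB.
have h3 : fine (P n B) <= e4.
  by rewrite -lee_fin fineK // fin_num_measure.
have h4 : \int[P n]_w (sin (Z n w + b) - sin (Y n w + b))
    = \int[P n]_w sin (Z n w + b) - \int[P n]_w sin (Y n w + b).
  by rewrite RintegralB //; exact: isin.
rewrite h4 in h2; have -> : e = e4 + e4 + 2 * e4 by rewrite /e4; field.
move: h1 h2; rewrite !ler_norml => /andP[? ?] /andP[? ?]; apply/andP; split; lra.
Unshelve. all: end_near. Qed.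

Lemma slutsky_tight (c : R) :
  (\forall n \near \oo, (P n).-integrable [set: T n] (EFin \o (fun w => Y n w ^+ 2)) /\
     \int[P n]_w (Y n w ^+ 2) <= c) ->
  forall e : R, 0 < e -> exists L : R, \forall n \near \oo,
    (P n [set w | (L < `|Z n w|)%R] <= e%:E)%E.
Proof.
(* Capped at 1 so that [|Z| > K + 1] forces [|Y| > K] outside the exceptional event. *)
move=> hY e e0; pose e2 := Num.min (e / 2) 1.
have e20 : 0 < e2 by rewrite lt_min divr_gt0 //=.
have e2e : e2 <= e / 2 by rewrite ge_min lexx.
have e21 : e2 <= 1 by rewrite ge_min lexx orbT.
have cl := close e20.
(* Gives [c <= e2 * K <= e2 * K ^+ 2], as Markov's inequality for [Y ^+ 2] requires. *)
pose K := 1 + `|c| / e2; have K1 : 1 <= K by rewrite lerDl divr_ge0 // ltW.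
exists (K + 1); near=> n.
have mYn : measurable_fun [set: T n] (Y n) by near: n.
have mZn : measurable_fun [set: T n] (Z n) by near: n.
have [iY Yc] : (P n).-integrable [set: T n] (EFin \o (fun w => Y n w ^+ 2)) /\
     \int[P n]_w (Y n w ^+ 2) <= c by near: n.
have [B [mB PB BP]] : exists B : set (T n),
  [/\ measurable B, (P n B <= e2%:E)%E & forall w, ~ B w -> `|Z n w - Y n w| <= e2] by near: n.
have K0 : 0 < K by lra.
have PY : (P n [set w | (K ^+ 2 < Y n w ^+ 2)%R] <= e2%:E)%E.
  apply: markov_le => //; [by move=> w; exact: sqr_ge0|by rewrite exprn_gt0|].
  apply: (le_trans Yc); rewrite -ler_pdivrMl // mulrC; apply: (@le_trans _ _ K).
    by apply: (@le_trans _ _ (`|c| / e2)); [rewrite ler_pM2r ?invr_gt0 // ler_norm|rewrite lerDr].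
  by rewrite expr2 ler_pMr.
have mA : measurable [set w | K ^+ 2 < Y n w ^+ 2].
  have -> : [set w | K ^+ 2 < Y n w ^+ 2] = [set w | K ^+ 2 < `|Y n w ^+ 2|].
    by apply/seteqP; split=> w /=; rewrite ger0_norm ?sqr_ge0.
  by apply: measurable_abs_gt; exact: measurable_funX.
apply: (@le_trans _ _ (P n (B `|` [set w | K ^+ 2 < Y n w ^+ 2]))).
  apply: le_measure; rewrite ?inE; [exact: measurable_abs_gt|exact: measurableU|].
  move=> w /= Lw; have [wB|wB] := pselect (B w); first by left.
  right => /=; rewrite -[ltRHS]real_normK ?num_real //.
  have KY : K < `|Y n w|.
    have := BP w wB; have := ler_normD (Z n w - Y n w) (Y n w); rewrite subrK; lra.
  by rewrite ltr_sqr ?nnegrE // ltW.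
apply: (@le_trans _ _ (e2%:E + e2%:E)%E); last by rewrite -EFinD lee_fin; lra.
by apply: le_trans (measureU2 _ _ _) _ => //; apply: leeD.
Unshelve. all: end_near. Qed.

End Slutsky.

(** * Limit law of linear forms of the scores and of their linearization *)

Section ScoreCLT.
Unset Implicit Arguments.
Context (R : realType) (s p : nat -> nat) (hsp : forall n, (s n <= p n)%N).
Context (dX : nat -> measure_display) (X : forall n, measurableType (dX n)).
Context (mu : forall n, {measure set (X n) -> \bar R}).
Context (f : forall n, X n -> 'cV[R]_(p n) -> R) (b0 : forall n, 'cV[R]_(p n)).
Context (dT : nat -> measure_display) (T : forall n, measurableType (dT n)).
Context (P : forall n, probability (T n) R) (V : forall n, 'I_n -> {RV (P n) >-> X n}).
Context (D : forall n, T n -> 'cV[R]_(s n)) (C1 C3 : R).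
Set Implicit Arguments.
Hypothesis hs0 : forall n, (0 < s n)%N.
Hypothesis mf : forall n, (0 < n)%N -> measurable_fun [set: X n] (f n ^~ (b0 n)).
Hypothesis f0 : forall n, (0 < n)%N -> forall x, 0 <= f n x (b0 n).
Hypothesis hindep : forall n, (0 < n)%N -> mutually_independent (V n).
Hypothesis hlaw : forall n, (0 < n)%N -> forall i : 'I_n,
  has_density (mu n) (V n i) ((f n) ^~ (b0 n)).
Hypothesis hscore : forall n, (0 < n)%N -> score_identities (mu n) (f n) (b0 n).
Hypothesis hC3 : forall n, (0 < n)%N -> forall j k : 'I_(p n),
  (expect (mu n) (f n) (b0 n) (fun x =>
     ((score (f n) (b0 n) j x * score (f n) (b0 n) k x) ^+ 2)%R) < C3%:E)%E.
Let I1 n := upper_left (hsp n) (fisher (mu n) (f n) (b0 n)).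
Hypothesis C10 : 0 < C1.
Hypothesis hC1 : forall n, (0 < n)%N -> forall u : 'cV[R]_(s n),
  C1 * (u^T *m u) ord0 ord0 <= (u^T *m I1 n *m u) ord0 ord0.
Hypothesis hdim : (fun n => (p n)%:R ^+ 5 / n%:R : R) @ \oo --> (0 : R).
Hypothesis mD : forall n, (0 < n)%N -> forall i, measurable_fun [set: T n] (fun w => D n w i ord0).
Hypothesis hD : forall e : R, 0 < e -> exists2 K : R, 0 <= K &
  \forall n \near \oo, exists B : set (T n),
  [/\ measurable B, (P n B <= e%:E)%E & forall w, ~ B w ->
    \sum_i (n%:R * D n w i ord0
      - \sum_l rscore (f n) (b0 n) (widen_ord (hsp n) i) (V n l w)) ^+ 2
    <= K * (p n)%:R ^+ 5].

Let r n (i : 'I_(s n)) := rscore (f n) (b0 n) (widen_ord (hsp n) i).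
Arguments r : clear implicits.

(** [iid_cf_bound] with [th] equal to [p n]: the lower eigenvalue bound gives [|a|^2 <= v / C1], so
    the fourth moment is of order [p_n^2] and the error is of order [p_n / sqrt n] and its
    square. *)
Lemma rscore_lincomb_bound n (a : 'cV[R]_(s n)) (b v rho : R) : (0 < n)%N ->
  v = (a^T *m I1 n *m a) ord0 ord0 -> rho = (p n)%:R / Num.sqrt n%:R ->
  `|\int[P n]_w sin ((Num.sqrt n%:R)^-1 * (\sum_l lincomb (r n) a (V n l w)) + b)
    - sin b * expR (- (v / 2))|
  <= 2 * ((v / C1) ^+ 2 * C3 + v ^+ 2) * rho ^+ 2 + 2 * (v + (v / C1) ^+ 2 * C3) * rho.
Proof.
move=> n0 vE rhoE; have N0 : 0 < n%:R :> R by rewrite ltr0n.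
have pp : (0 < p n)%N by exact: leq_trans (hs0 n) (hsp n).
have p0 : 0 < (p n)%:R :> R by rewrite ltr0n.
have p1 : 1 <= (p n)%:R :> R by rewrite ler1n.
have sq0 : 0 < Num.sqrt n%:R :> R by rewrite sqrtr_gt0.
have mr i : measurable_fun [set: X n] (r n i) by apply: measurable_rscore; [exact: mf|exact: f0|exact: hscore].
have r2 i j := rscore_cov n0 (mf n0) (f0 n0) (hlaw n0) (hscore n0) (widen_ord (hsp n) i) (widen_ord (hsp n) j).
have r1 i := rscore_mean n0 (mf n0) (f0 n0) (hlaw n0) (hscore n0) (widen_ord (hsp n) i).
have r4 i j := rscore_sqr n0 (mf n0) (f0 n0) (hlaw n0) (hscore n0) (hC3 n0) (widen_ord (hsp n) i) (widen_ord (hsp n) j).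
set nu := distribution _ _ in r1 r2 r4.
have r2' i j : nu.-integrable [set: X n] (EFin \o (fun x => r n i x * r n j x)) /\
    \int[nu]_x (r n i x * r n j x) = I1 n i j.
  by have [h1 h2] := r2 i j; split=> //; rewrite h2 !mxE.
have C30 : 0 <= C3.
  have [_ h] := r4 (Ordinal (hs0 n)) (Ordinal (hs0 n)).
  by apply: le_trans h; apply: Rintegral_ge0 => x _; rewrite mulr_ge0 ?sqr_ge0.
have [_ E2] := lincomb_sqr r2' a.
have [i4 E4] := lincomb_four mr r4 a.
have E1 := lincomb_mean r1 a.
have ml := measurable_lincomb_col mr a.
have B := iid_cf_bound (hindep n0) (sample_law n0 (hlaw n0)) n0 b ml i4 E1 p0 E2 (erefl _).
rewrite -vE in B; apply: (le_trans B).
set m4 := \int[_]__ _ in E4 *; set A := (a^T *m a) ord0 ord0 in E4.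
have A0 : 0 <= A by exact: sqnorm_ge0.
have Av : A <= v / C1 by rewrite ler_pdivlMr // mulrC vE; exact: hC1.
have m40 : m4 <= (v / C1) ^+ 2 * C3 * (p n)%:R ^+ 2.
  apply: le_trans E4 _; rewrite -mulrA [C3 * _]mulrC.
  have sp2 : (s n)%:R ^+ 2 <= (p n)%:R ^+ 2 :> R by rewrite lerXn2r ?nnegrE // ler_nat.
  rewrite ler_pM ?sqr_ge0 ?mulr_ge0 ?sqr_ge0 //.
    by rewrite lerXn2r ?nnegrE // (le_trans A0).
  by rewrite ler_wpM2r.
have rho2 : rho ^+ 2 = (p n)%:R ^+ 2 / n%:R.
  by rewrite rhoE expr_div_n sqr_sqrtr // ltW.
set k := (v / C1) ^+ 2 * C3 in m40 *.
have h1 : (m4 + v ^+ 2) / n%:R <= (k + v ^+ 2) * rho ^+ 2.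
  rewrite rho2 mulrA ler_wpM2r ?invr_ge0 ?ler0n // mulrDl lerD //.
  by rewrite ler_peMr ?sqr_ge0 // exprn_ege1.
have h2 : ((p n)%:R * v + m4 / (p n)%:R) / Num.sqrt n%:R <= (v + k) * rho.
  rewrite rhoE mulrA ler_wpM2r ?invr_ge0 ?sqrtr_ge0 // mulrDl lerD //; first by rewrite mulrC.
  by rewrite ler_pdivrMr // -mulrA -expr2.
rewrite -!mulrA -mulrDr ler_wpM2l // lerD //.
Qed.

Lemma dim_rate_near (e : R) : 0 < e -> \forall n \near \oo, (p n)%:R / Num.sqrt n%:R <= e.
Proof.
move=> e0; have h : \forall n \near \oo, ((p n)%:R ^+ 5 / n%:R : R) < e ^+ 2.
  by apply: (cvgr_lt _ hdim); rewrite exprn_gt0.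
near=> n; have n0 : (0 < n)%N by near: n; exact: nbhs_infty_gt.
have hn : ((p n)%:R ^+ 5 / n%:R : R) < e ^+ 2 by near: n.
have N0 : 0 < n%:R :> R by rewrite ltr0n.
have p1 : 1 <= (p n)%:R :> R by rewrite ler1n (leq_trans (hs0 n)).
rewrite -ler_sqr ?nnegrE ?divr_ge0 ?sqrtr_ge0 ?ler0n ?(ltW e0) // expr_div_n sqr_sqrtr ?ler0n //.
by apply: le_trans (ltW hn); rewrite ler_wpM2r ?invr_ge0 ?ler0n // ler_weXn2l.
Unshelve. all: end_near. Qed.

Section Scalar.
Unset Implicit Arguments.
Context (a : forall n, 'cV[R]_(s n)) (v : R).
Set Implicit Arguments.
Hypothesis av : (fun n => ((a n)^T *m I1 n *m a n) ord0 ord0) @ \oo --> v.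

Let S n (w : T n) := (Num.sqrt n%:R)^-1 * \sum_l lincomb (r n) (a n) (V n l w).
Let Z n (w : T n) := Num.sqrt n%:R * ((a n)^T *m D n w) ord0 ord0.
Let vn n := ((a n)^T *m I1 n *m a n) ord0 ord0.

Let mr n i : (0 < n)%N -> measurable_fun [set: X n] (r n i).
Proof. by move=> n0; apply: measurable_rscore; [exact: mf|exact: f0|exact: hscore]. Qed.

Let mS : \forall n \near \oo, measurable_fun [set: T n] (@S n).
Proof.
near=> n; have n0 : (0 < n)%N by near: n; exact: nbhs_infty_gt.
apply: measurable_funM => //; apply: measurable_sum => l.
apply: (measurableT_comp (f := lincomb (r n) (a n))) => //.
by apply: measurable_lincomb_col => i; exact: mr.
Unshelve. all: end_near. Qed.

Let mZ : \forall n \near \oo, measurable_fun [set: T n] (@Z n).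
Proof.
near=> n; have n0 : (0 < n)%N by near: n; exact: nbhs_infty_gt.
apply: measurable_funM => //.
rewrite (_ : (fun w => _) = (fun w => \sum_i a n i ord0 * D n w i ord0)).
  by apply: measurable_lincomb => i; exact: mD.
by apply/funext => w; rewrite mxE; apply: eq_bigr => i _; rewrite mxE.
Unshelve. all: end_near. Qed.

Let vn_near : \forall n \near \oo, (0 < n)%N /\ 0 <= vn n <= `|v| + 1.
Proof.
have h : \forall n \near \oo, vn n < `|v| + 1.
  by apply: (cvgr_lt _ av); rewrite (le_lt_trans (ler_norm v)) // ltrDl.
near=> n; have n0 : (0 < n)%N by near: n; exact: nbhs_infty_gt.
split=> //; apply/andP; split; last by apply: ltW; near: n.
by apply: le_trans (hC1 n0 (a n)); rewrite mulr_ge0 ?sqnorm_ge0 // ltW.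
Unshelve. all: end_near. Qed.

Let cfS b : (fun n => \int[P n]_w sin (S w + b)) @ \oo --> sin b * expR (- (v / 2)).
Proof.
have cv : (fun n => sin b * expR (- (vn n / 2))) @ \oo --> sin b * expR (- (v / 2)).
  apply: cvgMr; apply: continuous_cvg; first exact: continuous_expR.
  by apply: cvgN; apply: cvgMl.
apply/cvgrPdist_le => e e0; have e20 : 0 < e / 2 by rewrite divr_gt0.
move/cvgrPdist_le : cv => /(_ _ e20) cv.
pose w := `|v| + 1; have w0 : 0 <= w by rewrite addr_ge0.
pose c1 := 2 * ((w / C1) ^+ 2 * `|C3| + w ^+ 2); pose c2 := 2 * (w + (w / C1) ^+ 2 * `|C3|).
have c10 : 0 <= c1 by rewrite mulr_ge0 // addr_ge0 ?sqr_ge0 // mulr_ge0 ?sqr_ge0.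
have c20 : 0 <= c2 by rewrite mulr_ge0 // addr_ge0 // mulr_ge0 ?sqr_ge0.
(* Ensures [c1 * q ^+ 2 + c2 * q <= e / 2] for [0 <= q <= eta]. *)
pose eta := Num.min 1 (e / 2 / (c1 + c2 + 1)).
have cc : 0 < c1 + c2 + 1 by lra.
have eta0 : 0 < eta by rewrite lt_min ltr01 divr_gt0.
have dr := dim_rate_near eta0.
near=> n.
have [n0 /andP[v0 vw]] : (0 < n)%N /\ 0 <= vn n <= w by near: n.
have rho : (p n)%:R / Num.sqrt n%:R <= eta by near: n.
have cvn : `|sin b * expR (- (v / 2)) - sin b * expR (- (vn n / 2))| <= e / 2 by near: n.
set q := (p n)%:R / _ in rho.
have q0 : 0 <= q by rewrite divr_ge0 // sqrtr_ge0.
have B := rscore_lincomb_bound b n0 (erefl (vn n)) (erefl q).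
have {}B : `|\int[P n]_w sin (S w + b) - sin b * expR (- (vn n / 2))| <= e / 2.
  apply: (le_trans B).
  have hv : (vn n / C1) ^+ 2 * C3 <= (w / C1) ^+ 2 * `|C3|.
    apply: (@le_trans _ _ ((vn n / C1) ^+ 2 * `|C3|)); first by rewrite ler_wpM2l ?sqr_ge0 ?ler_norm.
    rewrite ler_wpM2r // lerXn2r ?nnegrE ?divr_ge0 ?(ltW C10) //.
    by rewrite ler_wpM2r // invr_ge0 ltW.
  have hv2 : vn n ^+ 2 <= w ^+ 2 by rewrite lerXn2r ?nnegrE.
  have q1 : q <= 1 by apply: le_trans rho _; rewrite ge_min lexx.
  have qe : q * (c1 + c2 + 1) <= e / 2.
    by rewrite -ler_pdivlMr //; apply: le_trans rho _; rewrite ge_min lexx orbT.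
  have qq : q ^+ 2 <= q by rewrite expr2 ler_piMl.
  apply: (@le_trans _ _ (c1 * q + c2 * q)); last by lra.
  apply: lerD.
    apply: (@le_trans _ _ (c1 * q ^+ 2)); last by rewrite ler_wpM2l.
    by rewrite ler_wpM2r ?sqr_ge0 // ler_wpM2l // lerD.
  by rewrite ler_wpM2r // ler_wpM2l // lerD.
move: cvn B; rewrite !ler_norml => /andP[? ?] /andP[? ?].
by apply/andP; split; lra.
Unshelve. all: end_near. Qed.

Let secondS : \forall n \near \oo,
  (P n).-integrable [set: T n] (EFin \o (fun w => S w ^+ 2)) /\
  \int[P n]_w (S w ^+ 2) <= `|v| + 1.
Proof.
near=> n; have [n0 /andP[v0 vw]] : (0 < n)%N /\ 0 <= vn n <= `|v| + 1 by near: n.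
have N0 : 0 < n%:R :> R by rewrite ltr0n.
have r2 i j := rscore_cov n0 (mf n0) (f0 n0) (hlaw n0) (hscore n0) (widen_ord (hsp n) i) (widen_ord (hsp n) j).
have r1 i := rscore_mean n0 (mf n0) (f0 n0) (hlaw n0) (hscore n0) (widen_ord (hsp n) i).
set nu := distribution _ _ in r1 r2.
have r2' i j : nu.-integrable [set: X n] (EFin \o (fun x => r n i x * r n j x)) /\
    \int[nu]_x (r n i x * r n j x) = I1 n i j.
  by have [h1 h2] := r2 i j; split=> //; rewrite h2 !mxE.
have [i2 E2] := lincomb_sqr r2' (a n).
have ml : measurable_fun [set: X n] (lincomb (r n) (a n)).
  by apply: measurable_lincomb_col => i; exact: mr.
have [iS ES] := iid_sum_sqr (hindep n0) (sample_law n0 (hlaw n0)) ml i2 (lincomb_mean r1 (a n)).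
have E : (fun w => S w ^+ 2) = (fun w => n%:R^-1 * (\sum_l lincomb (r n) (a n) (V n l w)) ^+ 2).
  by apply/funext => w; rewrite /S exprMn exprVn sqr_sqrtr // ltW.
rewrite E; split; first exact: integrable_Rscale.
by rewrite RintegralZl // ES E2 mulrA mulVf ?mul1r // gt_eqF.
Unshelve. all: end_near. Qed.

(** The difference is [n^(-1/2)] times the pairing of [a n] with the linearization error;
    Cauchy-Schwarz and the lower eigenvalue bound make its square at most a multiple of
    [p_n^5 / n]. *)
Let closeZ (e : R) : 0 < e -> \forall n \near \oo, exists B : set (T n),
  [/\ measurable B, (P n B <= e%:E)%E & forall w, ~ B w -> `|Z w - S w| <= e].
Proof.
move=> e0; have [K K0 KB] := hD e0.
pose k := (`|v| + 1) / C1 * K + 1.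
have k0 : 0 < k by rewrite ltr_wpDl // mulr_ge0 // divr_ge0 ?addr_ge0 // ltW.
have h : \forall n \near \oo, ((p n)%:R ^+ 5 / n%:R : R) < e ^+ 2 / k.
  by apply: (cvgr_lt _ hdim); rewrite divr_gt0 // exprn_gt0.
near=> n; have [n0 /andP[v0 vw]] : (0 < n)%N /\ 0 <= vn n <= `|v| + 1 by near: n.
have N0 : 0 < n%:R :> R by rewrite ltr0n.
have hn : ((p n)%:R ^+ 5 / n%:R : R) < e ^+ 2 / k by near: n.
have [B [mB PB BP]] : exists B : set (T n),
  [/\ measurable B, (P n B <= e%:E)%E & forall w, ~ B w ->
    \sum_i (n%:R * D n w i ord0 - \sum_l r n i (V n l w)) ^+ 2 <= K * (p n)%:R ^+ 5] by near: n.
exists B; split=> // w /BP hz.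
set z := fun i => n%:R * D n w i ord0 - \sum_l r n i (V n l w).
have E : Z w - S w = (Num.sqrt n%:R)^-1 * \sum_i a n i ord0 * z i.
  have sq0 : Num.sqrt n%:R != 0 :> R by rewrite gt_eqF // sqrtr_gt0.
  have -> : Z w = (Num.sqrt n%:R)^-1 * (n%:R * ((a n)^T *m D n w) ord0 ord0).
    by rewrite /Z [RHS]mulrA; congr (_ * _); rewrite -[X in _ * X]sqr_sqrtr ?ler0n // expr2 mulKf.
  rewrite /S -mulrBr; congr (_ * _).
  rewrite mxE mulr_sumr exchange_big /= -sumrB; apply: eq_bigr => i _.
  by rewrite /z mxE -mulr_sumr; ring.
have A0 := sqnorm_ge0 (a n).
have Av : ((a n)^T *m a n) ord0 ord0 <= (`|v| + 1) / C1.
  by rewrite ler_pdivlMr // mulrC; apply: le_trans (hC1 n0 (a n)) vw.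
rewrite -ler_sqr ?nnegrE ?(ltW e0) // real_normK ?num_real // E exprMn exprVn sqr_sqrtr ?ler0n //.
have cs := cauchy_schwarz_sum (fun i => a n i ord0) z; rewrite -sqnormE in cs.
have hz' : (\sum_i a n i ord0 * z i) ^+ 2 <= (`|v| + 1) / C1 * (K * (p n)%:R ^+ 5).
  apply: le_trans cs _; apply: ler_pM => //.
  by apply: sumr_ge0 => i _; exact: sqr_ge0.
apply: (@le_trans _ _ (n%:R^-1 * ((`|v| + 1) / C1 * (K * (p n)%:R ^+ 5)))).
  by rewrite ler_wpM2l ?invr_ge0 ?ler0n.
rewrite [leLHS](_ : _ = (k - 1) * ((p n)%:R ^+ 5 / n%:R)); last by rewrite /k; ring.
apply: (@le_trans _ _ (k * ((p n)%:R ^+ 5 / n%:R))).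
  by rewrite ler_wpM2r ?divr_ge0 ?exprn_ge0 ?ler0n //; lra.
by rewrite -ler_pdivlMl // [leRHS]mulrC ltW.
Unshelve. all: end_near. Qed.

Lemma scalar_clt (b : R) :
  (fun n => \int[P n]_w sin (Num.sqrt n%:R * ((a n)^T *m D n w) ord0 ord0 + b)) @ \oo
  --> sin b * expR (- (v / 2)).
Proof. exact: (slutsky_sin mS mZ closeZ (cfS (b := b))). Qed.

Lemma scalar_tight (e : R) : 0 < e -> exists L : R, \forall n \near \oo,
  (P n [set w | (L < `|Num.sqrt n%:R * ((a n)^T *m D n w) ord0 ord0|)%R] <= e%:E)%E.
Proof. exact: (slutsky_tight mS mZ closeZ secondS). Qed.

End Scalar.

End ScoreCLT.

Lemma posdef_unit (R : realType) m (A : 'M[R]_m) (c : R) : 0 < c ->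
  (forall u : 'cV[R]_m, c * (u^T *m u) ord0 ord0 <= (u^T *m A *m u) ord0 ord0) -> A \in unitmx.
Proof.
move=> c0 hA; rewrite -row_free_unit -kermx_eq0; apply/rowV0P => v /sub_kermxP vA.
apply/eqP; apply: contraT => v0; have := hA v^T; rewrite trmxK vA mul0mx [leRHS]mxE leNgt.
have := @sqnorm_gt0 R m v^T; rewrite trmx_eq0 trmxK => /(_ v0) vv.
by rewrite mulr_gt0.
Qed.

Lemma singular_kernel (R : realType) m (A : 'M[R]_m) : A \notin unitmx ->
  exists2 u : 'cV[R]_m, u != 0 & u^T *m A = 0.
Proof.
rewrite -row_free_unit -kermx_eq0 => /rowV0Pn[v /sub_kermxP vA v0].
by exists v^T; rewrite ?trmxK // trmx_eq0.
Qed.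

Lemma quad_expand (R : realType) m (A : 'M[R]_m) (c : 'cV[R]_m) :
  (c^T *m A *m c) ord0 ord0 = \sum_i \sum_j c i ord0 * c j ord0 * A i j.
Proof.
rewrite mxE; under eq_bigr do rewrite mxE mulr_suml.
rewrite exchange_big /=; apply: eq_bigr => i _; apply: eq_bigr => j _.
by rewrite mxE mulrAC.
Qed.

Lemma cvg_quad (R : realType) q (A : nat -> 'M[R]_q) (G : 'M[R]_q) (c : 'cV[R]_q) :
  A @ \oo --> G ->
  (fun n => (c^T *m A n *m c) ord0 ord0) @ \oo --> (c^T *m G *m c) ord0 ord0.
Proof.
move=> AG; rewrite quad_expand; under eq_fun do rewrite quad_expand.
have cvs (I : finType) (F : I -> nat -> R) (l : I -> R) :
    (forall i, F i @ \oo --> l i) -> (fun n => \sum_i F i n) @ \oo --> \sum_i l i.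
  by move=> Fl; apply: cvg_big => // -[x y]; exact: add_continuous.
have AGij i j : (fun n => A n i j) @ \oo --> G i j.
  exact: (cvg_comp _ _ AG (@coord_continuous _ _ _ i j G)).
by apply: (cvs _ (fun i n => \sum_j c i ord0 * c j ord0 * A n i j)) => i;
   apply: (cvs _ (fun j n => c i ord0 * c j ord0 * A n i j)) => j; apply: cvgMr.
Qed.

(** The symmetric root moves onto the coefficients: a linear form of [G^(1/2) Z] is one of [Z] with
    coefficients [G^(1/2) c], of squared norm [c^T G c]. *)
Lemma gauss_cf (R : realType) q (G : 'M[R]_q) (c : 'I_q -> R) (b : R) : G^T = G -> psd G ->
  \int[std_gauss q]_z sin (\sum_i c i * (mxsqrt G *m (\col_i tnth z i)) i ord0 + b)
  = sin b * expR (- (((\col_i c i)^T *m G *m (\col_i c i)) ord0 ord0 / 2)).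
Proof.
move=> sG pG; have [sg _ gg] := mxsqrtP sG pG.
pose c' k := (mxsqrt G *m (\col_i c i)) k ord0.
have E z : \sum_i c i * (mxsqrt G *m (\col_i tnth z i)) i ord0 = \sum_k c' k * tnth z k.
  under eq_bigr do rewrite mxE mulr_sumr.
  rewrite exchange_big /=; apply: eq_bigr => k _; rewrite [c' k]mxE mulr_suml.
  apply: eq_bigr => i _; rewrite !mxE -{1}sg mxE; ring.
under eq_Rintegral do rewrite E.
rewrite /Rintegral integral_sin_std_gauss /=; congr (_ * expR _).
rewrite mulNr; congr (- (_ / _)); rewrite -sqnormE trmx_mul sg.
by rewrite mulmxA -[_ *m mxsqrt G *m mxsqrt G]mulmxA gg.
Qed.

(** * From linear forms to vectors *)

Section CramerWold.
Unset Implicit Arguments.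
Context (R : realType) (s : nat -> nat) (I1 : forall n, 'M[R]_(s n)).
Context (dT : nat -> measure_display) (T : forall n, measurableType (dT n)).
Context (P : forall n, probability (T n) R).
Context (D : forall n, T n -> 'cV[R]_(s n)) (C1 : R).
Set Implicit Arguments.
Hypothesis hs0 : forall n, (0 < s n)%N.
Hypothesis symI : forall n, (I1 n)^T = I1 n.
Hypothesis C10 : 0 < C1.
Hypothesis hC1 : forall n, (0 < n)%N -> forall u : 'cV[R]_(s n),
  C1 * (u^T *m u) ord0 ord0 <= (u^T *m I1 n *m u) ord0 ord0.
Hypothesis mD : forall n, (0 < n)%N -> forall i, measurable_fun [set: T n] (fun w => D n w i ord0).
Hypothesis clt : forall (a : forall n, 'cV[R]_(s n)) (v : R),
  (fun n => ((a n)^T *m I1 n *m a n) ord0 ord0) @ \oo --> v -> forall b : R,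
  (fun n => \int[P n]_w sin (Num.sqrt n%:R * ((a n)^T *m D n w) ord0 ord0 + b)) @ \oo
  --> sin b * expR (- (v / 2)).
Hypothesis tight : forall (a : forall n, 'cV[R]_(s n)) (v : R),
  (fun n => ((a n)^T *m I1 n *m a n) ord0 ord0) @ \oo --> v ->
  forall e : R, 0 < e -> exists L : R, \forall n \near \oo,
  (P n [set w | (L < `|Num.sqrt n%:R * ((a n)^T *m D n w) ord0 ord0|)%R] <= e%:E)%E.

Lemma sqrt_unit n : (0 < n)%N -> [/\ (mxsqrt (I1 n))^T = mxsqrt (I1 n),
  mxsqrt (I1 n) *m mxsqrt (I1 n) = I1 n & mxsqrt (I1 n) \in unitmx].
Proof.
move=> n0; have [sB _ BB] : [/\ (mxsqrt (I1 n))^T = mxsqrt (I1 n), psd (mxsqrt (I1 n)) &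
    mxsqrt (I1 n) *m mxsqrt (I1 n) = I1 n].
  apply: mxsqrtP => // u; apply: le_trans (hC1 n0 u).
  by rewrite mulr_ge0 ?sqnorm_ge0 // ltW.
split=> //; have := posdef_unit C10 (hC1 n0).
by rewrite -[X in X \in _]BB unitmx_mul => /andP[].
Qed.

Section Multivariate.
Unset Implicit Arguments.
Context (q : nat) (A : forall n, 'M[R]_(q, s n)) (G : 'M[R]_q).
Set Implicit Arguments.
Hypothesis sG : G^T = G.
Hypothesis pG : psd G.
Hypothesis AG : (fun n => A n *m (A n)^T) @ \oo --> G.

(** The direction in which the linear form of [D n] is the [c]-combination of the normalized vector;
    its quadratic form in [I1 n] is [c^T A A^T c], whose limit is given by [G]. *)
Let dir (c : 'cV[R]_q) n : 'cV[R]_(s n) := invmx (mxsqrt (I1 n)) *m (A n)^T *m c.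

Let dir_cvg c : (fun n => ((dir c n)^T *m I1 n *m dir c n) ord0 ord0) @ \oo
  --> (c^T *m G *m c) ord0 ord0.
Proof.
have h := cvg_quad (c := c) AG.
apply: (cvg_trans _ h); apply: near_eq_cvg; near=> n.
have n0 : (0 < n)%N by near: n; exact: nbhs_infty_gt.
have [sB BB Bu] := sqrt_unit n0; rewrite /dir; set B := mxsqrt (I1 n) in sB BB Bu *.
rewrite -BB !trmx_mul trmx_inv sB trmxK.
rewrite -!mulmxA [invmx B *m (B *m _)]mulmxA mulVmx // mul1mx.
by rewrite [B *m (invmx B *m _)]mulmxA mulmxV // mul1mx.
Unshelve. all: end_near. Qed.

Let dir_mul c n (x : 'cV[R]_(s n)) : (0 < n)%N -> ((dir c n)^T *m x) ord0 ord0
  = \sum_i c i ord0 * (A n *m invmx (mxsqrt (I1 n)) *m x) i ord0.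
Proof.
move=> n0; have [sB BB Bu] := sqrt_unit n0.
rewrite /dir !trmx_mul trmx_inv sB trmxK -!mulmxA mxE.
by apply: eq_bigr => i _; rewrite mxE.
Qed.

(** General directions give the characteristic functions, and those of the basis vectors give the
    tightness of each coordinate. *)
Lemma gauss_clt : cvg_to_gauss P (fun n w =>
  Num.sqrt n%:R *: (A n *m invmx (mxsqrt (I1 n)) *m D n w)) G.
Proof.
move=> g cg [M gM]; rewrite /gauss_expect.
pose W n w := Num.sqrt n%:R *: (A n *m invmx (mxsqrt (I1 n)) *m D n w).
have WE n i w : (0 < n)%N -> W n w i ord0
    = Num.sqrt n%:R * ((dir (delta_mx i ord0) n)^T *m D n w) ord0 ord0.
  move=> n0; rewrite mxE dir_mul // (bigD1 i) //= big1 => [|k ki].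
    by rewrite [delta_mx _ _ _ _]mxE !eqxx mul1r addr0.
  by rewrite [delta_mx _ _ _ _]mxE (negbTE ki) mul0r.
have lin n (c : 'I_q -> R) w : (0 < n)%N -> \sum_i c i * W n w i ord0
    = Num.sqrt n%:R * ((dir (\col_i c i) n)^T *m D n w) ord0 ord0.
  move=> n0; rewrite dir_mul // mulr_sumr; apply: eq_bigr => i _; rewrite !mxE.
  by rewrite mulrCA.
have mW n : (0 < n)%N -> forall i, measurable_fun [set: T n] (fun w => W n w i ord0).
  move=> n0 i; rewrite (_ : (fun w => _) = (fun w => \sum_k (Num.sqrt n%:R * (A n *m invmx (mxsqrt (I1 n))) i k)
      * D n w k ord0)).
    by apply: measurable_lincomb => k; exact: mD.
  by apply/funext => w; rewrite !mxE mulr_sumr; apply: eq_bigr => k _; rewrite mulrA.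
apply: (@cvg_bounded_continuous _ _ _ P q W _ _ (std_gauss q)
  (fun z => mxsqrt G *m (\col_i tnth z i))) gM => //.
- by near=> n; apply: mW; near: n; exact: nbhs_infty_gt.
- move=> i; rewrite (_ : (fun z => _) = (fun z : q.-tuple (measurableTypeR R) =>
      \sum_k mxsqrt G i k * tnth z k)).
    by apply: measurable_lincomb => k; exact: measurable_tnth.
  by apply/funext => z; rewrite mxE; apply: eq_bigr => k _; rewrite mxE.
- move=> e e0.
  have /choice[L LP] i := tight (@dir_cvg (delta_mx i ord0 : 'cV[R]_q)) e0.
  exists (\sum_i `|L i|); have {}LP : \forall n \near \oo, forall i, (P n [set w | (L i < `|Num.sqrt n%:R
      * ((dir (delta_mx i ord0) n)^T *m D n w) ord0 ord0|)%R] <= e%:E)%E by exact: filter_forall.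
  have N0 : \forall n \near \oo, (0 < n)%N by exact: nbhs_infty_gt.
  apply: filterS2 N0 LP => n n0 h i.
  apply: le_trans (h i); apply: le_measure; rewrite ?inE.
  + exact/measurable_abs_gt/(mW n n0).
  + rewrite (_ : [set w | _ < _] = [set w | (L i < `|W n w i ord0|)%R]).
      exact/measurable_abs_gt/(mW n n0).
    by apply/seteqP; split=> w /=; rewrite WE.
  + move=> w /=; rewrite -WE //; apply: le_lt_trans; apply: le_trans (ler_norm _) _.
    by rewrite (bigD1 i) //= lerDl sumr_ge0.
- move=> c b; rewrite gauss_cf //.
  apply: cvg_trans (clt (@dir_cvg (\col_i c i)) (b := b)); apply: near_eq_cvg; near=> n.
  have n0 : (0 < n)%N by near: n; exact: nbhs_infty_gt.
  by apply: eq_Rintegral => w _; rewrite lin.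
Unshelve. all: end_near. Qed.
End Multivariate.

(* If [J n] is singular for infinitely many [n], a normalized [u n] in its left
   kernel makes [sqrt n (u n)^T D n] deterministic for these [n], say [k n];
   but then [sin (k n)] and [cos (k n)] are close to the means [0] and
   [exp (- 1/2)] of the sine and cosine of a standard normal variable, against
   [cos^2 + sin^2 = 1]. *)
Lemma invertible_near (J : forall n, 'M[R]_(s n)) (x : forall n, T n -> 'cV[R]_(s n))
    (beta : forall n, 'cV[R]_(s n)) :
  (forall n w, D n w = J n *m x n w + beta n) -> \forall n \near \oo, J n \in unitmx.
Proof.
move=> DE.
(* For invertible [J n] any nonzero vector serves, so that [u] is a full sequence to which [clt]
   applies. *)
have H n : exists u : 'cV[R]_(s n), u != 0 /\ (J n \notin unitmx -> u^T *m J n = 0).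
  have [Ju|/singular_kernel[u u0 uJ]] := boolP (J n \in unitmx); last by exists u.
  by exists (delta_mx (Ordinal (hs0 n)) ord0); split=> //; apply/eqP => /matrixP /(_ (Ordinal (hs0 n)) ord0) /eqP;
    rewrite !mxE !eqxx oner_eq0.
pose u n := sval (cid (H n)).
have uP n : u n != 0 /\ (J n \notin unitmx -> (u n)^T *m J n = 0) by exact: svalP (cid (H n)).
pose nu n := ((u n)^T *m I1 n *m u n) ord0 ord0.
have nu0 n : (0 < n)%N -> 0 < nu n.
  by move=> n0; apply: lt_le_trans (hC1 n0 (u n)); rewrite mulr_gt0 // sqnorm_gt0 //; have [] := uP n.
(* Normalized in the metric of [I1 n], so that the limit variance is 1. *)
pose a n := (Num.sqrt (nu n))^-1 *: u n.
have av : (fun n => ((a n)^T *m I1 n *m a n) ord0 ord0) @ \oo --> (1 : R).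
  apply: cvg_near_cst; near=> n.
  have n0 : (0 < n)%N by near: n; exact: nbhs_infty_gt.
  have E t : ((t *: u n)^T *m I1 n *m (t *: u n)) ord0 ord0 = t ^+ 2 * nu n.
    by rewrite -scalemxAr [(t *: u n)^T]linearZ /= -!scalemxAl [LHS]mxE [X in _ * X]mxE mulrA expr2.
  by rewrite E exprVn sqr_sqrtr ?ltW ?nu0 // mulVf // gt_eqF // nu0.
pose k n := Num.sqrt n%:R * ((a n)^T *m beta n) ord0 ord0.
have cf b (e : R) : 0 < e -> \forall n \near \oo, J n \notin unitmx ->
    `|sin (k n + b) - sin b * expR (- (1 / 2))| <= e.
  move=> e0; have /cvgrPdist_le/(_ e e0) := clt av (b := b); apply: filterS => n h Jn.
  have [_ /(_ Jn) uJ] := uP n.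
  have kE w : Num.sqrt n%:R * ((a n)^T *m D n w) ord0 ord0 = k n.
    rewrite /k DE mulmxDr mulmxA /a linearZ /= -[(_ *: _) *m J n]scalemxAl uJ scaler0 mul0mx add0r //.
  rewrite distrC; apply: le_trans h; under eq_Rintegral do rewrite kE.
  by rewrite Rintegral_cst // [X in fine X](probability_setT (P n)) mulr1.
pose rho := expR (- (1 / 2)) : R.
have rho1 : rho < 1 by rewrite /rho expR_lt1; lra.
have rho0 : 0 < rho by exact: expR_gt0.
(* Small enough for [eta^2 + (rho + eta)^2 < 1]. *)
pose eta := (1 - rho) / 4.
have eta0 : 0 < eta by rewrite divr_gt0 // subr_gt0.
have h1 := cf 0 eta eta0; have h2 := cf (pi / 2) eta eta0.
near=> n; apply: contraT => Jn.
have g1 : `|sin (k n + 0) - sin 0 * rho| <= eta by move: Jn; near: n.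
have g2 : `|sin (k n + pi / 2) - sin (pi / 2) * rho| <= eta by move: Jn; near: n.
move: g1 g2; rewrite addr0 sin0 mul0r subr0 sin_pihalf mul1r sinD cos_pihalf sin_pihalf mulr0 add0r mulr1.
have := cos2Dsin2 (k n); rewrite !ler_norml => E /andP[s1 s2] /andP[c1 c2].
have : eta = (1 - rho) / 4 by [].
nra.
Unshelve. all: end_near. Qed.

End CramerWold.

(** [u'] is [u] padded with zeros; a lower bound on the full quadratic form thus passes to the
    block. *)
Lemma sqnorm_upper_left (R : realType) m s (hs : (s <= m)%N) (A : 'M[R]_m) (u : 'cV[R]_s) :
  exists u' : 'cV[R]_m, (u'^T *m u') ord0 ord0 = (u^T *m u) ord0 ord0 /\
    (u'^T *m A *m u') ord0 ord0 = (u^T *m upper_left hs A *m u) ord0 ord0.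
Proof.
pose Q : 'M[R]_(s, m) := rowsub (widen_ord hs) 1%:M.
have QE (B : 'M[R]_m) : upper_left hs B = Q *m B *m Q^T.
  rewrite /Q -rowsubE; apply/matrixP => i j; rewrite !mxE (bigD1 (widen_ord hs j)) //= big1.
    by rewrite !mxE eqxx mulr1 addr0.
  by move=> k kj; rewrite !mxE eq_sym (negbTE kj) mulr0.
exists (Q^T *m u); split; last by rewrite QE trmx_mul trmxK !mulmxA.
rewrite trmx_mul trmxK -mulmxA [Q *m _]mulmxA.
have -> : Q *m Q^T = 1%:M.
  have := QE 1%:M; rewrite mulmx1 => <-; apply/matrixP => i j; rewrite !mxE.
  by rewrite -!val_eqE.
by rewrite mul1mx.
Qed.

Lemma wp_to_1_near (R : realType) (dT : nat -> measure_display)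
    (T : forall n, measurableType (dT n)) (P : forall n, probability (T n) R)
    (E : forall n, set (T n)) :
  (forall n, (0 < n)%N -> measurable (E n)) ->
  (forall e : R, 0 < e -> \forall n \near \oo, exists B : set (T n),
     [/\ measurable B, (P n B <= e%:E)%E & forall w, ~ B w -> E n w]) ->
  wp_to_1 P E.
Proof.
move=> mE HE.
(* Nothing is assumed at index 0, where the empty set is a measurable choice. *)
exists (fun n => if (0 < n)%N then E n else set0); split.
- by move=> n; case: ifPn => // n0; exact: mE.
- by move=> n; case: ifP => _ w.
apply/fine_cvgP; split; first by near=> n; rewrite fin_num_measure //; case: ifPn => // n0; exact: mE.
apply/cvgrPdist_le => e e0; have hE := HE e e0; near=> n.
have n0 : (0 < n)%N by near: n; exact: nbhs_infty_gt.
have [B [mB PB BE]] : exists B : set (T n),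
     [/\ measurable B, (P n B <= e%:E)%E & forall w, ~ B w -> E n w] by near: n.
rewrite /= n0; have mEn := mE n n0.
have PE1 : fine (P n (E n)) <= 1.
  by rewrite -lee_fin fineK ?fin_num_measure //; exact: (probability_le1 (P n)).
rewrite ger0_norm ?subr_ge0 // lerBlDr -lerBlDl -lee_fin.
have h : (P n (~` B) <= P n (E n))%E.
  by apply: le_measure; rewrite ?inE //; exact: measurableC.
rewrite fineK ?fin_num_measure //; apply: le_trans h.
have -> : P n (~` B) = (1 - P n B)%E by exact: probability_setC.
by rewrite EFinB leeB.
Unshelve. all: end_near. Qed.

Theorem theorem2 (R : realType)
  (* dimensions *)
  (s p : nat -> nat) (hsp : forall n, (s n <= p n)%N)
  (hs0 : forall n, (0 < s n)%N)
  (* the parametric family, its parameter space and the true parameter *)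
  (dX : nat -> measure_display) (X : forall n, measurableType (dX n))
  (mu : forall n, {measure set (X n) -> \bar R})
  (Omega : forall n, set 'cV[R]_(p n))
  (f : forall n, X n -> 'cV[R]_(p n) -> R)
  (b0 : forall n, 'cV[R]_(p n))
  (hdens : forall n, (0 < n)%N -> density_family (mu n) (f n) (Omega n))
  (hb0 : forall n, (0 < n)%N -> Omega n (b0 n))
  (* the samples *)
  (dT : nat -> measure_display) (T : forall n, measurableType (dT n))
  (P : forall n, probability (T n) R)
  (V : forall n, 'I_n -> {RV (P n) >-> X n})
  (* the penalty and the regularization parameters *)
  (pen : R -> R -> R) (lam : nat -> R)
  (hpen0 : forall l : R, 0 < l -> pen l 0 = 0)
  (hpen_ge0 : forall l t : R, 0 < l -> 0 <= t -> 0 <= pen l t)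
  (hlam : forall n, (0 < n)%N -> 0 < lam n)
  (* (i) *)
  (hindep : forall n, (0 < n)%N -> mutually_independent (V n))
  (hlaw : forall n, (0 < n)%N -> forall i : 'I_n,
     has_density (mu n) (V n i) ((f n) ^~ (b0 n)))
  (hsupp : forall n, (0 < n)%N -> common_support (f n) (Omega n))
  (hident : forall n, (0 < n)%N -> identifiable (mu n) (f n) (Omega n))
  (hscore : forall n, (0 < n)%N -> score_identities (mu n) (f n) (b0 n))
  (* (ii) *)
  (hinfo : exists C1 C2 C3 C4 : R, 0 < C1 /\ forall n, (0 < n)%N ->
     [/\ C1 < lambda_min (fisher (mu n) (f n) (b0 n)),
         lambda_max (fisher (mu n) (f n) (b0 n)) < C2,
         forall j k : 'I_(p n),
           (expect (mu n) (f n) (b0 n) (fun x =>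
              ((score (f n) (b0 n) j x * score (f n) (b0 n) k x) ^+ 2)%R)
            < C3%:E)%E
       & forall j k : 'I_(p n),
           (expect (mu n) (f n) (b0 n) (fun x =>
              (hess (f n) (b0 n) j k x ^+ 2)%R) < C4%:E)%E])
  (* (iii) *)
  (omega : forall n, set 'cV[R]_(p n))
  (homega : forall n, (0 < n)%N ->
     [/\ open (omega n), omega n `<=` Omega n & omega n (b0 n)])
  (homega_large : forall K : R, 0 < K -> \forall n \near \oo,
     [set b | enorm (b - b0 n) <= K * Num.sqrt ((p n)%:R / n%:R)] `<=` omega n)
  (M : forall n, 'I_(p n) -> 'I_(p n) -> 'I_(p n) -> X n -> R)
  (hM : forall n, (0 < n)%N -> forall j k l : 'I_(p n),
     measurable_fun [set: X n] (M n j k l))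
  (hthird : forall n, (0 < n)%N ->
     {ae mu n, forall x, 0 < f n x (b0 n) -> forall b, omega n b ->
        third_pderivable (f n x) b /\
        forall j k l : 'I_(p n), `|third (f n) b j k l x| <= M n j k l x})
  (hM2 : exists C5 : R, forall n, (0 < n)%N -> forall j k l : 'I_(p n),
     (expect (mu n) (f n) (b0 n) (fun x => (M n j k l x ^+ 2)%R) < C5%:E)%E)
  (* (iv) *)
  (hnz : forall n, (0 < n)%N -> forall j : 'I_(p n),
     (j < s n)%N -> b0 n j ord0 != 0)
  (hz : forall n, (0 < n)%N -> forall j : 'I_(p n),
     (s n <= j)%N -> b0 n j ord0 = 0)
  (hsignal : (fun n => min_abs (subvec (hsp n) (b0 n)) / lam n) @ \oo --> +oo)
  (* (v) *)
  (hpen_origin : forall K : R, 0 < K ->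
     (\forall n \near \oo, forall t : R,
        0 < t <= K * Num.sqrt ((p n)%:R / n%:R) -> derivable (pen (lam n)) t 1)
     /\ (0 < limn_einf (fun n => origin_slope (pen (lam n)) (lam n)
                                   (K * Num.sqrt ((p n)%:R / n%:R))%R))%E)
  (* (vi) *)
  (ha : (fun n => pen1_max (pen (lam n)) (b0 n) : R^o)
          =O_\oo (fun n => (Num.sqrt n%:R)^-1 : R^o))
  (* (vii) *)
  (hb : (fun n => pen2_max (pen (lam n)) (b0 n)) @ \oo --> (0 : R))
  (* (viii) *)
  (hpen_smooth : exists C D : R, forall n, (0 < n)%N ->
     (forall t : R, 0 < t -> C * lam n < t ->
        derivable (pen (lam n)) t 1 /\ derivable (pen1 (pen (lam n))) t 1) /\
     (forall t1 t2 : R, 0 < t1 -> 0 < t2 -> C * lam n < t1 -> C * lam n < t2 ->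
        `|pen2 (pen (lam n)) t1 - pen2 (pen (lam n)) t2| <= D * `|t1 - t2|))
  (* rates *)
  (hlam0 : lam @ \oo --> (0 : R))
  (hrate : (fun n => Num.sqrt (n%:R / (p n)%:R) * lam n) @ \oo --> +oo)
  (hdim : (fun n => (p n)%:R ^+ 5 / n%:R : R) @ \oo --> (0 : R))
  (* the root-(n/p_n)-consistent local maximizer *)
  (bhat : forall n, T n -> 'cV[R]_(p n))
  (hbhat_meas : forall n, (0 < n)%N -> forall j : 'I_(p n),
     measurable_fun [set: T n] (fun w => bhat n w j ord0))
  (hbhat_max : wp_to_1 P (fun n => [set w |
     local_maximizer (Omega n)
       (penlik (f n) (pen (lam n)) (fun i => V n i w)) (bhat n w)]))
  (hbhat_cons : bigO_p P (fun n w => enorm (bhat n w - b0 n))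
                  (fun n => Num.sqrt ((p n)%:R / n%:R))) :
  (* (1) *)
  wp_to_1 P (fun n => [set w |
    forall j : 'I_(p n), (s n <= j)%N -> bhat n w j ord0 = 0]) /\
  (* (2) *)
  (forall (q : nat) (A : forall n, 'M[R]_(q, s n)) (G : 'M[R]_q),
     G^T = G -> psd G -> (fun n => A n *m (A n)^T) @ \oo --> G ->
     cvg_to_gauss P (fun n w =>
       let I1 := upper_left (hsp n) (fisher (mu n) (f n) (b0 n)) in
       let b01 := subvec (hsp n) (b0 n) in
       let Sigma := pen_Sigma (pen (lam n)) b01 in
       Num.sqrt n%:R *: (A n *m invmx (mxsqrt I1) *m (I1 + Sigma) *m
         (subvec (hsp n) (bhat n w) - b01
          + invmx (I1 + Sigma) *m pen_bias (pen (lam n)) b01))) G).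
Proof.
split.
  apply: wp_to_1_near => [n n0|e e0]; last first.
    exact: (sparse_near hsp hs0 hdens hb0 hlam hindep hlaw hscore hinfo homega
      homega_large hM hthird hM2 hz hpen_origin hrate hdim hbhat_meas hbhat_max hbhat_cons hsupp).
  rewrite (_ : [set w | _] = \bigcap_(j in [set j : 'I_(p n) | (s n <= j)%N])
      [set w | bhat n w j ord0 = 0]); last by apply/seteqP; split=> w h j => [sj|]; exact: h.
  apply: fin_bigcap_measurable => // j _.
  rewrite (_ : [set w | _] = [set: T n] `&` (fun w => bhat n w j ord0) @^-1` [set 0]).
    exact: (hbhat_meas n n0 j).
  by rewrite setTI.
move=> q A G sG pG AG.
have [C1 [C2 [C3 [C4 [C10 hC]]]]] := hinfo.
have hlin := linear_near hs0 hdens hb0 hlam hindep hlaw hscore hinfo homega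
  homega_large hM hthird hM2 hz hsignal hpen_origin hpen_smooth hrate hdim hbhat_meas hbhat_max
  hbhat_cons hsupp.
pose I1 n := upper_left (hsp n) (fisher (mu n) (f n) (b0 n)).
pose b01 n := subvec (hsp n) (b0 n).
pose J n := I1 n + pen_Sigma (pen (lam n)) (b01 n).
pose beta n := pen_bias (pen (lam n)) (b01 n).
pose delta n w := subvec (hsp n) (bhat n w) - b01 n.
(* The linearized statistic without an inverse, so that its limit theorem can precede the
   invertibility of [J n]. *)
pose D n w := J n *m delta n w + beta n.
have symI n : (I1 n)^T = I1 n by rewrite /I1 /upper_left trmx_mxsub fisher_sym.
have hC1 n : (0 < n)%N -> forall u : 'cV[R]_(s n),
    C1 * (u^T *m u) ord0 ord0 <= (u^T *m I1 n *m u) ord0 ord0.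
  move=> n0 u; have [lmin _ _ _] := hC n n0.
  have [u' [<- <-]] := sqnorm_upper_left (hsp n) (fisher (mu n) (f n) (b0 n)) u.
  by apply: lambda_min_quad (ltW lmin); exact: fisher_sym.
have hC3 n : (0 < n)%N -> forall j k : 'I_(p n),
    (expect (mu n) (f n) (b0 n) (fun x =>
       ((score (f n) (b0 n) j x * score (f n) (b0 n) k x) ^+ 2)%R) < C3%:E)%E.
  by move=> n0; have [] := hC n n0.
have mf n : (0 < n)%N -> measurable_fun [set: X n] (f n ^~ (b0 n)).
  by move=> n0; have [] := hdens n n0 _ (hb0 n n0).
have f0 n : (0 < n)%N -> forall x, 0 <= f n x (b0 n).
  by move=> n0; have [] := hdens n n0 _ (hb0 n n0).
have mD n : (0 < n)%N -> forall i, measurable_fun [set: T n] (fun w => D n w i ord0).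
  move=> n0 i; rewrite (_ : (fun w => _) = (fun w => (\sum_k J n i k *
      (bhat n w (widen_ord (hsp n) k) ord0 - b01 n k ord0)) + beta n i ord0)).
    apply: measurable_funD => //; apply: measurable_lincomb => k.
    by apply: measurable_funB => //; exact: hbhat_meas.
  by apply/funext => w; rewrite [LHS]mxE [X in X + _]mxE; congr (_ + _); apply: eq_bigr => k _;
     congr (_ * _); rewrite !mxE.
have clt a v av b := scalar_clt hs0 mf f0 hindep hlaw hscore hC3 C10 hC1 hdim mD hlin (a := a) (v := v) av (b := b).
have tight a v av e := scalar_tight mf f0 hindep hlaw hscore C10 hC1 hdim mD hlin (a := a) (v := v) av (e := e).
(* [invmx] is an inverse only on [unitmx]; the statistic of the statement is thus the one built from
   [D n] for large [n], which is all that the limit sees. *)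
have Ju : \forall n \near \oo, J n \in unitmx.
  exact: (invertible_near hs0 C10 hC1 clt (J := J) (x := delta) (beta := beta)).
move=> g cg gM.
apply: cvg_trans (gauss_clt symI C10 hC1 mD clt tight sG pG AG cg gM).
apply: near_eq_cvg; near=> n; apply: eq_integral => w _; congr (g _)%:E.
have Jn : J n \in unitmx by near: n.
have -> : D n w = J n *m (delta n w + invmx (J n) *m beta n).
  by rewrite mulmxDr [J n *m (invmx _ *m _)]mulmxA mulmxV // mul1mx.
by rewrite mulmxA.
Unshelve. all: end_near. Qed.
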